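(* Let $X$ be a real Banach space, let $(x_n)$ be a sequence in $X$ which does not converge in norm, and let $E\subseteq X^*$ be an isomorphically precisely norming set for $X$ such that \[ \sum_n | x^*(x_{n+1}-x_n)| < \infty \quad \text{for all } x^* \in E. \] Then there exists a subsequence of $(x_n)$ whose closed linear span is an isomorphically polyhedral Banach space. Conversely, if $Y$ is a separable isomorphically polyhedral Banach space, then there exist a sequence $(x_n)$ in $Y$ which does not converge in norm and an isomorphically precisely norming set $E\subseteq Y^*$ for $Y$ such that the closed linear span of $(x_n)$ equals $Y$ and $\sum_n | x^*(x_{n+1}-x_n)| < \infty$ for all $x^* \in E$.
   Context: A set $E \subseteq X^*$ is called isomorphically precisely norming for a Banach space $(X,\|\cdot\|)$ if there exists $C \ge 1$ such that (a) $E \subseteq C\cdot Ba(X^* )$ (where $Ba(X^* )$ is the closed unit ball of $X^*$); (b) $\frac{1}{C}\|x\| \le \sup_{e\in E}|e(x)|$ for all $x \in X$; and (c) for every $x\in X$ there is $e_0 \in E$ with $|e_0(x)| = \sup_{e\in E}|e(x)|$. An infinite dimensional Banach space is polyhedral if the closed unit ball of each of its finite dimensional subspaces has finitely many extreme points. A Banach space is isomorphically polyhedral if it is polyhedral under some equivalent norm. *)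

(* Defs.v *)
From HB Require Import structures.
From mathcomp Require Import all_boot all_order all_algebra.
From mathcomp Require Import all_classical all_reals all_analysis.
Set Implicit Arguments. Unset Strict Implicit. Unset Printing Implicit Defensive.
Import Order.TTheory GRing.Theory Num.Theory.
Import numFieldNormedType.Exports.
Local Open Scope classical_set_scope.
Local Open Scope ring_scope.

Section Defs.
Variable R : realType.

Definition lspan (X : lmodType R) (S : set X) : set X :=
  [set x | exists (n : nat) (c : 'I_n -> R) (v : 'I_n -> X),
      (forall i, S (v i)) /\ x = \sum_(i < n) c i *: v i].

Variable X : normedModType R.

Definition clspan (S : set X) : set X := closure (lspan S).

Definition is_dual (e : X -> R) : Prop :=
  (forall (a : R) (u v : X), e (a *: u + v) = a * e u + e v) /\ continuous e.

(* isomorphically precisely norming set E in the dual X^* ; condition (a) E in C Ba(dual)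
   is written out as ||e|| <= C, i.e. |e x| <= C ||x|| for all x *)
Definition iso_precisely_norming (E : set (X -> R)) : Prop :=
  (forall e, E e -> is_dual e) /\
  exists C : R, 1 <= C /\
    (forall e, E e -> forall x, `|e x| <= C * `|x|) /\
    (forall x, `|x| / C <= sup [set `|e x| | e in E]) /\
    (forall x, exists2 e0, E e0 & `|e0 x| = sup [set `|e x| | e in E]).

Definition extreme_point (K : set X) (p : X) : Prop :=
  K p /\ forall (u v : X) (t : R), K u -> K v -> 0 < t < 1 ->
    p = t *: u + (1 - t) *: v -> u = p /\ v = p.

Definition polyhedral_norm (Y : set X) (N : X -> R) : Prop :=
  (~ exists (n : nat) (v : 'I_n -> X), Y `<=` lspan (range v)) /\
  forall (n : nat) (v : 'I_n -> X), (forall i, Y (v i)) ->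
    finite_set (extreme_point [set y | lspan (range v) y /\ N y <= 1]).

Definition iso_polyhedral (Y : set X) : Prop :=
  exists N : X -> R,
    (forall y1 y2, Y y1 -> Y y2 -> N (y1 + y2) <= N y1 + N y2) /\
    (forall (a : R) y, Y y -> N (a *: y) = `|a| * N y) /\
    (exists a b : R, 0 < a /\ 0 < b /\
       forall y, Y y -> a * `|y| <= N y /\ N y <= b * `|y|) /\
    polyhedral_norm Y N.

Definition separable_space : Prop :=
  exists D : set X, countable D /\ closure D = setT.

End Defs.

(* Main.v *)
(** Forward direction. Give X the norm N = max over E of |e|. If a sequence z is basic and
    every e in E has a finite sum s(e) of the |e(z_i)|, then, with P_m the basis projections,
    the supremum over m and e of (1 + 1/(1 + s_m(e)) + 1/(m+1)) |e(P_m x)|, where at level m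
    the functional e runs over a finite net of E on z_0, ..., z_{m-1}, is an equivalent norm
    on the span. Near each x <> 0 it is a maximum over boundedly many levels, so it is
    polyhedral. It remains to find such a z after passing to a subsequence of x:
    - if x is unbounded, normalize a fast growing subsequence;
    - if x converges on E, or on E together with one more functional, to a function at
      positive distance from X, take x_0 and the differences of a subsequence;
    - otherwise x converges on E to a point of X, and bounded variation makes a sparse
      subsequence of the differences from that point summable on E.

    Converse. In a separable polyhedral space, Baire's theorem (twice) shows that every x is
    normed by a functional h such that N = h on some open set; there are countably many such
    h (Fonf; the argument is Vesely's). Interleave small multiples of a dense sequence with
    unit vectors k_n killed by the first n of these functionals. *)
Require Import Defs.
From HB Require Import structures.
From mathcomp Require Import all_boot all_order all_algebra.
From mathcomp Require Import all_classical all_reals all_analysis.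
From mathcomp Require Import ring lra.
Set Implicit Arguments. Unset Strict Implicit. Unset Printing Implicit Defensive.
Import Order.TTheory GRing.Theory Num.Theory.
Import numFieldNormedType.Exports.
Local Open Scope classical_set_scope.
Local Open Scope ring_scope.


(** * Linear algebra *)

(** The norm N itself need not be polyhedral on the span, and the sums s(e), finite for each e in E,
    need not be uniformly bounded; if they were, z would be equivalent to the unit vector basis of
    c_0. The weight 1 + 1/(1 + s) + 1/(m + 1) is built to cope with this. Restricting e to a lower
    level lowers its sum from s to s1. This raises 1/(1 + s) by at least (s - s1)/S^2 as long as 1 +
    s <= S, while the value at x drops by at most s - s1 times the size of the late coordinates of
    x. Gain and loss are linear in the same quantity, so the gain wins once those coordinates are
    small. Functionals of high level and very large sum have weight close to 1 and lose against the
    functional attaining N x, whose weight stays above 1 by a fixed amount. The term 1/(m + 1),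
    being larger at lower levels, pays for replacing a functional by a member of a finite net. *)

Section Linear.
Variables (R : realType) (X : normedModType R).
Implicit Types (e : X -> R) (S : set X).

Definition linear_form e := forall (a : R) (u v : X), e (a *: u + v) = a * e u + e v.

Lemma linear_form0 e : linear_form e -> e 0 = 0.
Proof. by move=> /(_ (-1) 0 0); rewrite scaler0 addr0 mulN1r addNr. Qed.

Lemma linear_formZ e a u : linear_form e -> e (a *: u) = a * e u.
Proof. by move=> le; have := le a u 0; rewrite addr0 linear_form0 // addr0. Qed.

Lemma linear_formD e u v : linear_form e -> e (u + v) = e u + e v.
Proof. by move=> le; have := le 1 u v; rewrite scale1r mul1r. Qed.

Lemma linear_formB e u v : linear_form e -> e (u - v) = e u - e v.
Proof. by move=> le; rewrite addrC -scaleN1r le mulN1r addrC. Qed.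

Lemma linear_form_sum e (I : Type) (r : seq I) (P : pred I) (F : I -> X) :
  linear_form e -> e (\sum_(i <- r | P i) F i) = \sum_(i <- r | P i) e (F i).
Proof.
move=> le; elim/big_rec2: _ => [|i a b _ <-]; first exact: linear_form0.
exact: linear_formD.
Qed.

Lemma linear_form_lc e n (c : 'I_n -> R) (v : 'I_n -> X) :
  linear_form e -> e (\sum_i c i *: v i) = \sum_i c i * e (v i).
Proof.
by move=> le; rewrite linear_form_sum//; apply: eq_bigr => i _; exact: linear_formZ.
Qed.

Definition lsubspace S := S 0 /\ forall (a : R) u v, S u -> S v -> S (a *: u + v).

Lemma lsubspaceZ S a u : lsubspace S -> S u -> S (a *: u).
Proof. by move=> [S0 SL] Su; have := SL a _ _ Su S0; rewrite addr0. Qed.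

Lemma lsubspaceD S u v : lsubspace S -> S u -> S v -> S (u + v).
Proof. by move=> [S0 SL] Su Sv; have := SL 1 _ _ Su Sv; rewrite scale1r. Qed.

Lemma lsubspaceB S u v : lsubspace S -> S u -> S v -> S (u - v).
Proof. by move=> [S0 SL] Su Sv; have := SL (-1) _ _ Sv Su; rewrite scaleN1r addrC. Qed.

Lemma lsubspace_sum S (I : Type) (r : seq I) (P : pred I) (c : I -> R) (F : I -> X) :
  lsubspace S -> (forall i, P i -> S (F i)) -> S (\sum_(i <- r | P i) c i *: F i).
Proof.
move=> sS SF; elim/big_rec: _ => [|i a Pi Sa]; first exact: sS.1.
by apply: sS.2 => //; exact: SF.
Qed.

Lemma lspan_min S P : lsubspace P -> S `<=` P -> lspan S `<=` P.
Proof.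
move=> sP SP _ [n [c [v [Sv ->]]]].
by apply: lsubspace_sum => // i _; apply: SP.
Qed.

Lemma subset_lspan S : S `<=` lspan S.
Proof.
move=> u Su; exists 1%N, (fun=> 1), (fun=> u); split=> //.
by rewrite big_ord1 scale1r.
Qed.

Lemma lsubspace_lspan S : lsubspace (lspan S).
Proof.
split.
  by exists 0%N, (fun=> 0), (fun=> 0); split=> [[]//|]; rewrite big_ord0.
move=> a _ _ [n [c [v [Sv ->]]]] [m [d [w [Sw ->]]]].
exists (n + m)%N, (fun i => match fintype.split i with inl j => a * c j | inr j => d j end),
  (fun i => match fintype.split i with inl j => v j | inr j => w j end).
split; first by move=> i; case: fintype.splitP => j _.
rewrite big_split_ord /=; congr (_ + _).
  rewrite scaler_sumr; apply: eq_bigr => i _.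
  case: fintype.splitP => j /= ij; first by rewrite scalerA (_ : i = j)//; exact: val_inj.
  by have := ltn_ord i; rewrite ij ltnNge leq_addr.
apply: eq_bigr => i _.
case: fintype.splitP => j /= ij; last by rewrite (_ : i = j)//; apply/val_inj/(@addnI n).
by have := ltn_ord j; rewrite -ij ltnNge leq_addr.
Qed.

Lemma lspan_ordP n (v : 'I_n -> X) u :
  lspan (range v) u <-> exists c : 'I_n -> R, u = \sum_i c i *: v i.
Proof.
split=> [|[c ->]]; last first.
  by apply: lsubspace_sum (lsubspace_lspan _) _ => i _; apply: subset_lspan; exists i.
move: u; apply: lspan_min; first split.
- by exists (fun=> 0); rewrite big1// => i _; rewrite scale0r.
- move=> a _ _ [c ->] [d ->]; exists (fun i => a * c i + d i).
  rewrite scaler_sumr -big_split; apply: eq_bigr => i _ /=.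
  by rewrite scalerDl scalerA.
- move=> _ [i _ <-]; exists (fun j => (j == i)%:R).
  rewrite (bigD1 i)//= eqxx scale1r big1 ?addr0// => j /negbTE ->.
  by rewrite scale0r.
Qed.

Lemma lspan_natP (z : nat -> X) u :
  lspan (range z) u <-> exists n (b : nat -> R), u = \sum_(i < n) b i *: z i.
Proof.
split=> [|[n [b ->]]]; last first.
  by apply: lsubspace_sum (lsubspace_lspan _) _ => i _; apply: subset_lspan; exists i.
move: u; apply: lspan_min; first split.
- by exists 0%N, (fun=> 0); rewrite big_ord0.
- move=> a _ _ [n [c ->]] [m [d ->]].
  exists (maxn n m), (fun i => a * (if (i < n)%N then c i else 0) + (if (i < m)%N then d i else 0)).
  rewrite (big_ord_widen (maxn n m) (fun i => c i *: z i)) ?leq_maxl//.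
  rewrite (big_ord_widen (maxn n m) (fun i => d i *: z i)) ?leq_maxr//.
  rewrite [X in a *: X + _]big_mkcond [X in _ + X]big_mkcond /=.
  rewrite scaler_sumr -big_split; apply: eq_bigr => i _ /=.
  by rewrite scalerDl -scalerA; case: ifP; case: ifP; rewrite ?scale0r.
- move=> _ [i _ <-]; exists i.+1, (fun j => (j == i)%:R).
  rewrite big_ord_recr/= eqxx scale1r big1 ?add0r// => j _.
  by rewrite (ltn_eqF (ltn_ord j)) scale0r.
Qed.

(** A matrix with more rows than columns has a nonzero left kernel. This serves both to bound the
    size of independent families and to find common zeros of finitely many functionals. *)
Lemma ex_kernel n (A : 'I_n.+1 -> 'I_n -> R) :
  exists2 c : 'I_n.+1 -> R, (exists i, c i != 0) & forall j, \sum_i c i * A i j = 0.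
Proof.
pose M := \matrix_(i, j) A i j.
have : kermx M != 0.
  by rewrite -mxrank_eq0 mxrank_ker subn_eq0 -ltnNge ltnS rank_leq_col.
case/matrix0Pn => i [j Mij]; exists (fun k => kermx M i k); first by exists j.
move=> k; have /matrixP/(_ i k) := mulmx_ker M.
rewrite mxE [in X in _ = X]mxE => kM; rewrite -[RHS]kM.
by apply: eq_bigr => l _; rewrite [M _ _]mxE.
Qed.

Definition finite_dim S := exists n (v : 'I_n -> X), S `<=` lspan (range v).

Definition independent n (u : 'I_n -> X) :=
  forall c, \sum_i c i *: u i = 0 -> forall i, c i = 0.

Lemma not_independent n (v : 'I_n -> X) (u : 'I_n.+1 -> X) :
  (forall i, lspan (range v) (u i)) -> ~ independent u.
Proof.
move=> uv ind.
have /choice[A Au] : forall i, exists a : 'I_n -> R, u i = \sum_j a j *: v j.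
  by move=> i; apply/lspan_ordP.
have [c [i /eqP ci0] cA] := ex_kernel A.
apply: ci0; apply: ind; under eq_bigr => k _ do rewrite Au scaler_sumr.
rewrite exchange_big big1// => j _.
by under eq_bigr => k _ do rewrite scalerA; rewrite -scaler_suml cA scale0r.
Qed.

Lemma independent_infinite_dim S (z : nat -> X) : (forall n, S (z n)) ->
  (forall n (b : nat -> R), \sum_(i < n) b i *: z i = 0 -> forall i, (i < n)%N -> b i = 0) ->
  ~ finite_dim S.
Proof.
move=> Sz ind [n [v Sv]]; apply: (@not_independent n v (fun i => z i)).
  by move=> i; apply/Sv.
move=> c; pose b i := if insub i is Some j then c j else 0.
have bE (i : 'I_n.+1) : b i = c i by rewrite /b valK.
move=> cz i; rewrite -bE; apply: ind (ltn_ord i).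
by rewrite -[RHS]cz; apply: eq_bigr => j _; rewrite bE.
Qed.

Lemma ex_independent S n : ~ finite_dim S ->
  exists2 u : 'I_n -> X, (forall i, S (u i)) & independent u.
Proof.
move=> nfd; elim: n => [|n [u Su indu]]; first by exists (fun=> 0) => [[]|? ? []].
have [w Sw nw] : exists2 w, S w & ~ lspan (range u) w.
  apply: contrapT => H; apply: nfd; exists n, u => w Sw.
  by apply: contrapT => nw; apply: H; exists w.
exists (fun i => if unlift ord_max i is Some j then u j else w).
  by move=> i; case: unliftP.
move=> c; rewrite big_ord_recr /= unlift_none.
under eq_bigr => i _.
  rewrite (_ : widen_ord _ i = lift ord_max i); last by apply: val_inj; rewrite /= /bump leqNgt ltn_ord.
  rewrite liftK; over.
move=> c0.
have cm0 : c ord_max = 0.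
  apply: contrapT => /eqP cm; apply: nw; apply/lspan_ordP.
  exists (fun i => - (c ord_max)^-1 * c (lift ord_max i)).
  apply: (scalerI cm); rewrite scaler_sumr.
  under eq_bigr => i _ do rewrite scalerA mulrA mulrN mulfV// -scalerA scaleN1r.
  by rewrite sumrN; apply/eqP; rewrite -subr_eq0 opprK addrC c0.
move: c0; rewrite cm0 scale0r addr0 => /(indu (fun i => c (lift ord_max i))) ci0 i.
by case: (unliftP ord_max i) => [j ->|->//]; exact: ci0.
Qed.

Lemma lspan_independent n (v : 'I_n -> X) :
  exists m (w : 'I_m -> X), independent w /\ lspan (range v) = lspan (range w).
Proof.
elim: n v => [|n IH] v.
  by exists 0%N, v; split => // c _ [].
have [ind|] := pselect (independent v); first by exists n.+1, v.
move=> /existsNP[c /not_implyP[c0 /existsNP[i /eqP ci]]].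
have [m [w [indw vw]]] := IH (fun j => v (lift i j)).
exists m, w; split=> //; rewrite -vw; apply/seteqP; split; last first.
  apply: lspan_min; first exact: lsubspace_lspan.
  by move=> _ [j _ <-]; apply: subset_lspan; exists (lift i j).
apply: lspan_min; first exact: lsubspace_lspan.
move=> _ [k _ <-]; case: (unliftP i k) => [j ->|->].
  by apply: subset_lspan; exists j.
apply/lspan_ordP; exists (fun j => - (c i)^-1 * c (lift i j)).
apply: (scalerI ci); rewrite scaler_sumr.
under eq_bigr => j _ do rewrite scalerA mulrA mulrN mulfV// -scalerA scaleN1r.
apply/eqP; rewrite sumrN -subr_eq0 opprK; apply/eqP; rewrite -[RHS]c0 [RHS](bigD1 i)//=; congr (_ + _).
rewrite [RHS](reindex_omap (lift i) (unlift i)) /=; last by move=> j; case: unliftP => [k' ->|->] /=; rewrite ?eqxx.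

by apply: eq_bigl => j; rewrite liftK eqxx eq_sym neq_lift.
Qed.

End Linear.

(** * Seminorms, nets and extreme points *)

Section Seminorm.
Variables (R : realType) (X : normedModType R).

Definition seminorm (N : X -> R) :=
  (forall u v, N (u + v) <= N u + N v) /\ (forall (a : R) u, N (a *: u) = `|a| * N u).

Variables (N : X -> R) (sN : seminorm N).

Lemma seminormD u v : N (u + v) <= N u + N v. Proof. exact: sN.1. Qed.

Lemma seminormZ a u : N (a *: u) = `|a| * N u. Proof. exact: sN.2. Qed.

Lemma seminorm0 : N 0 = 0.
Proof. by rewrite -[0](scale0r 0) seminormZ normr0 mul0r. Qed.

Lemma seminormN u : N (- u) = N u.
Proof. by rewrite -scaleN1r seminormZ normrN1 mul1r. Qed.

Lemma seminorm_ge0 u : 0 <= N u.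
Proof. by have := seminormD u (- u); rewrite subrr seminorm0 seminormN; lra. Qed.

Lemma seminorm_dist u v : N (u - v) = N (v - u).
Proof. by rewrite -opprB seminormN. Qed.

Lemma seminorm_tri w u v : N (u - v) <= N (u - w) + N (w - v).
Proof. by apply: le_trans (seminormD _ _); rewrite addrA subrK. Qed.

Lemma seminorm_le_sub u v : N u <= N v + N (u - v).
Proof. by apply: le_trans (seminormD _ _); rewrite addrC subrK. Qed.

Lemma seminorm_sum n (F : 'I_n -> X) : N (\sum_i F i) <= \sum_i N (F i).
Proof.
elim/big_rec2: _ => [|i x y _ h]; first by rewrite seminorm0.
by apply: le_trans (seminormD _ _) _; rewrite lerD2l.
Qed.

End Seminorm.

Section Tools.
Variable R : realType.

(** Dependent choice in which each term may depend on the whole list of earlier ones; [hist k] is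
    that list. *)
Lemma ex_history (P : seq nat -> nat -> Prop) : (forall s, exists n, P s n) ->
  exists phi : nat -> nat, forall k, P (mkseq phi k) (phi k).
Proof.
move=> /choice[f Pf].
pose hist := fix hist k := if k is k'.+1 then rcons (hist k') (f (hist k')) else [::].
have hE k : hist k = mkseq (fun k => f (hist k)) k.
  by elim: k => [//|k IH]; rewrite mkseqS -IH.
by exists (fun k => f (hist k)) => k; rewrite -hE; exact: Pf.
Qed.

(** The [n] bounded values are rounded to a grid of mesh [eps]: there are finitely many cells, and
    one index is picked in each cell that is met. *)
Lemma finite_net (I : Type) (i0 : I) (u : nat -> I -> R) (B : nat -> R) n eps :
  0 < eps -> (forall l i, `|u l i| <= B l) ->
  exists K (G : nat -> I), forall i, exists2 j, (j < K)%N &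
    forall l, (l < n)%N -> `|u l i - u l (G j)| <= eps.
Proof.
move=> e0 uB.
pose t l i := Num.truncn ((u l i + B l) / eps).
pose M := \max_(l < n) Num.truncn (2 * B l / eps).
have pos l i : 0 <= (u l i + B l) / eps.
  by rewrite divr_ge0 ?(ltW e0)//; move: (uB l i); rewrite ler_norml => /andP[]; lra.
have tM (l : 'I_n) i : (t l i < M.+1)%N.
  rewrite ltnS; apply: leq_trans (leq_bigmax l); apply: le_truncn.
  by rewrite ler_pM2r ?invr_gt0//; move: (uB l i); rewrite ler_norml => /andP[]; lra.
pose q i : {ffun 'I_n -> 'I_M.+1} := [ffun l : 'I_n => Ordinal (tM l i)].
have /choice[G qG] : forall c, exists i, forall i', q i' = c -> q i = c.
  by move=> c; have [[i <-]|nc] := pselect (exists i, q i = c); [exists i|exists i0 => i' h; case: nc; exists i'].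
(* All cells are counted, empty ones included; indices out of range fall back on [i0]. *)
exists #|{ffun 'I_n -> 'I_M.+1}|,
  (fun j => if insub j is Some j' then G (enum_val (j' : 'I_#|{ffun 'I_n -> 'I_M.+1}|)) else i0).
move=> i; exists (enum_rank (q i)) => //.
move=> l ln; rewrite valK enum_rankK.
have /ffunP/(_ (Ordinal ln)) := qG _ _ (erefl (q i)).
rewrite !ffunE => -[tt].
have := truncn_itv (pos l i); have := truncn_itv (pos l (G (q i))).
rewrite -/(t l i) -/(t l (G (q i))) tt !ler_pdivlMr// !ltr_pdivrMr// => /andP[a b] /andP[c d].
by rewrite ler_norml; move: a b c d; rewrite -[(_.+1)%:R]natr1; nra.
Qed.

(** McShane's extension: the supremum of the cones [v i - K * N (s i - y)]. The family [s] may
    repeat points, since the Lipschitz bound makes [v] a function of [s i]; below, one vector has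
    many representations as a combination. *)
Lemma mcshane (X : normedModType R) (N : X -> R) (J : Type) (s : J -> X) (v : J -> R) (K : R) :
  seminorm N -> J -> 0 <= K -> (forall i j, `|v i - v j| <= K * N (s i - s j)) ->
  exists2 g : X -> R, (forall x y, `|g x - g y| <= K * N (x - y)) & forall i, g (s i) = v i.
Proof.
move=> sN i0 K0 vL; pose A y := range (fun i => v i - K * N (s i - y)).
have A0 y : A y !=set0 by exists (v i0 - K * N (s i0 - y)), i0.
have Aub j : ubound (A (s j)) (v j).
  by move=> _ [i _ <-]; have := vL i j; rewrite ler_norml => /andP[]; lra.
have AL x y b : ubound (A y) b -> ubound (A x) (b + K * N (x - y)).
  move=> yb _ [i _ <-]; have := yb (v i - K * N (s i - y)) (imageT _ _).
  have := ler_wpM2l K0 (seminorm_tri sN x (s i) y).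
  by rewrite mulrDr; lra.
have hub y : has_ubound (A y).
  by exists (v i0 + K * N (y - s i0)); apply: AL; exact: Aub.
have gL x y : sup (A x) <= sup (A y) + K * N (x - y).
  by apply: ge_sup => //; apply: AL => r Ar; apply: ub_le_sup.
exists (fun y => sup (A y)) => [x y|i].
  by have := gL x y; have := gL y x; rewrite (seminorm_dist sN y x) ler_norml; lra.
apply/eqP; rewrite eq_le; apply/andP; split; first exact: (ge_sup (A0 _) (Aub i)).
by apply: ub_le_sup => //; exists i => //; rewrite subrr (seminorm0 sN) mulr0 subr0.
Qed.

Lemma finite_set_fin_inj (T : Type) (F : finType) (f : T -> F) (A : set T) :
  (forall x y, A x -> A y -> f x = f y -> x = y) -> finite_set A.
Proof.
move=> inj; have [[x0 _]|A0] := pselect (exists x, A x); last first.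
  by rewrite (_ : A = set0)// -subset0 => x Ax; apply: A0; exists x.
have /choice[g gP] : forall c, exists x, forall y, A y -> f y = c -> x = y.
  move=> c; have [[y Ay <-]|nc] := pselect (exists2 y, A y & f y = c).
    by exists y => z Az /esym; exact: inj.
  by exists x0 => z Az fz; case: nc; exists z.
apply: (@sub_finite_set _ _ (g @` [set: F])); last exact/finite_image/finite_finset.
by move=> x Ax; exists (f x) => //; exact: gP.
Qed.

(* An extreme point is determined by the set of constraints active at it. *)
Lemma finite_extreme_points (X : normedModType R) (F : set X) (N : X -> R) (T : finType)
    (g : T -> X -> R) :
  lsubspace F ->
  (forall t a u v, F u -> F v -> g t (a *: u + v) = a * g t u + g t v) ->
  (forall y, F y -> (N y <= 1 <-> forall t, `|g t y| <= 1)) ->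
  finite_set (extreme_point [set y | F y /\ N y <= 1]).
Proof.
move=> sF gL gN.
apply: (@finite_set_fin_inj _ _ (fun y => [ffun t => (g t y == 1, g t y == -1)])).
move=> p q [[Fp Np] ep] [[Fq Nq] _] /ffunP pq.
have gp := (gN p Fp).1 Np.
have gq := (gN q Fq).1 Nq.
have Fd : F (q - p) by exact: (lsubspaceB sF).
have gD t a : g t (a *: (q - p) + p) = a * (g t q - g t p) + g t p.
  by rewrite gL// [q - p]addrC -scaleN1r gL// mulN1r [- _ + _]addrC.
(* Inactive constraints have slack at [p]; active ones take the same value at [q], so they vanish on
   [q - p]. Hence [p] is the midpoint of a segment of direction [q - p] inside the ball. *)
have [r r0 rP] : exists2 r, 0 < r & forall t, `|r * (g t q - g t p)| + `|g t p| <= 1 \/ g t q = g t p.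
  have [d d0 dP] : exists2 d, 0 < d & forall t, `|g t p| < 1 -> d <= 1 - `|g t p|.
    exists (\big[Order.min/1]_(t | `|g t p| < 1) (1 - `|g t p|)).
      by apply: lt_bigmin => // t; rewrite subr_gt0.
    by move=> t tp; apply: bigmin_le_cond.
  exists (d / 2); first by rewrite divr_gt0.
  move=> t; have [tp|tp] := ltP `|g t p| 1.
    left; have := dP _ tp; rewrite normrM gtr0_norm ?divr_gt0//.
    have := ler_normB (g t q) (g t p); have := gq t; have := gp t => *.
    have : d / 2 * `|g t q - g t p| <= d / 2 * 2 by apply: ler_wpM2l; lra.
    by lra.
  right; move: (pq t); rewrite !ffunE => -[h1 h2].
  have : `|g t p| = 1 by apply/eqP; rewrite eq_le gp.
  case: (ler0P (g t p)) => _ h.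
    have e2 : g t p = -1 by lra.
    by move: h2; rewrite e2 eqxx => /esym/eqP.
  by move: h1; rewrite h eqxx => /esym/eqP.
have K s : s = 1 \/ s = -1 -> [set y | F y /\ N y <= 1] (s * r *: (q - p) + p).
  move=> s1; split; first by apply: sF.2.
  apply/gN; first by apply: sF.2.
  move=> t; rewrite gD; case: (rP t) => [h|->]; last by rewrite subrr mulr0 add0r.
  apply: le_trans (ler_normD _ _) _; apply: le_trans h; rewrite lerD2r -mulrA normrM.
  by case: s1 => ->; rewrite ?normrN normr1 mul1r.
have [||h _] := ep _ _ 2^-1 (K 1 (or_introl erefl)) (K (-1) (or_intror erefl)).
- by lra.
- move: (q - p) => d; rewrite !scalerDr !scalerA addrACA -!scalerDl.
  have -> : 2^-1 * (1 * r) + (1 - 2^-1) * (-1 * r) = 0 by lra.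
  have -> : 2^-1 + (1 - 2^-1) = 1 :> R by lra.
  by rewrite scale0r add0r scale1r.
- move: h; rewrite mul1r => /(congr1 (fun x => x - p)); rewrite addrK subrr => /eqP.
  by rewrite scaler_eq0 (gt_eqF r0)/= subr_eq0 => /eqP.
Qed.

End Tools.

(** * Uniformity on finite-dimensional subspaces *)

Section FiniteDimension.
Variables (R : realType) (X : normedModType R).

(** Compactness of the unit sphere in coordinates: [Q M] holds locally for some [M], grows with [M]
    and is stable under scaling, so one [M] serves the whole sphere and then the whole subspace.
    Passing to independent generators makes [N] positive on that sphere. *)
Lemma finite_dim_uniform n (v : 'I_n -> X) (N : X -> R) (Q : nat -> X -> Prop) :
  seminorm N -> (forall x, N x = 0 -> x = 0) ->
  (forall M, Q M 0) ->
  (forall M M' y, (M <= M')%N -> Q M y -> Q M' y) ->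
  (forall M (t : R) y, lspan (range v) y -> Q M y -> Q M (t *: y)) ->
  (forall x, lspan (range v) x -> 0 < N x -> exists2 r, 0 < r &
     exists M, forall y, lspan (range v) y -> N (y - x) < r -> Q M y) ->
  exists M, forall y, lspan (range v) y -> Q M y.
Proof.
move=> sN N0 Q0 Qmono QZ Qloc.
have [m [w [indw vw]]] := lspan_independent v.
rewrite vw in QZ Qloc *.
pose L (c : 'rV[R]_m) := \sum_j c 0 j *: w j.
have Lw c : lspan (range w) (L c) by apply/lspan_ordP; exists (c 0).
have LZ t c : L (t *: c) = t *: L c.
  by rewrite scaler_sumr; apply: eq_bigr => j _; rewrite mxE scalerA.
have LB c d : L c - L d = L (c - d).
  by rewrite /L -sumrB; apply: eq_bigr => j _; rewrite !mxE scalerBl.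
pose S := \sum_j N (w j).
have S0 : 0 <= S by apply: sumr_ge0 => j _; exact: seminorm_ge0.
have LN c : N (L c) <= `|c| * S.
  apply: le_trans (seminorm_sum sN _) _; rewrite mulr_sumr; apply: ler_sum => j _.
  rewrite (seminormZ sN) ler_wpM2r ?seminorm_ge0//.
  rewrite (_ : `|c| = mx_norm c)// mx_normrE.
  by have := @le_bigmax _ _ _ 0 (fun ij : 'I_1 * 'I_m => `|c ij.1 ij.2|) (0, j).
pose A := [set c : 'rV[R]_m | `|c| = 1].
have cA : compact A.
  apply: bounded_closed_compact.
    by exists 1; split=> // M M1 c /= ->; exact: ltW.
  apply: (@closed_comp _ _ (fun c : 'rV[R]_m => `|c|) [set 1]); last exact: closed_eq.
  by move=> c _; exact: norm_continuous.
have := (compact_near_coveringP A).1 cA nat \oo (fun M c => Q M (L c)) _.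
case.
  move=> c Ac.
  have Lc0 : 0 < N (L c).
    rewrite lt_neqAle (seminorm_ge0 sN) andbT eq_sym; apply/eqP => /N0 /indw c0.
    have c00 : c = 0 by apply/rowP => j; rewrite mxE c0.
    by move: Ac; rewrite /A/= c00 normr0 => /esym/eqP; rewrite oner_eq0.
  have [r r0 [M QM]] := Qloc _ (Lw c) Lc0.
  exists (ball c (r / (S + 1)), [set k | (M <= k)%N]); first split=> /=.
  - by apply: nbhsx_ballx; rewrite divr_gt0//; lra.
  - by exists M.
  move=> [c' k] /= [cc' Mk]; apply: Qmono Mk _; apply: QM => //.
  rewrite LB; apply: le_lt_trans (LN _) _.
  move: cc'; rewrite -ball_normE /= distrC ltr_pdivlMr; last by lra.
  by have := normr_ge0 (c' - c); nra.
move=> M _ QM; exists M => y /lspan_ordP[c ->].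
pose d := \row_j c j.
have -> : \sum_i c i *: w i = L d by apply: eq_bigr => j _; rewrite mxE.
have [->|d0] := eqVneq d 0.
  by rewrite -[0](scale0r 0) LZ scale0r.
rewrite -[d]scale1r -(@mulfV _ `|d|) ?normr_eq0// -scalerA LZ; apply: QZ => //.
by apply: (QM M) => //=; rewrite /A/= normrZ normfV normr_id mulVf ?normr_eq0.
Qed.

Lemma le_of_small (K x y : R) : 0 <= K -> (forall e : R, 0 < e -> x <= y + K * e) -> x <= y.
Proof.
move=> K0 h; rewrite leNgt; apply/negP => yx.
have K1 : 0 < K + 1 by lra.
have e0 : 0 < (x - y) / (2 * (K + 1)) by apply: divr_gt0; lra.
have := h _ e0; set e := _ / _ in e0 *.
have : e * (2 * (K + 1)) = x - y by rewrite /e divfK// gt_eqF//; lra.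
by nra.
Qed.

Lemma lc_widen (z : nat -> X) (b : nat -> R) n m : (n <= m)%N ->
  \sum_(i < n) b i *: z i = \sum_(i < m) (if (i < n)%N then b i else 0) *: z i.
Proof.
move=> nm; rewrite (big_ord_widen m (fun i => b i *: z i) nm) big_mkcond /=.
by apply: eq_bigr => i _; case: ifP => //; rewrite scale0r.
Qed.

End FiniteDimension.

(** * Coordinates on the closed span of a basic sequence *)

Section Coordinates.
Variables (R : realType) (X : normedModType R) (N : X -> R).
Hypothesis sN : seminorm N.
Variables (z : nat -> X) (k : R).
Hypothesis k0 : 0 <= k.
Hypothesis basic : forall n (b : nat -> R) m, (m <= n)%N ->
  N (\sum_(i < m) b i *: z i) <= k * N (\sum_(i < n) b i *: z i).
Hypothesis coef : forall n (b : nat -> R) j, (j < n)%N ->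
  `|b j| <= k * N (\sum_(i < n) b i *: z i).

(** The closure is taken for [N] instead of the norm of [X], because every estimate on basic
    sequences is in terms of [N]. *)
Definition nclosure (x : X) :=
  forall e : R, 0 < e -> exists2 s, lspan (range z) s & N (x - s) < e.

Lemma nclosure_lspan s : lspan (range z) s -> nclosure s.
Proof. by move=> ss e e0; exists s => //; rewrite subrr (seminorm0 sN). Qed.

Lemma lsubspace_nclosure : lsubspace nclosure.
Proof.
split; first exact/nclosure_lspan/(lsubspace_lspan _).1.
move=> a u v Zu Zv e e0.
have e1 : 0 < e / (`|a| + 1) / 2.
  by have := normr_ge0 a => h; rewrite !divr_gt0//; lra.
have [s ss us] := Zu _ e1; have [t tt vt] := Zv (e / 2) ltac:(lra).
exists (a *: s + t); first by apply: (lsubspace_lspan _).2.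
rewrite opprD addrACA -scalerBr; apply: le_lt_trans (seminormD sN _ _) _.
rewrite (seminormZ sN).
have : `|a| * N (u - s) <= (`|a| + 1) * (e / (`|a| + 1) / 2).
  by apply: ler_pM; rewrite ?normr_ge0 ?(seminorm_ge0 sN) ?ltW//; lra.
by rewrite mulrA mulrCA mulfV ?mulr1; have := normr_ge0 a; lra.
Qed.

(** Density argument: an inequality between Lipschitz functions passes from the span to its
    closure. *)
Lemma nclosure_le (f : X -> R) (L : R) : 0 <= L ->
  (forall x y, f x - f y <= L * N (x - y)) ->
  (forall s, lspan (range z) s -> f s <= 0) -> forall x, nclosure x -> f x <= 0.
Proof.
move=> L0 fL fs x Zx; apply: (le_of_small L0) => e e0; rewrite add0r.
have [s ss xs] := Zx _ e0; have := fL x s; have := fs _ ss.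
by have := ler_wpM2l L0 (ltW xs); lra.
Qed.

(* The coordinate function on the span is extended to X as a Lipschitz, in general nonlinear,
   function; it is linear on the closure by density. *)
Lemma ex_coord j : exists2 g : X -> R, (forall x y, `|g x - g y| <= k * N (x - y)) &
  forall n (b : nat -> R), g (\sum_(i < n) b i *: z i) = if (j < n)%N then b j else 0.
Proof.
have [|g gL gE] := @mcshane _ _ N (nat * (nat -> R))%type
    (fun p => \sum_(i < p.1) p.2 i *: z i) (fun p => if (j < p.1)%N then p.2 j else 0) k sN (0%N, fun=> 0) k0.
  move=> [n b] [m d] /=.
  rewrite (lc_widen z b (leq_maxl n m)) (lc_widen z d (leq_maxr n m)) -sumrB.
  under eq_bigr => i _ do rewrite -scalerBl.
  pose c i := (if (i < n)%N then b i else 0) - (if (i < m)%N then d i else 0).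
  have [jm|jm] := ltnP j (maxn n m).
    exact: (@coef _ c j jm).
  rewrite !ifN ?subrr ?normr0 ?mulr_ge0 ?(seminorm_ge0 sN)// -leqNgt.
    exact: leq_trans (leq_maxr _ _) jm.
  exact: leq_trans (leq_maxl _ _) jm.
by exists g => // n b; have := gE (n, b).
Qed.

Definition coord_fun j : X -> R := projT1 (cid2 (ex_coord j)).

Lemma coord_lip j x y : `|coord_fun j x - coord_fun j y| <= k * N (x - y).
Proof. by rewrite /coord_fun; case: cid2. Qed.

Lemma coord_lc j n (b : nat -> R) :
  coord_fun j (\sum_(i < n) b i *: z i) = if (j < n)%N then b j else 0.
Proof. by rewrite /coord_fun; case: cid2 => /= g _ ->. Qed.

Lemma coord0 j : coord_fun j 0 = 0.
Proof. by have := coord_lc j 0 (fun=> 0); rewrite big_ord0. Qed.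

Lemma coord_le j x : `|coord_fun j x| <= k * N x.
Proof. by have := coord_lip j x 0; rewrite coord0 !subr0. Qed.

Lemma coord_lin_lspan j (t : R) s s' : lspan (range z) s -> lspan (range z) s' ->
  coord_fun j (t *: s + s') = t * coord_fun j s + coord_fun j s'.
Proof.
move=> /lspan_natP[n [b ->]] /lspan_natP[m [d ->]].
rewrite (lc_widen z b (leq_maxl n m)) (lc_widen z d (leq_maxr n m)).
rewrite scaler_sumr -big_split /=.
rewrite (eq_bigr (fun i : 'I_(maxn n m) =>
  (t * (if (i < n)%N then b i else 0) + (if (i < m)%N then d i else 0)) *: z i)); last first.
  by move=> i _; rewrite scalerDl scalerA.
rewrite (coord_lc _ _ (fun i => t * (if (i < n)%N then b i else 0) + (if (i < m)%N then d i else 0))).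
rewrite (coord_lc _ _ (fun i => if (i < n)%N then b i else 0)).
rewrite (coord_lc _ _ (fun i => if (i < m)%N then d i else 0)).
by case: ifP => // _; rewrite mulr0 addr0.
Qed.

(** The defect of linearity is Lipschitz in each argument and vanishes on the span; density is
    applied to one argument at a time. *)
Lemma coord_lin j (t : R) x y : nclosure x -> nclosure y ->
  coord_fun j (t *: x + y) = t * coord_fun j x + coord_fun j y.
Proof.
move=> Zx Zy; apply/eqP; rewrite -subr_eq0 -normr_le0.
pose D x y := coord_fun j (t *: x + y) - (t * coord_fun j x + coord_fun j y).
have DL x1 y1 x2 y2 : `|D x1 y1| - `|D x2 y2| <=
    (2 * k * `|t|) * N (x1 - x2) + (2 * k) * N (y1 - y2).
  have h1 := coord_lip j (t *: x1 + y1) (t *: x2 + y2).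
  have h2 := coord_lip j x1 x2; have h3 := coord_lip j y1 y2.
  have h4 : N (t *: x1 + y1 - (t *: x2 + y2)) <= `|t| * N (x1 - x2) + N (y1 - y2).
    by rewrite opprD addrACA -scalerBr -(seminormZ sN); exact: seminormD.
  have h5 : `|t * (coord_fun j x1 - coord_fun j x2)| <= `|t| * (k * N (x1 - x2)).
    by rewrite normrM ler_wpM2l.
  have h6 := ler_wpM2l k0 h4.
  apply: le_trans (lerB_dist _ _) _.
  have -> : D x1 y1 - D x2 y2 = (coord_fun j (t *: x1 + y1) - coord_fun j (t *: x2 + y2))
    - t * (coord_fun j x1 - coord_fun j x2) - (coord_fun j y1 - coord_fun j y2) by rewrite /D; ring.
  apply: le_trans (ler_normB _ _) _.
  by have := ler_normB (coord_fun j (t *: x1 + y1) - coord_fun j (t *: x2 + y2)) (t * (coord_fun j x1 - coord_fun j x2)); lra.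
have c1 : 0 <= 2 * k * `|t| by rewrite !mulr_ge0.
have c2 : 0 <= 2 * k by rewrite !mulr_ge0.
apply: (@nclosure_le (fun x => `|D x y|) _ c1) Zx => [x1 x2|s ss].
  by have := DL x1 y x2 y; rewrite subrr (seminorm0 sN) mulr0 addr0.
apply: (@nclosure_le (fun y => `|D s y|) _ c2) Zy => [x1 x2|s' ss'].
  by have := DL s x1 s x2; rewrite subrr (seminorm0 sN) mulr0 add0r.
by rewrite normr_le0 subr_eq0 coord_lin_lspan.
Qed.

Lemma coord_cvg0 x (e : R) : nclosure x -> 0 < e -> exists M, forall j, (M <= j)%N -> `|coord_fun j x| <= e.
Proof.
move=> Zx e0; have k1 := k0; have e1 : 0 < e / (k + 1) by rewrite divr_gt0//; lra.
have [s /lspan_natP[n [b sE]] xs] := Zx _ e1; exists n => j nj.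
have := coord_lip j x s; rewrite {1}sE coord_lc ltnNge nj /= subr0 => h.
apply: le_trans h _; apply: le_trans (ler_wpM2l k0 (ltW xs)) _.
by rewrite mulrA ler_pdivrMr; [nra|lra].
Qed.

Definition head_sum m x := \sum_(i < m) coord_fun i x *: z i.

Lemma head_sum_lc m n (b : nat -> R) :
  head_sum m (\sum_(i < n) b i *: z i) = \sum_(i < minn m n) b i *: z i.
Proof.
rewrite /head_sum; under eq_bigr => i _ do rewrite coord_lc.
rewrite (lc_widen z b (geq_minl m n)); apply: eq_bigr => i _.
by rewrite leq_min ltn_ord.
Qed.

Lemma head_sum_linear m (t : R) x y : nclosure x -> nclosure y ->
  head_sum m (t *: x + y) = t *: head_sum m x + head_sum m y.
Proof.
move=> Zx Zy; rewrite /head_sum scaler_sumr -big_split; apply: eq_bigr => i _ /=.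
by rewrite coord_lin// scalerDl scalerA.
Qed.

Lemma head_sumB m x y : nclosure x -> nclosure y -> head_sum m (x - y) = head_sum m x - head_sum m y.
Proof.
by move=> Zx Zy; rewrite addrC -scaleN1r head_sum_linear// scaleN1r addrC.
Qed.

Lemma head_sum_le m x : nclosure x -> N (head_sum m x) <= k * N x.
Proof.
move=> Zx; rewrite -subr_le0.
pose S := \sum_(i < m) N (z i).
have S0 : 0 <= S by apply: sumr_ge0 => j _; exact: seminorm_ge0.
apply: (@nclosure_le (fun x => N (head_sum m x) - k * N x) (k * S + k)) Zx.
- by rewrite addr_ge0 ?mulr_ge0.
- move=> u v.
  have h1 := seminorm_le_sub sN (head_sum m u) (head_sum m v).
  have h2 := seminorm_le_sub sN v u.
  have h3 : N (head_sum m u - head_sum m v) <= k * N (u - v) * S.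
    rewrite -sumrB; apply: le_trans (seminorm_sum sN _) _.
    rewrite mulr_sumr; apply: ler_sum => i _.
    by rewrite -scalerBl (seminormZ sN) ler_wpM2r ?(seminorm_ge0 sN)// coord_lip.
  have h4 := ler_wpM2l k0 h2.
  by rewrite (seminorm_dist sN v u) in h4; lra.
- move=> s /lspan_natP[n [b ->]]; rewrite subr_le0 head_sum_lc; apply: basic.
  exact: geq_minr.
Qed.

Lemma head_sum_cvg x (e : R) : nclosure x -> 0 < e ->
  exists M, forall m, (M <= m)%N -> N (head_sum m x - x) <= e.
Proof.
move=> Zx e0; have k1 := k0; have e1 : 0 < e / (k + 1) by rewrite divr_gt0//; lra.
have [s ss xs] := Zx _ e1; have Zs := nclosure_lspan ss.
move: (ss) => /lspan_natP[n [b sE]]; exists n => m nm.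
have ps : head_sum m s = s by rewrite sE head_sum_lc (minn_idPr nm).
have := seminorm_tri sN s (head_sum m x) x.
rewrite -{1}ps -head_sumB// (seminorm_dist sN s x).
have := head_sum_le m (lsubspaceB lsubspace_nclosure Zx Zs).
move: xs; rewrite ltr_pdivlMr; last by lra.
by lra.
Qed.

End Coordinates.

(** * The polyhedral renorming *)

Section RealEstimates.
Variable R : realType.

(* Compares the weighted value of a functional with that of its truncation to a lower level:
   [s], [s1], [s2] are the sums of the functional, of its restriction, and of the member of
   the net that replaces the restriction; [t] is the error due to the net. *)
Lemma weight_tradeoff (s s1 s2 em e1 t p p2 S D k al : R) :
  0 <= s1 -> s1 <= s -> 0 <= s2 -> s2 <= s1 + t -> 0 <= t -> 1 + s <= S ->
  0 < D -> 1 <= k -> D / 3 <= p -> p - t * k * (2 * D) - (s - s1) * al <= p2 ->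
  0 <= al -> al * (9 * S ^+ 2) <= D ->
  0 <= em -> em <= e1 / 2 -> e1 <= 1 -> t * (1 + 18 * k) <= e1 / 2 ->
  (1 + (1 + s)^-1 + em) * p <= (1 + (1 + s2)^-1 + e1) * p2.
Proof.
move=> s10 s1s s20 s2s t0 sS D0 k1 Dp pp2 al0 alD em0 em1 e11 te.
have S0 : 0 < S by lra.
have [f fE] : exists f, f = (1 + s)^-1 by exists (1 + s)^-1.
have [f1 f1E] : exists f, f = (1 + s1)^-1 by exists (1 + s1)^-1.
have [f2 f2E] : exists f, f = (1 + s2)^-1 by exists (1 + s2)^-1.
have [q qE] : exists q, q = S^-1 by exists S^-1.
have qS : q * S = 1 by rewrite qE mulVf// gt_eqF.
have fs : f * (1 + s) = 1 by rewrite fE mulVf// gt_eqF//; lra.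
have fs1 : f1 * (1 + s1) = 1 by rewrite f1E mulVf// gt_eqF//; lra.
have fs2 : f2 * (1 + s2) = 1 by rewrite f2E mulVf// gt_eqF//; lra.
rewrite -fE -f2E.
have q0 : 0 < q by rewrite qE invr_gt0.
have f0 : 0 < f by rewrite fE invr_gt0; lra.
have f10 : 0 < f1 by rewrite f1E invr_gt0; lra.
have f20 : 0 < f2 by rewrite f2E invr_gt0; lra.
have qf : q <= f by rewrite qE fE lef_pV2 ?posrE//; lra.
have qf1 : q <= f1 by rewrite qE f1E lef_pV2 ?posrE//; lra.
have f11 : f1 <= 1 by rewrite f1E invf_le1; lra.
have f21 : f2 <= 1 by rewrite f2E invf_le1; lra.
clear fE f1E f2E qE.
have d1 : f1 - f = (s - s1) * (f * f1).
  have -> : f1 - f = f1 * (f * (1 + s)) - f * (f1 * (1 + s1)) by rewrite fs fs1; ring.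
  by ring.
have d2 : f1 - f2 = (s2 - s1) * (f2 * f1).
  have -> : f1 - f2 = f1 * (f2 * (1 + s2)) - f2 * (f1 * (1 + s1)) by rewrite fs2 fs1; ring.
  by ring.
(* The gain in weight is linear in the tail sum [s - s1], like the loss [(s - s1) * al] in value. *)
have h1 : (s - s1) * q ^+ 2 <= f1 - f.
  by rewrite d1; apply: ler_wpM2l; [rewrite subr_ge0|rewrite expr2; apply: ler_pM => //; exact: ltW].
have h2 : f1 - f2 <= t.
  have h : 0 <= f2 * f1 <= 1 by apply/andP; split; [apply: mulr_ge0|apply: mulr_ile1] => //; exact: ltW.
  rewrite d2; move: h; set ff := f2 * f1 => /andP[ff0 ff1].
  apply: (le_trans (ler_wpM2r ff0 (_ : s2 - s1 <= t))); first by lra.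
  by have := ler_wpM2l t0 ff1; lra.
(* The 9 is the bound 3 on the weight times the 3 in [D / 3 <= p]; the 18 in the last hypothesis has
   one more factor 2, from [2 * D]. *)
have al1 : 9 * al <= D * q ^+ 2.
  have := ler_wpM2r (exprn_ge0 2 (ltW q0)) alD.
  have -> : al * (9 * S ^+ 2) * q ^+ 2 = 9 * al * (q * S) ^+ 2 by ring.
  by rewrite qS expr1n mulr1.
set Q := q ^+ 2 in h1 al1 *.
have Q0 : 0 <= Q by rewrite exprn_ge0// ltW.
set d := s - s1 in h1 pp2 *.
have d0 : 0 <= d by rewrite /d; lra.
have tk : 0 <= t * k by rewrite mulr_ge0//; lra.
have w3 : 1 + f2 + e1 <= 3 by lra.
have w0 : 0 <= 1 + f2 + e1 by lra.
have dal : 0 <= d * al by rewrite mulr_ge0.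
have h3 : (1 + f2 + e1) * (p - t * k * (2 * D) - d * al) <= (1 + f2 + e1) * p2.
  by rewrite ler_wpM2l.
apply: le_trans h3.
have tkD : 0 <= t * k * (2 * D) by rewrite mulr_ge0//; lra.
have h4 : (1 + f2 + e1) * (t * k * (2 * D) + d * al) <= 3 * (t * k * (2 * D) + d * al).
  by rewrite ler_wpM2r//; lra.
have h5 : d * Q - t + e1 / 2 <= (1 + f2 + e1) - (1 + f + em) by lra.
have dQ : 0 <= d * Q by rewrite mulr_ge0.
have h6 : (d * Q - t + e1 / 2) * (D / 3) <= ((1 + f2 + e1) - (1 + f + em)) * p.
  apply: ler_pM => //; last by lra.
  by lra.
have h7 : d * (9 * al) <= d * (D * Q) by rewrite ler_wpM2l.
have h8 : t * (1 + 18 * k) * D <= e1 / 2 * D by rewrite ler_wpM2r// ltW.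
by lra.
Qed.

(** Here [f] stands for [1 / (1 + s)]. A weighted value clearly above [D] with [p] hardly above [D]
    forces a weight well above 1, hence a bounded sum; and as the weight is at most 3, it forces
    [p >= D / 3]. *)
Lemma weight_lower (phi D p f em : R) : 0 < phi -> phi <= 1 / 2 -> 0 < D ->
  p <= D * (1 + phi / 20) -> 0 < f -> f <= 1 -> 0 <= em -> em <= phi / 8 -> 
  (1 + phi / 3) * D < (1 + f + em) * p ->
  phi / 8 <= f /\ D / 3 <= p.
Proof.
move=> h0 h1 D0 pD f0 f1 em0 em1 lt.
have pp : 0 < p by rewrite -(@pmulr_rgt0 _ (1 + f + em)); [apply: lt_trans lt; apply: mulr_gt0|]; lra.
have pD0 : 0 < phi * D by apply: mulr_gt0.
have w3 : (1 + f + em) * p <= 3 * p by apply: ler_wpM2r; [exact: ltW|lra].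
split; last by lra.
rewrite leNgt; apply/negP => fl.
have : (1 + f + em) * p <= (1 + phi / 4) * (D * (1 + phi / 20)).
  by apply: ler_pM; lra.
have Dp : 0 < D * phi by rewrite mulr_gt0.
by have := ler_wpM2l (ltW Dp) h1; lra.
Qed.

Definition recip (m : nat) : R := m.+1%:R^-1.

Lemma recip_gt0 m : 0 < recip m. Proof. by rewrite /recip invr_gt0. Qed.

Lemma recip_le1 m : recip m <= 1. Proof. by rewrite /recip invf_le1// ler1n. Qed.

Lemma recip_small (c : R) : 0 < c -> exists M, forall m, (M <= m)%N -> recip m <= c.
Proof.
move=> c0; exists (Num.truncn c^-1) => m Mm.
rewrite /recip -[leRHS]invrK lef_pV2 ?posrE ?invr_gt0//.
by apply/ltW; apply: lt_le_trans (truncnS_gt _) _; rewrite ler_nat ltnS.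
Qed.

(** This explains the mesh [recip m ^ 3] of the nets: summed over [m] vectors, the error is of
    second order compared with the term [recip m] of the weight that has to pay for it. *)
Lemma mesh_small m : m%:R * recip m ^+ 3 <= recip m ^+ 2.
Proof.
rewrite exprS mulrA; apply: ler_piMl; first by rewrite exprn_ge0// ltW// recip_gt0.
by rewrite /recip ler_pdivrMr ?ltr0Sn// mul1r ler_nat.
Qed.

End RealEstimates.

Section Renorming.
Variables (R : realType) (X : normedModType R) (N : X -> R).
Hypothesis sN : seminorm N.
Variables (E : set (X -> R)).
Hypothesis El : forall e, E e -> linear_form e.
Hypothesis EN : forall e, E e -> forall x, `|e x| <= N x.
Hypothesis Eatt : forall x, exists2 e, E e & `|e x| = N x.
Variables (z : nat -> X) (k : R).
Hypothesis k1 : 1 <= k.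
Hypothesis summ : forall e, E e -> exists V : R, forall n, \sum_(i < n) `|e (z i)| <= V.
Variables (Z : set X) (a : nat -> X -> R).
Hypothesis Zs : lsubspace Z.
Hypothesis a_lip : forall j x y, `|a j x - a j y| <= k * N (x - y).
Hypothesis a_le : forall j x, `|a j x| <= k * N x.
Hypothesis a_lin : forall j t x y, Z x -> Z y -> a j (t *: x + y) = t * a j x + a j y.
Hypothesis a_cvg0 : forall x (e : R), Z x -> 0 < e ->
  exists M, forall j, (M <= j)%N -> `|a j x| <= e.
Let P m x := \sum_(i < m) a i x *: z i.
Hypothesis P_le : forall m x, Z x -> N (P m x) <= k * N x.
Hypothesis P_cvg : forall x (e : R), Z x -> 0 < e ->
  exists M, forall m, (M <= m)%N -> N (P m x - x) <= e.

Let P_lin m t x y : Z x -> Z y -> P m (t *: x + y) = t *: P m x + P m y.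
Proof.
move=> Zx Zy; rewrite /P scaler_sumr -big_split; apply: eq_bigr => i _ /=.
by rewrite a_lin// scalerDl scalerA.
Qed.

Let PB m x y : Z x -> Z y -> P m (x - y) = P m x - P m y.
Proof. by move=> Zx Zy; rewrite addrC -scaleN1r P_lin// scaleN1r addrC. Qed.

Let mesh m : R := recip R m ^+ 3.

(** The net is made of members of [E], so it inherits linearity and the bound by [N]. It
    approximates [E] on the first [m] vectors only, which is all that [P m] sees. *)
Lemma ex_E_net m : exists p : nat * (nat -> X -> R), (forall j, E (p.2 j)) /\
  forall e, E e -> exists2 j, (j < p.1)%N & forall l, (l < m)%N -> `|e (z l) - p.2 j (z l)| <= mesh m.
Proof.
have [e0 Ee0 _] := Eatt 0.
have m0 : 0 < mesh m by rewrite exprn_gt0// recip_gt0.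
have [//|K [G KG]] := @finite_net R {e | E e} (exist _ e0 Ee0) (fun l e => sval e (z l)) (fun l => N (z l)) m _ m0.
  by move=> l [e Ee] /=; exact: EN.
exists (K, fun j => sval (G j)); split=> [j|e Ee] /=; first exact: (svalP (G j)).
by have [j jK h] := KG (exist _ e Ee); exists j.
Qed.

Let K m := (projT1 (cid (ex_E_net m))).1.
Let G m := (projT1 (cid (ex_E_net m))).2.

Let GE m j : E (G m j).
Proof. by rewrite /G; case: cid => p [h _] /=. Qed.

Let G_net m e : E e -> exists2 j, (j < K m)%N & forall l, (l < m)%N -> `|e (z l) - G m j (z l)| <= mesh m.
Proof. by rewrite /G /K; case: cid => p [_ h] /=; exact: h. Qed.

Let s m (e : X -> R) : R := \sum_(i < m) `|e (z i)|.
Let w m e : R := 1 + (1 + s m e)^-1 + recip R m.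
Let val m e y : R := w m e * `|e (P m y)|.

Let s_ge0 m e : 0 <= s m e. Proof. exact: sumr_ge0. Qed.

(** Error of replacing a functional by a nearby member of the level [m] net: at most [t m] in the
    sum, at most [t m * k * N y] in the value at [P m y]. *)
Let t m : R := m%:R * mesh m.
Let t_ge0 m : 0 <= t m.
Proof. by rewrite mulr_ge0// exprn_ge0// ltW// recip_gt0. Qed.
Let t_le m : t m <= recip R m ^+ 2. Proof. exact: mesh_small. Qed.

Let s_net m e e' : (forall l, (l < m)%N -> `|e (z l) - e' (z l)| <= mesh m) ->
  s m e' <= s m e + t m.
Proof.
move=> h; have -> : t m = \sum_(i < m) mesh m by rewrite sumr_const card_ord /t mulr_natl.
rewrite /s -big_split /=; apply: ler_sum => i _.
have := h i (ltn_ord i); have := ler_normB (e (z i)) (e (z i) - e' (z i)).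
by rewrite subKr; lra.
Qed.

Let EP e m y : E e -> e (P m y) = \sum_(i < m) a i y * e (z i).
Proof.
move=> Ee; rewrite (linear_form_sum _ _ _ (El Ee)).
by apply: eq_bigr => i _; rewrite (linear_formZ _ _ (El Ee)).
Qed.

Let P_net m e e' y : E e -> E e' ->
  (forall l, (l < m)%N -> `|e (z l) - e' (z l)| <= mesh m) ->
  `|e (P m y) - e' (P m y)| <= t m * k * N y.
Proof.
move=> Ee Ee' h; rewrite !EP// -sumrB.
have -> : t m * k * N y = \sum_(i < m) (k * N y) * mesh m.
  by rewrite sumr_const card_ord -[RHS]mulr_natl /t; ring.
apply: le_trans (ler_norm_sum _ _ _) _; apply: ler_sum => i _.
by rewrite -mulrBr normrM ler_pM// ?a_le// h.
Qed.

Let w_ge1 m e : 1 <= w m e.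
Proof.
have h1 := recip_gt0 R m; have h2 : 0 <= (1 + s m e)^-1.
  by rewrite invr_ge0; have := s_ge0 m e; lra.
by rewrite /w; lra.
Qed.

Let inv_s_le1 m e : 0 < (1 + s m e)^-1 <= 1.
Proof. by have := s_ge0 m e => h; rewrite invr_gt0 invf_le1; [apply/andP; split|]; lra. Qed.

Let w_le3 m e : w m e <= 3.
Proof. by have := recip_le1 R m; have /andP[_] := inv_s_le1 m e; rewrite /w; lra. Qed.

Let w_ge0 m e : 0 <= w m e. Proof. by apply: le_trans (w_ge1 m e). Qed.

Let val_le m e y : E e -> Z y -> val m e y <= 3 * k * N y.
Proof.
move=> Ee Zy; rewrite -mulrA; apply: ler_pM => //.
by apply: le_trans (EN Ee _) (P_le _ Zy).
Qed.

Let valZ m e (c : R) y : E e -> Z y -> val m e (c *: y) = `|c| * val m e y.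
Proof.
move=> Ee Zy; rewrite /val -[c *: y]addr0 P_lin//; last exact: Zs.1.
have -> : P m 0 = 0.
  by have := PB m Zy Zy; rewrite !subrr.
by rewrite addr0 (linear_formZ _ _ (El Ee)) normrM mulrCA.
Qed.

Let valD m e x y : E e -> Z x -> Z y -> val m e (x + y) <= val m e x + val m e y.
Proof.
move=> Ee Zx Zy; rewrite /val -mulrDr ler_wpM2l//.
have := P_lin m 1 Zx Zy; rewrite !scale1r => ->.
by rewrite (linear_formD _ _ (El Ee)) ler_normD.
Qed.

Let val_lip m e x y : E e -> Z x -> Z y -> val m e x <= val m e y + 3 * k * N (x - y).
Proof.
move=> Ee Zx Zy; have Zxy := lsubspaceB Zs Zx Zy.
have := valD m Ee Zxy Zy; rewrite subrK.
by have := val_le m Ee Zxy; lra.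
Qed.

(* The functional attaining [N x] has a finite sum S, hence its truncations carry the
   limiting weight 1 + 1/(1 + S) > 1. *)
Lemma value_large x : Z x -> 0 < N x -> exists2 phi, 0 < phi <= 1 / 2 &
  exists m j, (j < K m)%N /\ (1 + phi / 2) * N x <= val m (G m j) x.
Proof.
move=> Zx D0; have [e0 Ee0 e0x] := Eatt x.
have [V VP] := summ Ee0.
have V0 : 0 <= V by have := VP 0%N; rewrite big_ord0.
(* [2 + V] will bound [1 + s] for the net member replacing [e0], whose sum exceeds that of [e0] by
   at most 1. *)
have [phi phiE] : exists p, p = (2 + V)^-1 by exists (2 + V)^-1.
have p0 : 0 < phi by rewrite phiE invr_gt0; lra.
have pV : phi * (2 + V) = 1 by rewrite phiE mulVf// gt_eqF//; lra.
have p2 : phi <= 1 / 2 by have := mulr_ge0 (ltW p0) V0; lra.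
exists phi; first by rewrite p0.
have th0 : 0 < phi * N x / 8 by rewrite !mulr_gt0.
have [M1 M1P] := P_cvg Zx th0.
have kk := k1; have k0 : 0 < k by lra.
have c0 : 0 < phi / (8 * k) by rewrite divr_gt0// mulr_gt0.
have [M2 M2P] := recip_small c0.
pose m := maxn M1 M2.
have [j jK jP] := G_net m Ee0.
exists m, j; split=> //.
have h1 : t m <= recip R m.
  by apply: le_trans (t_le m) _; rewrite expr2 ler_piMr ?recip_le1// ltW// recip_gt0.
have h2 := M2P m (leq_maxr _ _).
have h3 : t m * k * N x <= phi * N x / 8.
  have : t m * k * N x <= phi / (8 * k) * k * N x.
    by apply: ler_wpM2r; [exact: seminorm_ge0|apply: ler_wpM2r; [lra|exact: le_trans h1 h2]].
  have -> : phi / (8 * k) * k = phi / 8 by field; rewrite gt_eqF.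
  by lra.
have h4 := P_net x Ee0 (GE m j) jP.
have h5 := M1P m (leq_maxl _ _).
have h6 := le_trans (EN Ee0 _) h5.
have h7 : (1 - phi / 4) * N x <= `|G m j (P m x)|.
  have := lerB_dist (e0 (P m x)) (e0 (P m x) - G m j (P m x)); rewrite subKr.
  have := ler_normB (e0 (P m x)) (e0 (P m x - x)); rewrite (linear_formB _ _ (El Ee0)) subKr e0x.
  rewrite -(linear_formB _ _ (El Ee0)).
  by move: h4 h6; lra.
have h8 : 1 + phi <= w m (G m j).
  have sV : s m (G m j) <= V + 1.
    have := s_net jP; have := VP m; rewrite -/(s m e0).
    by have := recip_le1 R m; lra.
  have : phi <= (1 + s m (G m j))^-1.
    by rewrite phiE lef_pV2 ?posrE; have := s_ge0 m (G m j); lra.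
  by have := recip_gt0 R m; rewrite /w; lra.
have Np : 0 <= N x * (phi * (1 / 2 - phi)) by apply: mulr_ge0; [exact: ltW|apply: mulr_ge0; lra].
apply: (@le_trans _ _ ((1 + phi) * ((1 - phi / 4) * N x))); first by lra.
by apply: ler_pM => //; [lra|rewrite mulr_ge0//; lra].
Qed.

(* Past some level M every weighted truncation is dominated, near x, by one of level at
   most M: a competitor of high level has bounded sum, and restricting it to a fixed level
   m1 gains more in weight (by convexity of 1/(1+s)) than it loses in value, because the
   coordinates of x beyond m1 are small. *)
Lemma locally_finite x : Z x -> 0 < N x -> exists2 r, 0 < r & exists M, forall y, Z y ->
  N (y - x) < r -> forall m j, (j < K m)%N ->
  exists m' j', [/\ (m' <= M)%N, (j' < K m')%N & val m (G m j) y <= val m' (G m' j') y].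
Proof.
move=> Zx D0; have [phi /andP[p0 p2] [m0 [j0 [j0K v0]]]] := value_large Zx D0.
set D := N x in D0 v0.
have kk := k1; have k0 : 0 < k by lra.
(* Only competitors that beat the pair [m0], [j0] matter; for these [weight_lower] gives
   [phi / 8 <= 1 / (1 + s)], that is [1 + s <= S]. *)
have [S SE] : exists S, S = 8 / phi by exists (8 / phi).
have Sp : S * phi = 8 by rewrite SE divfK// gt_eqF.
have S1 : 1 <= S by rewrite SE ler_pdivlMr//; lra.
have S0 : 0 < S by lra.
have SS1 : 1 <= S ^+ 2 by rewrite exprn_ege1.
have [r rE] : exists r, r = D * phi / (40 * k * S ^+ 2) by exists (D * phi / (40 * k * S ^+ 2)).
have den0 : 0 < 40 * k * S ^+ 2 by rewrite !mulr_gt0// exprn_gt0.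
have r0 : 0 < r by rewrite rE divr_gt0// mulr_gt0.
have krS : k * r * S ^+ 2 = D * phi / 40 by rewrite rE; field; rewrite !gt_eqF.
have kr0 : 0 < k * r by rewrite mulr_gt0.
have kr : k * r <= D * phi / 40 by rewrite -krS ler_peMr// ltW.
have Dphi : D * phi <= D * (1 / 2) by rewrite ler_wpM2l// ltW.
have rkr : r <= k * r by rewrite ler_peMl// ltW.
have rD : r <= D by lra.
(* Half of the admissible coordinate size [D / (9 * S ^ 2)]; the other half is spent on passing from
   [x] to [y], which is what fixes [r]. *)
have al0 : 0 < D / (18 * S ^+ 2) by rewrite divr_gt0// mulr_gt0// exprn_gt0.
have [Ma MaP] := a_cvg0 Zx al0.
(* From this level on, [t m * (1 + 18 * k)] is at most [recip m / 2]. Levels beyond [Me] have level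
   term at most half of that of [m1], and the difference pays for the net error. *)
have c0 : 0 < (2 * (1 + 18 * k))^-1 by rewrite invr_gt0 mulr_gt0//; lra.
have [Mb MbP] := recip_small c0.
pose m1 := maxn Ma Mb.
have th0 : 0 < phi * D / 40 by rewrite !mulr_gt0.
have [Mc McP] := P_cvg Zx th0.
have d0 : 0 < phi / 8 by lra.
have [Md MdP] := recip_small d0.
have r10 : 0 < recip R m1 / 2 by rewrite divr_gt0// recip_gt0.
have [Me MeP] := recip_small r10.
exists r => //; exists (maxn m0 (maxn m1 (maxn Mc (maxn Md Me)))) => y Zy yx m j jK.
set M := maxn _ _.
have [mM|Mm] := leqP m M; first by exists m, j.
have [le0|lt0] := leP (val m (G m j) y) (val m0 (G m0 j0) y).
  by exists m0, j0; split=> //; exact: leq_maxl.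
have [Mc_m Md_m Me_m m1_m] : [/\ Mc <= m, Md <= m, Me <= m & m1 <= m]%N.
  move: (ltnW Mm); rewrite /M !geq_max => /andP[_ /andP[? /andP[? /andP[? ?]]]].
  by split.
set e := G m j in lt0 *; have Ee : E e := GE m j.
(* The dominating functional: a member of the level [m1] net close to [e] on the first [m1]
   vectors. *)
have [j1 j1K j1P] := G_net m1 Ee.
exists m1, j1; split=> //; first by rewrite /M leq_max [X in _ || X]leq_max leqnn orbT.
have Zyx := lsubspaceB Zs Zy Zx.
have kyx : k * N (y - x) <= k * r by apply: ler_wpM2l; [exact: ltW|exact: ltW].
have v1 : (1 + phi / 3) * D < val m e y.
  apply: le_lt_trans lt0; have := val_lip m0 (GE m0 j0) Zx Zy.
  rewrite (seminorm_dist sN x y).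
  by lra.
have pD : `|e (P m y)| <= D * (1 + phi / 20).
  apply: le_trans (EN Ee _) _.
  have := seminorm_le_sub sN (P m y) (P m x); rewrite -PB//.
  have := P_le m Zyx; have := seminorm_le_sub sN (P m x) x; have := McP _ Mc_m.
  by rewrite -/D; lra.
have /andP[f0 f1] := inv_s_le1 m e.
have [pf pD3] := weight_lower p0 p2 D0 pD f0 f1 (ltW (recip_gt0 R m)) (MdP _ Md_m) v1.
have sS : 1 + s m e <= S.
  rewrite SE -invf_div -[leLHS]invrK lef_pV2 ?posrE//.
pose al := D / (9 * S ^+ 2).
have alE : al * (9 * S ^+ 2) = D by rewrite /al; field; rewrite gt_eqF.
have aly i : (m1 <= i)%N -> `|a i y| <= al.
  move=> m1i; have := a_lip i y x; have := MaP i (leq_trans (leq_maxl _ _) m1i).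
  have := ler_normB (a i x) (a i x - a i y); rewrite subKr [`|a i x - _|]distrC.
  have : k * r <= D / (18 * S ^+ 2).
    rewrite ler_pdivlMr ?mulr_gt0 ?exprn_gt0//.
    have -> : k * r * (18 * S ^+ 2) = 18 * (k * r * S ^+ 2) by ring.
    by rewrite krS; lra.
  have -> : al = D / (18 * S ^+ 2) + D / (18 * S ^+ 2) by rewrite /al; field; rewrite gt_eqF.
  by lra.
have [Ny0 Ny] : 0 <= N y /\ N y <= 2 * D.
  split; first exact: seminorm_ge0.
  by have := seminorm_le_sub sN y x; rewrite -/D; lra.
have sm : s m e - s m1 e = \sum_(m1 <= i < m) `|e (z i)|.
  rewrite /s -!(big_mkord xpredT (fun i => `|e (z i)|)) (@big_cat_nat _ _ _ m1 0 m)//=.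
  by ring.
have s1s : s m1 e <= s m e by rewrite -subr_ge0 sm sumr_ge0.
have pp : `|e (P m y)| - t m1 * k * (2 * D) - (s m e - s m1 e) * al <= `|G m1 j1 (P m1 y)|.
  have h1 := P_net y Ee (GE m1 j1) j1P.
  have h2 : `|e (P m y) - e (P m1 y)| <= (s m e - s m1 e) * al.
    rewrite !EP// sm mulr_suml.
    rewrite -!(big_mkord xpredT (fun i => a i y * e (z i))) (@big_cat_nat _ _ _ m1 0 m)//=.
    rewrite addrAC subrr add0r; apply: le_trans (ler_norm_sum _ _ _) _.
    rewrite big_seq [leRHS]big_seq; apply: ler_sum => i; rewrite mem_index_iota => /andP[m1i _].
    by rewrite normrM mulrC ler_wpM2l// aly.
  have h3 : t m1 * k * N y <= t m1 * k * (2 * D) by rewrite ler_wpM2l// mulr_ge0// ltW.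
  have := lerB_dist (e (P m y)) (e (P m y) - e (P m1 y)); rewrite subKr.
  have := lerB_dist (e (P m1 y)) (e (P m1 y) - G m1 j1 (P m1 y)); rewrite subKr.
  by lra.
apply: (weight_tradeoff (s_ge0 m1 e) s1s (s_ge0 _ _) (s_net j1P) (t_ge0 m1) sS D0 k1 pD3 pp) => //.
- by rewrite divr_ge0 ?mulr_ge0 ?exprn_ge0// ltW.
- by rewrite alE.
- exact/ltW/recip_gt0.
- exact: MeP.
- exact: recip_le1.
- have h1 := MbP m1 (leq_maxr _ _); have r1 := recip_gt0 R m1.
  have h2 : t m1 * (1 + 18 * k) <= recip R m1 * recip R m1 * (1 + 18 * k).
    by rewrite ler_wpM2r ?t_le//; lra.
  apply: le_trans h2 _; rewrite -mulrA; apply: ler_wpM2l; first exact: ltW.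
  apply: (@le_trans _ _ ((2 * (1 + 18 * k))^-1 * (1 + 18 * k))).
    by apply: ler_wpM2r => //; lra.
  by rewrite le_eqVlt; apply/orP; left; apply/eqP; field; rewrite gt_eqF//; lra.
Qed.

(** The new norm is the supremum of all weighted truncations. On a finite-dimensional subspace,
    compactness turns the local domination into one bound on the levels, so finitely many linear
    functionals cut out the unit ball there. *)
Theorem locally_finite_renorming : exists N' : X -> R,
  [/\ forall x y, Z x -> Z y -> N' (x + y) <= N' x + N' y,
      forall (c : R) y, Z y -> N' (c *: y) = `|c| * N' y,
      forall y, Z y -> N y <= N' y <= 3 * k * N y &
      (forall x, N x = 0 -> x = 0) -> forall n (v : 'I_n -> X), (forall i, Z (v i)) ->
        exists (T : finType) (g : T -> X -> R),
          (forall t (c : R) x y, Z x -> Z y -> g t (c *: x + y) = c * g t x + g t y) /\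
          forall y, lspan (range v) y -> (N' y <= 1 <-> forall t, `|g t y| <= 1)].
Proof.
pose A y := [set r | exists m j, (j < K m)%N /\ r = val m (G m j) y].
have A0 y : A y !=set0.
  have [e0 Ee0 _] := Eatt 0; have [j jK _] := G_net 0 Ee0.
  by exists (val 0 (G 0 j) y), 0%N, j.
have Aub y : Z y -> ubound (A y) (3 * k * N y).
  by move=> Zy _ [m [j [_ ->]]]; exact: val_le.
have le_A y m j : Z y -> (j < K m)%N -> val m (G m j) y <= sup (A y).
  by move=> Zy jK; apply: ub_le_sup; [exists (3 * k * N y); exact: Aub|exists m, j].
have A_le y b : (forall m j, (j < K m)%N -> val m (G m j) y <= b) -> sup (A y) <= b.
  by move=> h; apply: ge_sup => // _ [m [j [jK ->]]]; exact: h.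
have NA y : Z y -> N y <= sup (A y).
  move=> Zy; have [Ny0|Ny0] := eqVneq (N y) 0.
    have [_ [m [j [jK _]]]] := A0 y.
    by rewrite Ny0; apply: le_trans (le_A _ _ _ Zy jK); rewrite mulr_ge0.
  have Ny : 0 < N y by rewrite lt_neqAle eq_sym Ny0 (seminorm_ge0 sN).
  have [phi /andP[p0 _] [m [j [jK h]]]] := value_large Zy Ny.
  apply: le_trans (le_A _ _ _ Zy jK); apply: le_trans h.
  by rewrite ler_peMl ?(ltW Ny)//; lra.
have AZle (c : R) y : Z y -> sup (A (c *: y)) <= `|c| * sup (A y).
  by move=> Zy; apply: A_le => m j jK; rewrite valZ// ler_wpM2l// le_A.
exists (fun y => sup (A y)); split.
- move=> x y Zx Zy; apply: A_le => m j jK.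
  by apply: le_trans (valD _ _ Zx Zy) _ => //; rewrite lerD// le_A.
- move=> c y Zy; apply/eqP; rewrite eq_le AZle//=.
  have [->|c0] := eqVneq c 0.
    rewrite normr0 mul0r; apply: le_trans (seminorm_ge0 sN _) (NA _ _).
    by rewrite scale0r; exact: Zs.1.
  rewrite -ler_pdivlMl ?normr_gt0//.
  have := AZle c^-1 _ (lsubspaceZ c Zs Zy).
  by rewrite scalerA mulVf// scale1r normfV.
- by move=> y Zy; rewrite NA//=; apply: ge_sup => //; exact: Aub.
move=> N0 n v Zv.
have vZ : lspan (range v) `<=` Z by apply: lspan_min => // _ [i _ <-].
pose Q M y := forall m j, (j < K m)%N ->
  exists m' j', [/\ (m' <= M)%N, (j' < K m')%N & val m (G m j) y <= val m' (G m' j') y].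
have [||||M QM] := @finite_dim_uniform _ _ n v N Q sN N0.
- move=> M m j jK; have [e0 Ee0 _] := Eatt 0; have [j' jK' _] := G_net 0 Ee0.
  exists 0%N, j'; split => //; rewrite -[0](scale0r 0) !valZ//; try exact: Zs.1.
  by rewrite normr0 !mul0r.
- move=> M M' y MM' QM m j jK; have [m' [j' [? ? ?]]] := QM m j jK.
  by exists m', j'; split => //; exact: leq_trans MM'.
- move=> M c y /vZ Zy QM m j jK; have [m' [j' [? ? h]]] := QM m j jK.
  by exists m', j'; split => //; rewrite !valZ// ler_wpM2l.
- move=> x /vZ Zx Nx; have [r r0 [M MP]] := locally_finite Zx Nx.
  by exists r => //; exists M => y /vZ Zy yx m j jK; exact: MP.
exists {m : 'I_M.+1 & 'I_(K m)}, (fun (t : {m : 'I_M.+1 & 'I_(K m)}) y => w (tag t) (G (tag t) (tagged t)) * G (tag t) (tagged t) (P (tag t) y)).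
split=> [[m j] c x y Zx Zy|y vy] /=.
  by rewrite P_lin// (El (GE m j)) mulrDr mulrCA.
have Zy := vZ _ vy.
have vE m j : `|w m (G m j) * G m j (P m y)| = val m (G m j) y.
  by rewrite normrM ger0_norm.
split=> [N1 [m j]|h].
  by rewrite /= vE; apply: le_trans (le_A _ _ _ Zy (ltn_ord j)) N1.
apply: A_le => m j jK; have [m' [j' [m'M j'K h']]] := QM _ vy m j jK.
have m'M1 : (m' < M.+1)%N by rewrite ltnS.
have := h (Tagged (fun m : 'I_M.+1 => 'I_(K m)) (Ordinal j'K : 'I_(K (Ordinal m'M1)))).
by rewrite /= vE; exact: le_trans.
Qed.

End Renorming.

(** The common end of all forward cases, which only have to supply a basic sequence [z] summable on
    [E]. [Y] may be smaller than the closed span of [z], as a case may use a vector outside the span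
    of the subsequence. *)
Lemma basic_iso_polyhedral (R : realType) (X : normedModType R) (N : X -> R) (C : R)
    (E : set (X -> R)) (z : nat -> X) (k : R) (Y : set X) :
  seminorm N -> 0 < C -> (forall x, `|x| <= C * N x) -> (forall x, N x <= C * `|x|) ->
  (forall e, E e -> linear_form e) -> (forall e, E e -> forall x, `|e x| <= N x) ->
  (forall x, exists2 e, E e & `|e x| = N x) ->
  1 <= k ->
  (forall n (b : nat -> R) m, (m <= n)%N ->
    N (\sum_(i < m) b i *: z i) <= k * N (\sum_(i < n) b i *: z i)) ->
  (forall n (b : nat -> R) j, (j < n)%N -> `|b j| <= k * N (\sum_(i < n) b i *: z i)) ->
  (forall e, E e -> exists V : R, forall n, \sum_(i < n) `|e (z i)| <= V) ->
  lsubspace Y -> Y `<=` clspan (range z) -> ~ finite_dim Y ->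
  iso_polyhedral Y.
Proof.
move=> sN C0 CN NC El EN Eatt k1 basic coef summ sY YZ nfd.
have k0 : 0 <= k by lra.
pose Z := nclosure N z.
have YZ' : Y `<=` Z.
  move=> y /YZ yz e e0; have [s [ss ys]] := yz _ (nbhsx_ballx y _ (divr_gt0 e0 C0)).
  exists s => //; apply: le_lt_trans (NC _) _.
  by move: ys; rewrite -ball_normE /= ltr_pdivlMr// mulrC.
have [N' [N'D N'Z NN' N'poly]] := @locally_finite_renorming R X N sN E El EN Eatt z k k1 summ Z
  (coord_fun sN k0 coef) (lsubspace_nclosure sN z) (@coord_lip _ _ _ sN _ _ k0 coef)
  (@coord_le _ _ _ sN _ _ k0 coef) (@coord_lin _ _ _ sN _ _ k0 coef)
  (@coord_cvg0 _ _ _ sN _ _ k0 coef) (@head_sum_le _ _ _ sN _ _ k0 basic coef)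
  (@head_sum_cvg _ _ _ sN _ _ k0 basic coef).
have N0 x : N x = 0 -> x = 0.
  by move=> Nx; apply/eqP; rewrite -normr_le0; have := CN x; rewrite Nx mulr0.
exists N'; split; first by move=> x y /YZ' Zx /YZ' Zy; exact: N'D.
split; first by move=> c y /YZ' Zy; exact: N'Z.
split.
  exists C^-1, (3 * k * C); split; first by rewrite invr_gt0.
  split; first by rewrite !mulr_gt0//; lra.
  move=> y /YZ' Zy; have /andP[h1 h2] := NN' _ Zy; split.
    by rewrite ler_pdivrMl//; apply: le_trans (CN _) _; rewrite ler_wpM2l// ltW.
  by apply: le_trans h2 _; rewrite -[leRHS]mulrA; apply: ler_wpM2l => //; lra.
split=> // n v Yv.
have [T [g [gL gN]]] := N'poly N0 n v (fun i => YZ' _ (Yv i)).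
have vZ : lspan (range v) `<=` Z.
  by apply: lspan_min; [exact: lsubspace_nclosure|move=> _ [i _ <-]; exact/YZ'/Yv].
apply: (finite_extreme_points (g := g)) => //; first exact: lsubspace_lspan.
by move=> t a u w /vZ Zu /vZ Zw; exact: gL.
Qed.

(** * Selecting basic subsequences *)

Section Selection.
Variable R : realType.

Lemma sum_geom n : \sum_(i < n) (2^-1 : R) ^+ i <= 2.
Proof.
suff -> : \sum_(i < n) (2^-1 : R) ^+ i = 2 - 2 * 2^-1 ^+ n.
  by rewrite gerBl mulr_ge0// exprn_ge0.
elim: n => [|n IH]; first by rewrite big_ord0 expr0; lra.
by rewrite big_ord_recr/= IH exprS; lra.
Qed.

Lemma mul_geom_le1 n : n.+1%:R * (2^-1 : R) ^+ n <= 1.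
Proof.
rewrite exprVn ler_pdivrMr ?exprn_gt0// mul1r -natrX ler_nat.
exact: ltn_expl.
Qed.

(* The usual selection of a basic sequence: each tail vector is taken small on finite
   sets that almost norm the span of the vectors already chosen. *)
Lemma basic_selection (I : Type) (i0 : I) (y : I -> R) (w : nat -> I -> R) (B0 : R)
    (B : nat -> R) (d : R) :
  0 < d -> (forall i, `|y i| <= B0) -> (forall n i, `|w n i| <= B n) ->
  (forall i (e : R), 0 < e -> exists M, forall n, (M <= n)%N -> `|w n i| <= e) ->
  (exists i, d <= `|y i|) -> (forall n, exists i, d <= `|w n i|) ->
  exists phi : nat -> nat, {homo phi : m n / (m < n)%N >-> (m < n)%N} /\
    forall n (c : R) (b : nat -> R) (A : R),
    (forall i, `|c * y i + \sum_(j < n) b j * w (phi j) i| <= A) ->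
    [/\ `|c| <= 4 / d * A, forall j, (j < n)%N -> `|b j| <= 4 / d * A &
        forall m i, (m <= n)%N -> `|c * y i + \sum_(j < m) b j * w (phi j) i| <= 2 * A].
Proof.
move=> d0 yB wB w0 yd wd.
(* The net error is at most [(m + 1) * eps m <= d / 12] and the sum of all [eps] at most [d / 6];
   together they give the [d / 4] in [hm]. *)
pose eps n : R := d / 12 * 2^-1 ^+ n.
have eps0 n : 0 < eps n by rewrite mulr_gt0 ?exprn_gt0//; lra.
pose u s l i := if l is l'.+1 then w (nth 0%N s l') i else y i.
have /choice[p pP] : forall s, exists p : nat * (nat -> I), forall i,
    exists2 j, (j < p.1)%N & forall l, (l < (size s).+1)%N -> `|u s l i - u s l (p.2 j)| <= eps (size s).
  move=> s; have [|K [G KG]] := @finite_net R I i0 (u s)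
    (fun l => if l is l'.+1 then B (nth 0%N s l') else B0) (size s).+1 _ (eps0 (size s)).
    by move=> [|l] i /=.
  by exists (K, G).
(* The new vector must be small on the nets of all prefixes, not only of the latest: in the tail
   estimate every later vector is evaluated at a point of the net of stage [m]. *)
pose Q s n := all (fun m => m < n)%N s /\ forall k j, (k < (size s).+1)%N -> (j < (p (take k s)).1)%N ->
  `|w n ((p (take k s)).2 j)| <= eps (size s).
have Qex s : exists n, Q s n.
  have /choice[M MP] : forall i, exists M, forall n, (M <= n)%N -> `|w n i| <= eps (size s).
    by move=> i; exact: w0.
  pose n1 := \max_(m <- s) m.
  pose n2 := \max_(k < (size s).+1) \max_(j < (p (take k s)).1) M ((p (take k s)).2 j).
  exists (maxn n1.+1 n2); split.
    by apply/allP => m ms; rewrite leq_max ltnS (@leq_bigmax_seq _ s xpredT id m ms isT).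
  move=> k j ks jK; apply: MP; rewrite leq_max; apply/orP; right.
  apply: leq_trans (leq_bigmax (Ordinal ks)).
  exact: (leq_bigmax (Ordinal jK)).
have [phi phiP] := ex_history Qex.
exists phi; split.
  move=> m n mn; have [/allP/(_ (phi m)) + _] := phiP n; apply.
  by apply/mapP; exists m => //; rewrite mem_iota.
move=> n c b A hA.
pose h m i := c * y i + \sum_(j < m) b j * w (phi j) i.
(* All errors are measured by the largest coefficient, not yet bounded; it is absorbed at the end
   through [d * bt <= 2 * A + d / 2 * bt]. *)
pose bt := \big[Order.max/`|c|]_(j < n) `|b j|.
have cbt : `|c| <= bt by exact: bigmax_ge_id.
have bbt j : (j < n)%N -> `|b j| <= bt.
  by move=> jn; exact: (@le_bigmax _ _ _ `|c| (fun j : 'I_n => `|b j|) (Ordinal jn)).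
have bt0 : 0 <= bt by apply: le_trans cbt.
have A0 : 0 <= A by apply: le_trans (hA i0).
have hm m i : (m <= n)%N -> `|h m i| <= A + d / 4 * bt.
  move=> mn; have [j jK jP] := pP (mkseq phi m) i.
  rewrite size_mkseq in jP; set i' := _.2 j in jP.
  have h1 : `|h m i - h m i'| <= (d / 12) * bt.
    have uE l i1 : (l < m)%N -> u (mkseq phi m) l.+1 i1 = w (phi l) i1.
      by move=> lm; rewrite /u nth_mkseq.
    apply: (@le_trans _ _ (bt * (m.+1%:R * eps m))); last first.
      rewrite mulrC ler_wpM2r// /eps mulrCA ler_piMr ?mul_geom_le1//; lra.
    have -> : h m i - h m i' = c * (y i - y i') + \sum_(l < m) b l * (w (phi l) i - w (phi l) i').
      rewrite /h opprD addrACA -mulrBr -sumrB; congr (_ + _).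
      by apply: eq_bigr => l _; rewrite mulrBr.
    apply: le_trans (ler_normD _ _) _; rewrite -natr1 mulrDl mul1r [bt * _]mulrDr addrC; apply: lerD; last first.
      by rewrite normrM ler_pM//; exact: (jP 0%N).
    apply: le_trans (ler_norm_sum _ _ _) _.
    have -> : bt * (m%:R * eps m) = \sum_(l < m) bt * eps m.
      by rewrite sumr_const card_ord -[RHS]mulr_natl; ring.
    apply: ler_sum => l _; rewrite normrM ler_pM// ?bbt//; first exact: leq_trans mn.
    by have := jP l.+1 (ltn_ord l); rewrite !uE.
  have h2 : `|h n i' - h m i'| <= d / 6 * bt.
    have -> : h n i' - h m i' = \sum_(m <= l < n) b l * w (phi l) i'.
      rewrite /h opprD addrACA subrr add0r -!(big_mkord xpredT (fun l => b l * w (phi l) i')).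
      by rewrite (@big_cat_nat _ _ _ m 0 n)//= addrAC subrr add0r.
    apply: le_trans (ler_norm_sum _ _ _) _.
    apply: (@le_trans _ _ (\sum_(m <= l < n) bt * eps l)).
      rewrite big_seq [leRHS]big_seq; apply: ler_sum => l; rewrite mem_index_iota => /andP[ml ln].
      rewrite normrM ler_pM// ?bbt//.
      have [_ /(_ m j)] := phiP l; rewrite size_mkseq.
      have -> : take m (mkseq phi l) = mkseq phi m.
        by rewrite /mkseq -map_take take_iota (minn_idPl ml).
      by apply.
    rewrite -mulr_sumr mulrC ler_wpM2r//.
    apply: (@le_trans _ _ (\sum_(l < n) eps l)).
      rewrite -(big_mkord xpredT eps) (@big_cat_nat _ _ _ m 0 n)//= lerDr.
      by apply: sumr_ge0 => l _; exact: ltW.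
    by rewrite -mulr_sumr; have := sum_geom n; nra.
  have := hA i'; rewrite -/(h n i').
  have := lerB_dist (h n i') (h n i' - h m i'); rewrite subKr.
  have := ler_normB (h n i') (h n i' - h m i'); rewrite subKr.
  have := ler_normD (h m i - h m i') (h m i'); rewrite subrK.
  by lra.
have cd : `|c| * d <= A + d / 4 * bt.
  have [i yi] := yd; have := hm 0%N i (leq0n _); rewrite /h big_ord0 addr0 normrM.
  by apply: le_trans; rewrite ler_wpM2l.
have bd j : (j < n)%N -> `|b j| * d <= 2 * A + d / 2 * bt.
  move=> jn; have [i wi] := wd (phi j).
  have e1 := hm j.+1 i jn; have e2 := hm j i (ltnW jn).
  have e3 : h j.+1 i - h j i = b j * w (phi j) i by rewrite /h big_ord_recr /=; ring.
  have := ler_normB (h j.+1 i) (h j i); rewrite e3 normrM.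
  have : `|b j| * d <= `|b j| * `|w (phi j) i| by rewrite ler_wpM2l.
  by lra.
have dbt : 0 <= d * bt by apply: mulr_ge0 => //; exact: ltW.
have btA : bt <= 4 / d * A.
  have : bt <= (2 * A + d / 2 * bt) / d.
    apply: bigmax_le => [|j _]; rewrite ler_pdivlMr//; last exact: bd.
    by apply: le_trans cd _; lra.
  rewrite ler_pdivlMr// => h1; rewrite mulrAC ler_pdivlMr//; lra.
split; [exact: le_trans btA|by move=> j /bbt/le_trans; apply|].
move=> m i mn; apply: le_trans (hm m i mn) _.
have : d / 4 * bt <= d / 4 * (4 / d * A) by rewrite ler_wpM2l//; lra.
have -> : d / 4 * (4 / d * A) = A by field; rewrite gt_eqF.
by lra.
Qed.

End Selection.

(** * Real sequences of finite variation *)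

Section BoundedVariation.
Variable R : realType.
Implicit Type u : nat -> R.

Definition finite_variation u := exists V : R, forall n, \sum_(i < n) `|u i.+1 - u i| <= V.

Lemma variation_ge u p q : (p <= q)%N -> `|u q - u p| <= \sum_(p <= i < q) `|u i.+1 - u i|.
Proof. by move=> pq; rewrite -telescope_sumr//; exact: ler_norm_sum. Qed.

Lemma homo_ltn_ge (psi : nat -> nat) n : {homo psi : m n / (m < n)%N >-> (m < n)%N} ->
  (n <= psi n)%N.
Proof.
by move=> psiM; elim: n => [//|n IH]; apply: leq_ltn_trans IH (psiM _ _ (ltnSn n)).
Qed.

Lemma subseq_variation_le u (psi : nat -> nat) n : {homo psi : m n / (m < n)%N >-> (m < n)%N} ->
  \sum_(i < n) \sum_(psi i <= j < psi i.+1) `|u j.+1 - u j| <= \sum_(j < psi n) `|u j.+1 - u j|.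
Proof.
move=> psiM; elim: n => [|n IH]; first by rewrite big_ord0 sumr_ge0.
rewrite big_ord_recr /= -(big_mkord xpredT (fun j => `|u j.+1 - u j|)).
rewrite (@big_cat_nat _ _ _ (psi n) 0)//=; last exact/ltnW/psiM.
by rewrite big_mkord lerD2r.
Qed.

Lemma finite_variation_subseq u (psi : nat -> nat) :
  {homo psi : m n / (m < n)%N >-> (m < n)%N} ->
  finite_variation u -> finite_variation (u \o psi).
Proof.
move=> psiM [V VP]; exists V => n; apply: le_trans (VP (psi n)).
apply: le_trans (subseq_variation_le u n psiM); apply: ler_sum => i _ /=.
by apply: variation_ge; exact/ltnW/psiM.
Qed.

Lemma finite_variation_bounded u : finite_variation u -> exists W : R, forall n, `|u n| <= W.
Proof.
move=> [V VP]; exists (`|u 0%N| + V) => n.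
have := variation_ge u (leq0n n); rewrite big_mkord => h.
have := ler_normD (u n - u 0%N) (u 0%N); rewrite subrK.
by have := VP n; lra.
Qed.

Lemma finite_variation_cvg u : finite_variation u ->
  exists l : R, forall e : R, 0 < e -> exists M, forall n, (M <= n)%N -> `|u n - l| <= e.
Proof.
move=> [V VP].
have /normed_cvg cs : cvgn [normed series (telescope u)].
  apply: nondecreasing_is_cvgn.
    apply: nondecreasing_series => n _ _. exact: normr_ge0.
  by exists V => _ [n _ <-]; have := VP n; rewrite -(big_mkord xpredT (fun i => `|u i.+1 - u i|)).
have cu : cvgn u.
  rewrite (_ : u = (fun n => u 0%N + series (telescope u) n)).
    by apply: is_cvgD => //; exact: is_cvg_cst.
  by apply/funext => n; exact: eq_sum_telescope.
exists (limn u) => e e0.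
have /cvgrPdist_le/(_ _ e0)[M _ MP] := cu.
by exists M => n Mn; rewrite distrC; exact: MP.
Qed.

Lemma cvg_unique_eps u (l l' : R) :
  (forall e : R, 0 < e -> exists M, forall n, (M <= n)%N -> `|u n - l| <= e) ->
  (forall e : R, 0 < e -> exists M, forall n, (M <= n)%N -> `|u n - l'| <= e) -> l = l'.
Proof.
move=> ul ul'; apply/eqP; rewrite -subr_eq0 -normr_le0.
apply: (@le_of_small _ 2) => // e e0.
have [M MP] := ul _ e0; have [M' MP'] := ul' _ e0.
have := MP _ (leq_maxl M M'); have := MP' _ (leq_maxr M M'); set n := maxn _ _.
have := ler_normB (u n - l') (u n - l); rewrite opprB addrC addrA subrK.
by lra.
Qed.

End BoundedVariation.

(** * Limits of functionals along an ultrafilter *)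

Section Ultralimit.
Variables (R : realType) (X : normedModType R).

(** Compactness of the interval between [- N u] and [N u] gives the limit at each [u]. An
    ultrafilter is used because on a nonseparable space a bounded sequence of functionals need not
    have a pointwise convergent subsequence. *)
Lemma ultralimit (N : X -> R) (e : nat -> X -> R) :
  (forall q, linear_form (e q)) -> (forall q u, `|e q u| <= N u) ->
  exists g : X -> R, [/\ linear_form g, forall u, `|g u| <= N u &
    forall u (c : R) q0, (forall q, (q0 <= q)%N -> c <= `|e q u|) -> c <= `|g u|].
Proof.
move=> el eN.
have [U [UU Uoo]] := @ultraFilterLemma nat \oo _.
have lim u : exists l : R, forall eps : R, 0 < eps -> U [set q | `|e q u - l| < eps].
  have := @segment_compact R (- N u) (N u).
  move=> /(_ (fmap (e ^~ u) U) _) [].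
    by apply: (@filterS nat U _ setT); [move=> q _ /=; rewrite in_itv/= -ler_norml|exact: filterT].
  move=> l [_ lcl]; exists l => eps e0.
  have [//|nU] := in_ultra_setVsetC [set q | `|e q u - l| < eps] UU.
  have Fn : U (e ^~ u @^-1` (e ^~ u @` (~` [set q | `|e q u - l| < eps]))).
    by apply: filterS nU => q qn; exists q.
  have [r [[q qn <-]]] := lcl _ _ Fn (nbhsx_ballx l _ e0).
  by rewrite -ball_normE /= distrC.
have /choice[g gP] := lim.
have near u1 u2 u3 (eps : R) : 0 < eps -> forall q0, exists q, [/\ (q0 <= q)%N,
   `|e q u1 - g u1| < eps, `|e q u2 - g u2| < eps & `|e q u3 - g u3| < eps].
  move=> e0 q0.
  have Uq : U [set q | (q0 <= q)%N] by apply: Uoo; exists q0.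
  have [q [? [? [? ?]]]] : exists q, ([set q | (q0 <= q)%N] `&` ([set q | `|e q u1 - g u1| < eps] `&`
      ([set q | `|e q u2 - g u2| < eps] `&` [set q | `|e q u3 - g u3| < eps]))) q.
    by apply: (@filter_ex _ U); apply: filterI => //; apply: filterI; [exact: gP|apply: filterI; exact: gP].
  by exists q.
exists g; split.
- move=> a u v; apply/eqP; rewrite -subr_eq0 -normr_le0.
  apply: (@le_of_small _ (`|a| + 2)); first by rewrite addr_ge0.
  move=> eps e0; rewrite add0r; have [q [_ h1 h2 h3]] := near (a *: u + v) u v _ e0 0%N.
  have -> : g (a *: u + v) - (a * g u + g v) =
    a * (e q u - g u) + (e q v - g v) - (e q (a *: u + v) - g (a *: u + v)).
    by rewrite el; ring.
  apply: le_trans (ler_normB _ _) _.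
  have := ler_normD (a * (e q u - g u)) (e q v - g v); rewrite normrM.
  have : `|a| * `|e q u - g u| <= `|a| * eps by rewrite ler_wpM2l// ltW.
  by lra.
- move=> u; apply: (@le_of_small _ 1) => // eps e0.
  have [q [_ h _ _]] := near u u u _ e0 0%N.
  have := ler_normB (e q u) (e q u - g u); rewrite subKr.
  by have := eN q u; lra.
- move=> u c q0 h; apply: (@le_of_small _ 1) => // eps e0.
  have [q [q0q hq _ _]] := near u u u _ e0 q0.
  have := ler_normD (e q u - g u) (g u); rewrite subrK.
  by have := h _ q0q; lra.
Qed.

End Ultralimit.

Section Closure.
Variables (R : realType) (X : normedModType R).

Lemma seminorm_norm : seminorm (fun u : X => `|u|).
Proof. by split=> [u v|a u]; [exact: ler_normD|exact: normrZ]. Qed.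

Lemma clspan_nclosure (z : nat -> X) : clspan (range z) = nclosure (fun u => `|u|) z.
Proof.
apply/seteqP; split=> y yz.
  move=> e e0; have [s [ss]] := yz _ (nbhsx_ballx y _ e0).
  by rewrite -ball_normE /=; exists s.
move=> B /nbhs_ballP[e /= e0 eB]; have [s ss ys] := yz _ e0.
by exists s; split=> //; apply: eB; rewrite -ball_normE.
Qed.

Lemma lsubspace_clspan (z : nat -> X) : lsubspace (clspan (range z)).
Proof. by rewrite clspan_nclosure; exact/lsubspace_nclosure/seminorm_norm. Qed.

Lemma lspan_clspan (S : set X) : lspan S `<=` clspan S.
Proof. exact: subset_closure. Qed.

Lemma clspan_sub (S S' : set X) : S `<=` lspan S' -> clspan S `<=` clspan S'.
Proof. by move=> SS'; apply: closureS; apply: lspan_min SS'; exact: lsubspace_lspan. Qed.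

End Closure.

(** * Two sources of basic sequences that are summable on [E] *)

Section Subsequences.
Variables (R : realType) (X : normedModType R) (N : X -> R) (C : R) (E : set (X -> R)).
Hypotheses (sN : seminorm N) (C0 : 0 < C) (CN : forall x, `|x| <= C * N x)
  (NC : forall x, N x <= C * `|x|).
Hypothesis El : forall e, E e -> linear_form e.
Hypothesis EN : forall e, E e -> forall x, `|e x| <= N x.
Hypothesis Eatt : forall x, exists2 e, E e & `|e x| = N x.

Let N0 x : N x = 0 -> x = 0.
Proof. by move=> Nx; apply/eqP; rewrite -normr_le0; have := CN x; rewrite Nx mulr0. Qed.

(* A combination of the differences with coefficients [a] is, up to its first m terms, the
   truncation of a combination of [f] and the [x n - f]; as [a m] is the coefficient of [f]
   in it and [f] stays at distance [d] from X, [a m] is bounded. *)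
Lemma subseq_limit_outside (E' : set (X -> R)) (x : nat -> X) (B : R) (f : (X -> R) -> R) (d : R) :
  E `<=` E' -> (forall e, E' e -> linear_form e) -> (forall e, E' e -> forall u, `|e u| <= N u) ->
  (forall n, N (x n) <= B) ->
  (forall e, E' e -> forall eps : R, 0 < eps -> exists M, forall n, (M <= n)%N -> `|e (x n) - f e| <= eps) ->
  0 < d -> (forall u, exists2 e, E' e & d <= `|e u - f e|) ->
  (forall e, E e -> finite_variation (e \o x)) ->
  exists phi : nat -> nat, {homo phi : m n / (m < n)%N >-> (m < n)%N} /\
    iso_polyhedral (clspan (range (x \o phi))).
Proof.
move=> EE' El' EN' xB xf d0 fd xbv.
have [e0 Ee0 _] := Eatt 0.
have B0 : 0 <= B by apply: le_trans (xB 0%N); exact: seminorm_ge0.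
have fB e : E' e -> `|f e| <= B + 1.
  move=> Ee; have [M /(_ M (leqnn _)) h] := xf _ Ee 1 ltr01.
  have := ler_normB (e (x M)) (e (x M) - f e); rewrite subKr.
  by have := le_trans (EN' _ Ee (x M)) (xB M); lra.
have wB (e : {e | E' e}) n : `|sval e (x n) - f (sval e)| <= 2 * B + 1.
  have := ler_normB (sval e (x n)) (f (sval e)).
  by have := fB _ (svalP e); have := le_trans (EN' _ (svalP e) (x n)) (xB n); lra.
have [|||||phi [phiM phiP]] := @basic_selection R {e | E' e} (exist _ e0 (EE' _ Ee0))
    (fun e => f (sval e)) (fun n e => sval e (x n) - f (sval e)) (B + 1) (fun=> 2 * B + 1) d d0.
- by move=> e; exact/fB/(svalP e).
- by move=> n e; exact: wB.
- by move=> e; exact: xf (svalP e).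
- have [e Ee h] := fd 0; exists (exist _ e Ee) => /=.
  by move: h; rewrite (linear_form0 (El' _ Ee)) sub0r normrN.
- by move=> n; have [e Ee h] := fd (x n); exists (exist _ e Ee).
exists phi; split=> //.
pose x' := x \o phi.
pose z n := if n is m.+1 then x' n - x' m else x' n.
have dd : 0 <= 2 / d by rewrite divr_ge0// ltW.
have dB : 0 <= 2 / d * (2 * B + 1) by rewrite mulr_ge0// addr_ge0// mulr_ge0.
have key n (a : nat -> R) : let A := N (\sum_(i < n) a i *: z i) in
    (forall m, (m <= n)%N -> N (\sum_(i < m) a i *: z i) <= (2 + 2 / d * (2 * B + 1)) * A) /\
    (forall j, (j < n)%N -> `|a j| <= 2 / d * A).
  move=> A; have A0 : 0 <= A by exact: seminorm_ge0.
  pose a' i := if (i < n)%N then a i else 0.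
  have aa' m : (m <= n)%N -> \sum_(i < m) a i *: z i = \sum_(i < m) a' i *: z i.
    by move=> mn; apply: eq_bigr => i _; rewrite /a' (leq_trans (ltn_ord i) mn).
  (* Abel summation: [b] holds the coefficients with respect to [x']. The sum of the first [m] of
     them telescopes to [a' 0 - a' m], which gives the identity [hS]. *)
  pose b i := a' i - a' i.+1.
  pose S m := \sum_(i < m) b i *: x' i.
  have TS m : \sum_(i < m.+1) a' i *: z i = S m + a' m *: x' m.
    elim: m => [|m IH]; first by rewrite big_ord1 /S big_ord0 add0r.
    rewrite big_ord_recr /= IH /S big_ord_recr /= /b scalerBl scalerBr.
    rewrite -!addrA; congr (_ + (_ + _)).
    by rewrite addrC.
  have hS m e : E' e -> a' 0%N * f e + \sum_(j < m) b j * (e (x' j) - f e) = a' m * f e + e (S m).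
    move=> Ee; elim: m => [|m IH]; first by rewrite big_ord0 /S big_ord0 (linear_form0 (El' _ Ee)) !addr0.
    rewrite big_ord_recr /= addrA IH /S big_ord_recr /= (linear_formD _ _ (El' _ Ee)).
    by rewrite (linear_formZ _ _ (El' _ Ee)) /b; ring.
  have a'n : a' n = 0 by rewrite /a' ltnn.
  have Sn : S n = \sum_(i < n) a i *: z i.
    by rewrite aa'//; have := TS n; rewrite big_ord_recr /= a'n !scale0r !addr0.
  have [|_ _ hm] := phiP n (a' 0%N) b A.
    move=> [e Ee] /=; rewrite (hS n e Ee) a'n mul0r add0r Sn.
    exact: EN'.
  have ad m : (m <= n)%N -> `|a' m| <= 2 / d * A.
    move=> mn; have [->|am] := eqVneq (a' m) 0.
      by rewrite normr0 mulr_ge0// divr_ge0// ltW.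
    have [e Ee de] := fd (- (a' m)^-1 *: S m).
    have := hm m (exist _ e Ee) mn; rewrite /= (hS m e Ee).
    have -> : a' m * f e + e (S m) = - a' m * (e (- (a' m)^-1 *: S m) - f e).
      by rewrite (linear_formZ _ _ (El' _ Ee)); field.
    rewrite normrM normrN => h.
    have : `|a' m| * d <= 2 * A by apply: le_trans h; rewrite ler_wpM2l.
    by rewrite -ler_pdivlMr// => /le_trans; apply; rewrite mulrAC.
  split=> [[|m] mn|j jn].
  - by rewrite big_ord0 (seminorm0 sN) mulr_ge0// addr_ge0.
  - rewrite (aa' m.+1)// TS; have [e Ee <-] := Eatt (S m + a' m *: x' m).
    have -> : e (S m + a' m *: x' m) = a' m * f e + e (S m) + a' m * (e (x' m) - f e).
      by rewrite (linear_formD _ _ (El Ee)) (linear_formZ _ _ (El Ee)); ring.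
    have h1 := hm m (exist _ e (EE' _ Ee)) (ltnW mn); rewrite /= (hS m e (EE' _ Ee)) in h1.
    have h2 : `|a' m * (e (x' m) - f e)| <= 2 / d * A * (2 * B + 1).
      by rewrite normrM ler_pM// ?ad 1?ltnW//; exact: (wB (exist _ e (EE' _ Ee))).
    by apply: le_trans (ler_normD _ _) _; lra.
  - by have := ad j (ltnW jn); rewrite /a' jn.
pose k := 2 + 2 / d * (2 * B + 1) + 2 / d.
have zY n : lspan (range x') (z n).
  case: n => [|n]; first by apply: subset_lspan; exists 0%N.
  by apply: (lsubspaceB (lsubspace_lspan _)); apply: subset_lspan; [exists n.+1|exists n].
have x'z n : lspan (range z) (x' n).
  elim: n => [|n IH]; first by apply: subset_lspan; exists 0%N.
  rewrite -(subrK (x' n) (x' n.+1)); apply: (lsubspaceD (lsubspace_lspan _)) => //.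
  by apply: subset_lspan; exists n.+1.
apply: (@basic_iso_polyhedral R X N C E z k) => //.
- by rewrite /k; lra.
- move=> n b m mn; have [h _] := key n b; apply: le_trans (h m mn) _.
  by rewrite ler_wpM2r ?(seminorm_ge0 sN)// /k; lra.
- move=> n b j jn; have [_ h] := key n b; apply: le_trans (h j jn) _.
  by rewrite ler_wpM2r ?(seminorm_ge0 sN)// /k; lra.
- move=> e Ee; have [V VP] := finite_variation_subseq phiM (xbv e Ee).
  exists (`|e (z 0%N)| + V) => -[|n].
    by rewrite big_ord0 addr_ge0//; have := VP 0%N; rewrite big_ord0.
  rewrite big_ord_recl /= lerD2l; apply: le_trans (VP n); apply: ler_sum => i _ /=.
  by rewrite (linear_formB _ _ (El Ee)).
- exact: lsubspace_clspan.
- by apply: clspan_sub => _ [n _ <-].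
- apply: (@independent_infinite_dim _ _ _ z); first by move=> n; apply: lspan_clspan.
  move=> n b bz i iN; have [_ /(_ i iN)] := key n b.
  by rewrite bz (seminorm0 sN) mulr0 normr_le0 => /eqP.
Qed.

(** The basic sequence is [y] followed by a subsequence of [w]: summability makes [w] tend to 0 on
    [E], while the lower bound on [N] keeps its terms away from 0. The subsequence of [x] lies in
    the span, and is independent because [s] does not vanish. *)
Lemma subseq_summable (x w : nat -> X) (y : X) (s : nat -> R) (t d : R) :
  y != 0 -> (forall n, s n != 0) -> (forall n, x n = s n *: w n + t *: y) ->
  0 < d -> (forall n, d <= N (w n)) ->
  (forall e, E e -> exists V : R, forall n, \sum_(i < n) `|e (w i)| <= V) ->
  exists phi : nat -> nat, {homo phi : m n / (m < n)%N >-> (m < n)%N} /\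
    iso_polyhedral (clspan (range (x \o phi))).
Proof.
move=> y0 s0 xE d0 wd wV.
have [e0 Ee0 _] := Eatt 0.
have Ny : 0 < N y.
  by rewrite lt_neqAle (seminorm_ge0 sN) andbT eq_sym; apply/eqP => /N0 /eqP; apply/negP.
pose dl := Order.min d (N y).
have dl0 : 0 < dl by rewrite lt_min d0.
have [|||||phi [phiM phiP]] := @basic_selection R {e | E e} (exist _ e0 Ee0)
    (fun e => sval e y) (fun n e => sval e (w n)) (N y) (fun n => N (w n)) dl dl0.
- by move=> [e Ee]; exact: EN.
- by move=> n [e Ee]; exact: EN.
- move=> [e Ee] eps eps0 /=; have [V VP] := wV _ Ee.
  have : cvgn (series (fun i => `|e (w i)|)).
    apply: nondecreasing_is_cvgn; first by apply: nondecreasing_series => n _ _; exact: normr_ge0.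
    by exists V => _ [n _ <-]; have := VP n; rewrite -(big_mkord xpredT (fun i => `|e (w i)|)).
  move=> /cvg_series_cvg_0 /cvgrPdist_le/(_ _ eps0)[M _ MP].
  by exists M => n Mn; have := MP n Mn; rewrite /= sub0r normrN normr_id.
- by have [e Ee ey] := Eatt y; exists (exist _ e Ee); rewrite /= ey ge_min lexx orbT.
- by move=> n; have [e Ee ew] := Eatt (w n); exists (exist _ e Ee); rewrite /= ew ge_min wd.
exists phi; split=> //.
pose x' := x \o phi; pose z n := if n is m.+1 then w (phi m) else y.
have zE n (a : nat -> R) : \sum_(i < n.+1) a i *: z i = a 0%N *: y + \sum_(i < n) a i.+1 *: w (phi i).
  by rewrite big_ord_recl.
have key n (a : nat -> R) : let A := N (\sum_(i < n) a i *: z i) in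
    (forall m, (m <= n)%N -> N (\sum_(i < m) a i *: z i) <= 2 * A) /\
    (forall j, (j < n)%N -> `|a j| <= 4 / dl * A).
  move=> A; have A0 : 0 <= A by exact: seminorm_ge0.
  case: n => [|n] in A A0 *.
    by split=> // m; rewrite leqn0 => /eqP ->; rewrite big_ord0 (seminorm0 sN) mulr_ge0.
  have eE m e : E e -> e (\sum_(i < m.+1) a i *: z i) = a 0%N * e y + \sum_(i < m) a i.+1 * e (w (phi i)).
    by move=> Ee; rewrite zE (El Ee) (linear_form_lc _ _ (El Ee)).
  have [|h0 hj hm] := phiP n (a 0%N) (fun i => a i.+1) A.
    by move=> [e Ee] /=; rewrite -eE//; exact: EN.
  split=> [[|m] mn|[|j] jn].
  - by rewrite big_ord0 (seminorm0 sN) mulr_ge0.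
  - have [e Ee <-] := Eatt (\sum_(i < m.+1) a i *: z i).
    by rewrite eE//; exact: (hm m (exist _ e Ee)).
  - exact: h0.
  - exact: hj.
have dd : 0 <= 4 / dl by rewrite divr_ge0// ltW.
pose k := 2 + 4 / dl.
have x'z n : lspan (range z) (x' n).
  rewrite /x' /= xE; apply: (lsubspaceD (lsubspace_lspan _)).
    by apply: (lsubspaceZ _ (lsubspace_lspan _)); apply: subset_lspan; exists n.+1.
  by apply: (lsubspaceZ _ (lsubspace_lspan _)); apply: subset_lspan; exists 0%N.
apply: (@basic_iso_polyhedral R X N C E z k) => //.
- by rewrite /k; lra.
- move=> n b m mn; have [h _] := key n b; apply: le_trans (h m mn) _.
  by rewrite ler_wpM2r ?(seminorm_ge0 sN)// /k; lra.
- move=> n b j jn; have [_ h] := key n b; apply: le_trans (h j jn) _.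
  by rewrite ler_wpM2r ?(seminorm_ge0 sN)// /k; lra.
- move=> e Ee; have [V VP] := wV e Ee.
  exists (`|e y| + V) => -[|n].
    by rewrite big_ord0 addr_ge0//; have := VP 0%N; rewrite big_ord0.
  rewrite big_ord_recl /= lerD2l; apply: le_trans (VP (phi n)).
  elim: n => [|n IH]; first by rewrite big_ord0 sumr_ge0.
  rewrite big_ord_recr /=.
  apply: (@le_trans _ _ (\sum_(i < (phi n).+1) `|e (w i)|)).
    by rewrite big_ord_recr /= lerD2r.
  rewrite -!(big_mkord xpredT (fun i => `|e (w i)|)).
  rewrite [leRHS](@big_cat_nat _ _ _ (phi n).+1 0)//=; last exact: phiM.
  by rewrite lerDl sumr_ge0.
- exact: lsubspace_clspan.
- by apply: clspan_sub => _ [n _ <-].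
- apply: (@independent_infinite_dim _ _ _ x'); first by move=> n; apply/lspan_clspan/subset_lspan; exists n.
  move=> n b bx i iN; pose a j := if j is j'.+1 then b j' * s (phi j') else (\sum_(l < n) b l) * t.
  have az : \sum_(j < n.+1) a j *: z j = 0.
    rewrite zE -[RHS]bx /a mulr_suml scaler_suml -big_split /=; apply: eq_bigr => j _.
    by rewrite /x' /= xE scalerDr !scalerA addrC.
  have [_ /(_ i.+1 iN)] := key n.+1 a.
  rewrite az (seminorm0 sN) mulr0 normr_le0 /= mulf_eq0 (negbTE (s0 _)) orbF => /eqP.
  by [].
Qed.

End Subsequences.

(** * From the summability condition to a polyhedral subsequence *)

Section Forward.
Variables (R : realType) (X : completeNormedModType R) (N : X -> R) (C : R) (E : set (X -> R)).
Hypotheses (sN : seminorm N) (C0 : 0 < C) (CN : forall x, `|x| <= C * N x)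
  (NC : forall x, N x <= C * `|x|).
Hypothesis El : forall e, E e -> linear_form e.
Hypothesis EN : forall e, E e -> forall x, `|e x| <= N x.
Hypothesis Eatt : forall x, exists2 e, E e & `|e x| = N x.

Let N0 x : N x = 0 -> x = 0.
Proof. by move=> Nx; apply/eqP; rewrite -normr_le0; have := CN x; rewrite Nx mulr0. Qed.

Let finite_variation_shift (x : nat -> X) (u : X) e : E e ->
  finite_variation (e \o x) -> finite_variation (e \o (fun n => x n - u)).
Proof.
move=> Ee [V VP]; exists V => n; apply: le_trans (VP n); apply: ler_sum => i _ /=.
rewrite !(linear_formB _ _ (El Ee)) le_eqVlt; apply/orP; left; apply/eqP; congr `|_|.
by ring.
Qed.

Lemma subseq_ge (P : nat -> nat -> Prop) : (forall k p, exists2 n, (p <= n)%N & P k n) ->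
  exists2 psi : nat -> nat, {homo psi : m n / (m < n)%N >-> (m < n)%N} & forall k, P k (psi k).
Proof.
move=> Pex; have [s|psi psiP] := @ex_history (fun s n => all (fun m => (m < n)%N) s /\ P (size s) n).
  have [n pn Pn] := Pex (size s) (\max_(m <- s) m).+1; exists n; split=> //.
  apply/allP => m ms; apply: leq_trans pn; rewrite ltnS.
  exact: (@leq_bigmax_seq _ s xpredT id m ms isT).
exists psi => [m n mn|k]; last by have [_] := psiP k; rewrite size_mkseq.
have [/allP/(_ (psi m)) + _] := psiP n; apply.
by apply/mapP; exists m => //; rewrite mem_iota.
Qed.

(** By finite variation each e in [E] is bounded along [x], so on normalized terms with [N (x n)] at
    least [2 ^ k] its values are dominated by a geometric series. *)
Lemma forward_unbounded (x : nat -> X) :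
  (forall e, E e -> finite_variation (e \o x)) -> ~ (exists B, forall n, N (x n) <= B) ->
  exists phi : nat -> nat, {homo phi : m n / (m < n)%N >-> (m < n)%N} /\
    iso_polyhedral (clspan (range (x \o phi))).
Proof.
move=> xV unb.
have big k p : exists2 n, (p <= n)%N & 2 ^+ k <= N (x n).
  apply: contrapT => H; apply: unb; exists (2 ^+ k + \sum_(i < p) N (x i)) => n.
  have S0 : 0 <= \sum_(i < p) N (x i) by apply: sumr_ge0 => i _; exact: seminorm_ge0.
  have [pn|np] := leqP p n.
    have h : N (x n) < 2 ^+ k by rewrite ltNge; apply/negP => h; apply: H; exists n.
    by lra.
  rewrite (bigD1 (Ordinal np))//= addrCA lerDl addr_ge0 ?exprn_ge0//.
  by apply: sumr_ge0 => i _; exact: seminorm_ge0.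
have [psi psiM psiP] := subseq_ge big.
have Npos k : 0 < N (x (psi k)) by apply: lt_le_trans (psiP k); rewrite exprn_gt0.
have xn0 : x (psi 0%N) != 0.
  by apply/eqP => h; have := Npos 0%N; rewrite h (seminorm0 sN) ltxx.
have [|||||phi [phiM Hphi]] := @subseq_summable R X N C E sN C0 CN NC El EN Eatt
    (x \o psi) (fun n => (N (x (psi n)))^-1 *: x (psi n)) (x (psi 0%N)) (fun n => N (x (psi n))) 0 1 xn0.
- by move=> n; rewrite gt_eqF.
- by move=> n; rewrite scalerA mulfV ?gt_eqF// scale1r scale0r addr0.
- exact: ltr01.
- by move=> n; rewrite (seminormZ sN) ger0_norm ?invr_ge0 ?(ltW (Npos n))// mulVf ?gt_eqF.
- move=> e Ee; have [W WP] := finite_variation_bounded (xV e Ee).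
  have W0 : 0 <= W by apply: le_trans (WP 0%N).
  exists (2 * W) => n; apply: (@le_trans _ _ (\sum_(i < n) 2^-1 ^+ i * W)); last first.
    by rewrite -mulr_suml ler_wpM2r// sum_geom.
  apply: ler_sum => i _; rewrite (linear_formZ _ _ (El Ee)) normrM ler_pM//; last exact: WP.
  rewrite ger0_norm ?invr_ge0 ?(ltW (Npos _))// exprVn lef_pV2 ?posrE ?exprn_gt0//.
by exists (psi \o phi); split=> // m n mn; exact/psiM/phiM.
Qed.

(* Between two consecutive chosen indices every e in E has a small value, so its value at the
   first one is at most a small number plus its variation between the two. *)
Lemma subseq_sparse (w : nat -> X) :
  (forall e, E e -> finite_variation (e \o w)) ->
  (forall p (r : R), 0 < r -> exists q, forall e, E e ->
     exists k, [/\ (p <= k)%N, (k <= q)%N & `|e (w k)| < r]) ->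
  exists2 psi : nat -> nat, {homo psi : m n / (m < n)%N >-> (m < n)%N} &
    forall e, E e -> exists V : R, forall n, \sum_(i < n) `|e (w (psi i))| <= V.
Proof.
move=> wV wq.
have /choice[q qP] : forall pk : nat * nat, exists q, forall e, E e ->
    exists j, [/\ (pk.1 <= j)%N, (j <= q)%N & `|e (w j)| < 2^-1 ^+ pk.2].
  by move=> [p k]; apply: wq; rewrite exprn_gt0.
pose psi := fix psi k := if k is k'.+1 then maxn (psi k').+1 (q (psi k', k')) else 0%N.
have psiM : {homo psi : m n / (m < n)%N >-> (m < n)%N}.
  by apply: homo_ltn => [y x z|i]; [exact: ltn_trans|rewrite /= leq_max leqnn].
exists psi => // e Ee; have [V VP] := wV e Ee; exists (2 + V) => n.
apply: (@le_trans _ _ (\sum_(i < n) (2^-1 ^+ i + \sum_(psi i <= j < psi i.+1) `|e (w j.+1) - e (w j)|))).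
  apply: ler_sum => i _; have [k [pk kq ek]] := qP (psi i, i : nat) e Ee.
  have k1 : (k <= psi i.+1)%N by apply: leq_trans kq _; rewrite /= leq_max leqnn orbT.
  have h := variation_ge (e \o w) pk.
  rewrite [X in _ <= _ + X](@big_cat_nat _ _ _ k (psi i))//=.
  have : 0 <= \sum_(k <= j < psi i.+1) `|e (w j.+1) - e (w j)| by apply: sumr_ge0.
  have := ler_normB (e (w k)) (e (w k) - e (w (psi i))); rewrite subKr.
  by move: h ek => /=; lra.
rewrite big_split /= lerD ?sum_geom//.
exact: le_trans (subseq_variation_le (e \o w) n psiM) (VP _).
Qed.

Lemma subseq_cluster (a : nat -> R) (B : R) : (forall n, `|a n| <= B) ->
  exists2 theta : nat -> nat, {homo theta : m n / (m < n)%N >-> (m < n)%N} &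
    exists l : R, forall e : R, 0 < e -> exists M, forall n, (M <= n)%N -> `|a (theta n) - l| <= e.
Proof.
move=> aB; have := @segment_compact R (- B) B.
move=> /(_ (fmap a \oo) _) [].
  by exists 0%N => // n _ /=; rewrite in_itv/= -ler_norml.
move=> l [_ lcl].
have [k p|theta thetaM thetaP] := @subseq_ge (fun k n => `|a n - l| < recip R k).
  have Fp : (fmap a \oo) (a @` [set n | (p <= n)%N]) by exists p => // n /= pn; exists n.
  have [_ [[n /= pn <-]]] := lcl _ _ Fp (nbhsx_ballx l _ (recip_gt0 R k)).
  by rewrite -ball_normE /= distrC; exists n.
exists theta => //; exists l => e e0; have [M MP] := recip_small e0.
by exists M => n Mn; apply: le_trans (ltW (thetaP n)) (MP n Mn).
Qed.

Lemma forward_bounded (x : nat -> X) (B : R) :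
  ~ cvgn x ->
  (forall e, E e -> finite_variation (e \o x)) -> (forall n, N (x n) <= B) ->
  exists phi : nat -> nat, {homo phi : m n / (m < n)%N >-> (m < n)%N} /\
    iso_polyhedral (clspan (range (x \o phi))).
Proof.
move=> ncv xV xB.
have lim_subseq (u : nat -> R) l (psi : nat -> nat) : {homo psi : m n / (m < n)%N >-> (m < n)%N} ->
    (forall e : R, 0 < e -> exists M, forall n, (M <= n)%N -> `|u n - l| <= e) ->
    (forall e : R, 0 < e -> exists M, forall n, (M <= n)%N -> `|u (psi n) - l| <= e).
  move=> psiM ul e /ul[M MP]; exists M => n Mn; apply: MP.
  exact: leq_trans Mn (homo_ltn_ge n psiM).
have /choice[f fP] : forall e, exists l : R, E e -> forall eps : R, 0 < eps ->
    exists M, forall n, (M <= n)%N -> `|e (x n) - l| <= eps.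
  move=> e; have [Ee|nE] := pselect (E e); last by exists 0 => /nE.
  by have [l lP] := finite_variation_cvg (xV e Ee); exists l => _.
have [[d [d0 fd]]|near] := pselect (exists d : R, 0 < d /\ forall u, exists2 e, E e & d <= `|e u - f e|).
  exact: (@subseq_limit_outside R X N C E sN C0 CN NC El EN Eatt E x B f d).
(* Now [f] is a uniform limit on [E] of vectors of [X]. They form a Cauchy sequence because [N] is
   attained on [E], and completeness yields the vector [xoo] representing [f]. *)
have /choice[u uP] : forall k, exists u, forall e, E e -> `|e u - f e| < recip R k.
  move=> k; apply: contrapT => H; apply: near; exists (recip R k); split; first exact: recip_gt0.
  move=> u; apply: contrapT => H1; apply: H; exists u => e Ee.
  by rewrite ltNge; apply/negP => h; apply: H1; exists e.
have uN k l : N (u k - u l) <= recip R k + recip R l.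
  have [e Ee <-] := Eatt (u k - u l); rewrite (linear_formB _ _ (El Ee)).
  have := uP k e Ee; have := uP l e Ee.
  have := ler_normB (e (u k) - f e) (e (u l) - f e).
  rewrite (_ : _ - _ - (_ - _) = e (u k) - e (u l)); last by ring.
  by lra.
have cu : cvgn u.
  apply/cauchy_cvgP/cauchy_exP => eps e0.
  have c0 : 0 < eps / (3 * C) by rewrite divr_gt0// mulr_gt0.
  have [M MP] := recip_small c0.
  exists (u M); exists M => // k /= Mk; rewrite -ball_normE /=; apply: le_lt_trans (CN _) _.
  apply: (@le_lt_trans _ _ (C * (eps / (3 * C) + eps / (3 * C)))).
    by rewrite ler_wpM2l ?(ltW C0)//; apply: le_trans (uN M k) _; rewrite lerD// MP.
  by have -> : C * (eps / (3 * C) + eps / (3 * C)) = 2 / 3 * eps; [field; rewrite gt_eqF|lra].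
pose xoo := limn u.
have xooP e : E e -> e xoo = f e.
  move=> Ee; apply/eqP; rewrite -subr_eq0 -normr_le0.
  apply: (@le_of_small _ (C + 1)) => [|eps e0]; first by rewrite addr_ge0// ltW.
  have [M1 MP1] := recip_small e0.
  have /cvgrPdist_le/(_ _ e0)[M2 _ MP2] := cu.
  have := MP2 _ (leq_maxr M1 M2); have := MP1 _ (leq_maxl M1 M2); set k := maxn _ _ => h1 h2.
  have := uP k e Ee; have := EN Ee (xoo - u k); have := NC (xoo - u k).
  have := ler_wpM2l (ltW C0) h2; rewrite (linear_formB _ _ (El Ee)).
  have := ler_normD (e xoo - e (u k)) (e (u k) - f e); rewrite addrA subrK.
  by rewrite -/xoo; lra.
pose w n := x n - xoo.
have [dl dl0 wdl] : exists2 d : R, 0 < d & forall p, exists2 n, (p <= n)%N & d <= N (w n).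
  apply: contrapT => H; apply: ncv; apply: (@cvgP _ _ xoo).
  apply/cvgrPdist_le => eps e0.
  have c0 : 0 < eps / C by rewrite divr_gt0.
  have [p pP] : exists p, forall n, (p <= n)%N -> N (w n) < eps / C.
    apply: contrapT => H1; apply: H; exists (eps / C) => // p; apply: contrapT => H2; apply: H1.
    by exists p => n pn; rewrite ltNge; apply/negP => h; apply: H2; exists n.
  exists p => // n pn; rewrite distrC; apply: le_trans (CN _) _.
  by have := pP n pn; rewrite ltr_pdivlMr// mulrC => /ltW.
have [psi psiM psiP] := subseq_ge (fun _ : nat => wdl).
pose w' := w \o psi.
have w'V e : E e -> finite_variation (e \o w').
  move=> Ee; apply: (@finite_variation_subseq _ (e \o w) _ psiM).
  exact: (finite_variation_shift _ Ee (xV e Ee)).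
(* Either every e in [E] is small somewhere in a window of uniform length, and sparse terms are
   summable; or for each [q] some e stays above [eta] from [p] to [q], and these e have an
   ultralimit. *)
have [wq|] := pselect (forall p (r : R), 0 < r -> exists q, forall e, E e ->
     exists k, [/\ (p <= k)%N, (k <= q)%N & `|e (w' k)| < r]).
  have [th thM thV] := subseq_sparse w'V wq.
  (* [subseq_summable] asks for a nonzero [y]; when [xoo] is 0 the first term of [w'] stands in,
     with coefficient [t = 0]. *)
  pose y := if xoo == 0 then w' 0%N else xoo.
  pose t : R := (xoo != 0)%:R.
  have y0 : y != 0.
    rewrite /y; case: ifPn => // _; apply/eqP => h; have : dl <= N (w' 0%N) := psiP 0%N.
    by rewrite h (seminorm0 sN) leNgt dl0.
  have [|||||phi [phiM Hphi]] := @subseq_summable R X N C E sN C0 CN NC El EN Eatt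
    (x \o (psi \o th)) (w' \o th) y (fun=> 1) t dl y0.
  - by move=> n; rewrite oner_eq0.
  - move=> n; rewrite scale1r /w' /w /= /t /y; case: eqVneq => [->|_].
      by rewrite scale0r addr0 subr0.
    by rewrite scale1r subrK.
  - by [].
  - by move=> n; exact: psiP.
  - exact: thV.
  exists (psi \o (th \o phi)); split=> // m n mn; exact/psiM/thM/phiM.
move=> /existsNP[p /existsNP[eta /not_implyP[eta0 /forallNP ne]]].
(* The functional [g] below separates [w'] from 0, although [w'] tends to 0 on [E]: on
   [E `|` [set g]] a subsequence of [x] tends to a function at positive distance from X. *)
have /choice[e eP] : forall q, exists e, E e /\ forall k, (p <= k)%N -> (k <= q)%N -> eta <= `|e (w' k)|.
  move=> q; have /existsNP[e /not_implyP[Ee nk]] := ne q.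
  exists e; split=> // k pk kq; rewrite leNgt; apply/negP => h.
  by apply: nk; exists k.
have [g [gl gN ge]] := ultralimit (fun q => El (eP q).1) (fun q => EN (eP q).1).
have gw k : (p <= k)%N -> eta <= `|g (w' k)|.
  by move=> pk; apply: (ge _ _ k) => q kq; apply: (eP q).2.
have gB k : `|g (w' k)| <= B + N xoo.
  apply: le_trans (gN _) _; apply: le_trans (seminormD sN _ _) _.
  by rewrite (seminormN sN) lerD2r.
have [th thM [gam gamP]] := subseq_cluster gB.
have gam_eta : eta <= `|gam|.
  apply: (@le_of_small _ 1) => // eps e0; have [M MP] := gamP _ e0.
  have := MP _ (leq_maxl M p); have := gw (th (maxn M p)) (leq_trans (leq_maxr M p) (homo_ltn_ge _ thM)).
  have := ler_normB (g (w' (th (maxn M p)))) (gam - g (w' (th (maxn M p)))).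
  have := ler_normD (g (w' (th (maxn M p))) - gam) gam; rewrite subrK.
  by lra.
pose f' e := if pselect (E e) then f e else g xoo + gam.
(* If [g] were in [E], its limit along [x] would be [g xoo], which contradicts that [gam] is
   nonzero; so [f'] can take its own value at [g]. *)
have nEg : ~ E g.
  move=> Eg; have gx := fP g Eg.
  have l1 := lim_subseq _ _ _ thM (lim_subseq _ _ _ psiM gx).
  have l2 eps : 0 < eps -> exists M, forall n, (M <= n)%N -> `|g (x (psi (th n))) - (g xoo + gam)| <= eps.
    move=> /gamP[M MP]; exists M => n Mn; have := MP n Mn.
    by rewrite /w' /w /= (linear_formB _ _ gl) opprD addrA.
  have := cvg_unique_eps l1 l2; rewrite -xooP// => /eqP; rewrite -subr_eq0 opprD addrA subrr add0r oppr_eq0.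
  by move=> /eqP h; move: gam_eta; rewrite h normr0 leNgt eta0.
have f'E e0 : E e0 -> f' e0 = f e0 by rewrite /f'; case: pselect.
have f'g : f' g = g xoo + gam by rewrite /f'; case: pselect.
have [||||||||phi [phiM Hphi]] := @subseq_limit_outside R X N C E sN C0 CN NC El EN Eatt
    (E `|` [set g]) (x \o (psi \o th)) B f' (eta / 2).
- exact: subsetUl.
- by move=> e0 [/El//|->].
- by move=> e0 [/EN//|->].
- by move=> n; exact: xB.
- move=> e0 [Ee|->] eps eps0.
    rewrite (f'E _ Ee).
    exact: (lim_subseq _ _ _ thM (lim_subseq _ _ _ psiM (fP _ Ee))).
  have [M MP] := gamP _ eps0; exists M => n Mn; have := MP n Mn.
  by rewrite f'g /w' /w /= (linear_formB _ _ gl) opprD addrA.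
- by rewrite divr_gt0.
(* A vector far from [xoo] is separated from [f'] by [E], one near [xoo] by [g], because [f' g]
   differs from [g xoo] by [gam]. *)
- move=> v; have [h|h] := leP (eta / 2) (N (v - xoo)).
    have [e0 Ee e0v] := Eatt (v - xoo); exists e0; first by left.
    by rewrite (f'E _ Ee) -xooP// -(linear_formB _ _ (El Ee)) e0v.
  exists g; first by right.
  rewrite f'g; have := gN (v - xoo); rewrite (linear_formB _ _ gl).
  have := lerB_dist gam (g v - g xoo); rewrite [`|gam - _|]distrC.
  by rewrite opprD addrA; lra.
- move=> e0 Ee; apply: (@finite_variation_subseq _ (e0 \o x \o psi) _ thM).
  exact: (@finite_variation_subseq _ (e0 \o x) _ psiM (xV e0 Ee)).
by exists (psi \o (th \o phi)); split=> // m n mn; exact/psiM/thM/phiM.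
Qed.

End Forward.

(** * A countable boundary of a separable polyhedral space *)

Section ConvexOnLine.
Variable R : realType.

(* The leftmost minimizer of g minus its chord is a point of strict convexity of g. *)
Lemma strict_convexity_point (g : R -> R) (L t0 : R) :
  (forall s t, `|g s - g t| <= L * `|s - t|) ->
  (forall s t mu, 0 <= mu <= 1 -> g (mu * s + (1 - mu) * t) <= mu * g s + (1 - mu) * g t) ->
  0 < t0 -> ~ (forall t, 0 <= t <= t0 -> g t = g 0 + t * ((g t0 - g 0) / t0)) ->
  exists2 t, 0 < t < t0 & forall s s' mu, 0 < mu < 1 -> t = mu * s + (1 - mu) * s' ->
    g t = mu * g s + (1 - mu) * g s' -> s = s'.
Proof.
move=> gL gC t00 naff.
pose m := (g t0 - g 0) / t0.
have mt0 : m * t0 = g t0 - g 0 by rewrite /m divfK// gt_eqF.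
pose k t := g t - (g 0 + t * m).
have kL s t : `|k s - k t| <= (L + `|m|) * `|s - t|.
  have -> : k s - k t = (g s - g t) - m * (s - t) by rewrite /k; ring.
  apply: le_trans (ler_normB _ _) _; rewrite normrM.
  by have := gL s t; lra.
have kC s t mu : 0 <= mu <= 1 -> k (mu * s + (1 - mu) * t) <= mu * k s + (1 - mu) * k t.
  by move=> /(gC s t); rewrite /k; lra.
have k0 : k 0 = 0 by rewrite /k; ring.
have kt0 : k t0 = 0 by rewrite /k mulrC mt0; ring.
have kneg t : 0 <= t <= t0 -> k t <= 0.
  move=> /andP[t1 t2]; have tt0 : t / t0 <= 1 by rewrite ler_pdivrMr// mul1r.
  have h := kC t0 0 (t / t0) _; move: h; rewrite divr_ge0 ?(ltW t00)//= tt0 => /(_ isT).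
  by rewrite k0 kt0 !mulr0 !addr0 divfK// gt_eqF.
have [t1 t1i kt1] : exists2 t1, 0 <= t1 <= t0 & k t1 < 0.
  apply: contrapT => H; apply: naff => t ti; apply/eqP; rewrite -subr_eq0 eq_le; apply/andP; split.
    exact: kneg.
  by rewrite leNgt; apply/negP => h; apply: H; exists t.
have kc : {within `[0, t0], continuous k}.
  apply: continuous_subspaceT => s; apply/cvgrPdist_le => e e0.
  have L0 : 0 < L + `|m| + 1.
    have := kL 0 1; rewrite sub0r normrN normr1 mulr1 => h.
    by have := le_trans (normr_ge0 _) h; lra.
  near=> t; apply: le_trans (kL s t) _.
  have : `|s - t| <= e / (L + `|m| + 1).
    near: t; apply: (@cvgr_dist_le _ _ _ (nbhs s) _ id s) => //; rewrite ?divr_gt0//.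
  by rewrite ler_pdivlMr//; have := normr_ge0 (s - t); nra.
have [c ci cmin] := EVT_min (ltW t00) kc.
pose M := [set t | 0 <= t <= t0 /\ k t <= k c].
have Mc : M c by split=> //; move: ci; rewrite in_itv.
have infM : has_inf M by split; [exists c|exists 0 => t [/andP[]]].
pose t2 := inf M.
have t2le t : M t -> t2 <= t by apply: ge_inf; case: infM.
have t20 : 0 <= t2 by apply: lb_le_inf; [exists c|move=> t [/andP[]]].
have t2c : t2 <= t0 by apply: le_trans (t2le _ Mc) _; case: Mc => /andP[].
have Lm0 : 0 <= L + `|m|.
  by have := kL 0 1; rewrite sub0r normrN normr1 mulr1; exact: le_trans.
have kt2 : k t2 <= k c.
  apply: (le_of_small Lm0) => e e0.
  have [t [ti kt] tt2] := inf_adherent e0 infM.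
  have t2t := t2le t (conj ti kt).
  have := kL t2 t; rewrite [`|t2 - t|]distrC [`|t - t2|]ger0_norm ?subr_ge0// => h.
  have : (L + `|m|) * (t - t2) <= (L + `|m|) * e by rewrite ler_wpM2l//; move: tt2; rewrite -/t2; lra.
  by have := ler_norm (k t2 - k t); lra.
have kc0 : k c < 0 by apply: le_lt_trans kt1; apply: cmin; rewrite in_itv.
have t2i : 0 < t2 < t0.
  apply/andP; split; rewrite lt_neqAle ?t20 ?t2c andbT; apply/eqP => h.
    by move: kt2; rewrite -h k0 leNgt kc0.
  by move: kt2; rewrite h kt0 leNgt kc0.
have kmin t : 0 <= t <= t0 -> k t2 <= k t.
  by move=> ti; apply: le_trans kt2 _; apply: cmin; rewrite in_itv.
have half s s' mu : 0 < mu < 1 -> t2 = mu * s + (1 - mu) * s' ->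
    g t2 = mu * g s + (1 - mu) * g s' -> ~ s < s'.
  move=> /andP[mu0 mu1] ts gs ss'.
  have st2 : s < t2 by rewrite ts; nra.
  have t2s' : t2 < s' by rewrite ts; nra.
  have /andP[a1 a2] := t2i.
  (* [del] shrinks the segment towards [t2] until it lies in [[0, t0]], where [t2] is a minimizer.
     Equality in the convexity inequality then makes the left end a minimizer too, although [t2] is
     the leftmost one. *)
  pose del := Order.min 1 (Order.min (t2 / (t2 - s)) ((t0 - t2) / (s' - t2))).
  have d0 : 0 < del by rewrite !lt_min ltr01 !divr_gt0//; lra.
  have d1 : del <= 1 by rewrite /del ge_min lexx.
  have d2 : del * (t2 - s) <= t2.
    by rewrite -ler_pdivlMr; [rewrite /del !ge_min lexx !orbT|lra].
  have d3 : del * (s' - t2) <= t0 - t2.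
    by rewrite -ler_pdivlMr; [rewrite /del !ge_min lexx !orbT|lra].
  pose s1 := del * s + (1 - del) * t2; pose s1' := del * s' + (1 - del) * t2.
  have di : 0 <= del <= 1 by rewrite ltW.
  have c1 := kC s t2 del di; have c2 := kC s' t2 del di.
  have ks : k t2 = mu * k s + (1 - mu) * k s' by rewrite /k gs {1}ts; ring.
  have dts : 0 < del * (t2 - s) by rewrite mulr_gt0//; lra.
  have dts' : 0 < del * (s' - t2) by rewrite mulr_gt0//; lra.
  have i1 : 0 <= s1 <= t0 by rewrite /s1; apply/andP; split; lra.
  have i1' : 0 <= s1' <= t0 by rewrite /s1'; apply/andP; split; lra.
  have m1 := kmin _ i1; have m1' := kmin _ i1'.
  rewrite -/s1 in c1; rewrite -/s1' in c2.
  have e1 : mu * k s1 + (1 - mu) * k s1' <= k t2.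
    have : mu * k s1 <= mu * (del * k s + (1 - del) * k t2) by rewrite ler_wpM2l// ltW.
    have : (1 - mu) * k s1' <= (1 - mu) * (del * k s' + (1 - del) * k t2) by rewrite ler_wpM2l//; lra.
    have : del * k t2 = del * (mu * k s + (1 - mu) * k s') by rewrite -ks.
    by lra.
  have e2 : (1 - mu) * k t2 <= (1 - mu) * k s1' by rewrite ler_wpM2l//; lra.
  have e3 : k s1 <= k t2 by rewrite -(ler_pM2l mu0); lra.
  have := t2le s1 (conj i1 (le_trans e3 kt2)).
  by rewrite /s1; lra.
exists t2 => // s s' mu mui ts gs.
have [ss'|ss'|//] := ltgtP s s'; first by case: (half s s' mu mui ts gs).
case: (half s' s (1 - mu)) => //; first by move: mui => /andP[? ?]; apply/andP; split; lra.
  by rewrite ts; ring.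
by rewrite gs; ring.
Unshelve. all: end_near. Qed.

End ConvexOnLine.

(** * Polyhedral norms are affine on short segments *)

Section Polyhedral.
Variables (R : realType) (X : normedModType R) (N : X -> R).
Hypotheses (sN : seminorm N) (N0 : forall x, N x = 0 -> x = 0).

Let Ngt0 x : x != 0 -> 0 < N x.
Proof. by move=> x0; rewrite lt_neqAle (seminorm_ge0 sN) andbT eq_sym; apply/eqP => /N0/eqP; apply/negP. Qed.

Lemma seminorm_convex u v (mu : R) : 0 <= mu <= 1 ->
  N (mu *: u + (1 - mu) *: v) <= mu * N u + (1 - mu) * N v.
Proof.
move=> /andP[m0 m1]; apply: le_trans (seminormD sN _ _) _.
by rewrite !(seminormZ sN) !ger0_norm ?subr_ge0.
Qed.

(** If [u] lies between two points of the ball, these are projected radially to the line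
    [x + s *: y]. As their norms are at most 1, convexity along the line is an equality at [t], so
    by strictness the projections coincide. This requires positive coefficients of [x], which is
    arranged by first moving both points towards [u]. *)
Lemma extreme_point_of_strict (x y : X) (t : R) (v : 'I_2 -> X) :
  v ord0 = x -> v ord_max = y -> independent v ->
  (forall s s' mu, 0 < mu < 1 -> t = mu * s + (1 - mu) * s' ->
    N (x + t *: y) = mu * N (x + s *: y) + (1 - mu) * N (x + s' *: y) -> s = s') ->
  extreme_point [set z | lspan (range v) z /\ N z <= 1] ((N (x + t *: y))^-1 *: (x + t *: y)).
Proof.
move=> v0 v1 ind strict; pose g s := N (x + s *: y).
have vE (c : 'I_2 -> R) : \sum_i c i *: v i = c ord0 *: x + c ord_max *: y.
  by rewrite big_ord_recl big_ord1 v0 -v1; congr (_ + c _ *: v _); apply: val_inj.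
have vxy (a b : R) : lspan (range v) (a *: x + b *: y).
  apply/lspan_ordP; exists (fun i => if i == ord0 then a else b).
  by rewrite vE /=.
have xy0 s : x + s *: y != 0.
  apply/eqP => h; have := ind (fun i => if i == ord0 then 1 else s).
  rewrite vE /= scale1r h => /(_ erefl ord0) /= /eqP.
  by rewrite oner_eq0.
have g0 s : 0 < g s by apply: Ngt0.
rewrite -/(g t); set u := _^-1 *: _.
have uE : u = (g t)^-1 *: x + ((g t)^-1 * t) *: y by rewrite /u scalerDr scalerA.
have Nu : N u = 1 by rewrite /u (seminormZ sN) ger0_norm ?invr_ge0 ?(ltW (g0 t))// mulVf// gt_eqF.
clearbody u.
have gt_inv : (g t)^-1 * g t = 1 by rewrite mulVf// gt_eqF.
have inj (a b a' b' : R) : a *: x + b *: y = a' *: x + b' *: y -> a = a' /\ b = b'.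
  move=> /eqP; rewrite -subr_eq0 opprD addrACA -!scalerBl => /eqP h.
  have := ind (fun i => if i == ord0 then a - a' else b - b'); rewrite vE /= h => /(_ erefl) hh.
  by split; apply/eqP; rewrite -subr_eq0; apply/eqP; [exact: (hh ord0)|exact: (hh ord_max)].
have core (p0 p1 q0 q1 tau : R) : 0 < tau < 1 -> 0 < p0 -> 0 < q0 ->
    N (p0 *: x + p1 *: y) <= 1 -> N (q0 *: x + q1 *: y) <= 1 ->
    u = tau *: (p0 *: x + p1 *: y) + (1 - tau) *: (q0 *: x + q1 *: y) ->
    p0 *: x + p1 *: y = u.
  move=> /andP[ta0 ta1] p00 q00 Np Nq.
  rewrite !scalerDr !scalerA addrACA -!scalerDl {1}uE => /inj[e0 e1].
  have ps (a b : R) : 0 < a -> N (a *: x + b *: y) = a * g (b / a).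
    move=> a0; have -> : a *: x + b *: y = a *: (x + (b / a) *: y).
      by rewrite scalerDr scalerA [a * _]mulrC divfK ?gt_eqF.
    by rewrite (seminormZ sN) ger0_norm// ltW.
  rewrite ps// in Np; rewrite ps// in Nq.
  set s := p1 / p0 in Np; set s' := q1 / q0 in Nq.
  have sp : p1 = s * p0 by rewrite /s divfK// gt_eqF.
  have sq : q1 = s' * q0 by rewrite /s' divfK// gt_eqF.
  (* The weights of the two projections in [x + t *: y]; they add up to 1 because [u] has
     coefficient [1 / g t] on [x]. *)
  pose mu := tau * p0 * g t.
  have mu1 : 1 - mu = (1 - tau) * q0 * g t by rewrite /mu -[in LHS]gt_inv e0; ring.
  have mu0 : 0 < mu by rewrite /mu !mulr_gt0.
  have mu2 : 0 < 1 - mu by rewrite mu1 !mulr_gt0//; lra.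
  have ts : t = mu * s + (1 - mu) * s'.
    have : (g t)^-1 * g t * t = g t * ((g t)^-1 * t) by ring.
    rewrite gt_inv mul1r e1 mu1 /mu sp sq => {1}->; ring.
  have mui : 0 <= mu <= 1 by apply/andP; split; lra.
  have conv : g t <= mu * g s + (1 - mu) * g s'.
    have := seminorm_convex (x + s *: y) (x + s' *: y) mui; rewrite -/(g s) -/(g s').
    rewrite !scalerDr !scalerA addrACA -!scalerDl -ts (_ : mu + _ = 1) ?scale1r//.
    by ring.
  have b1 : mu * g s <= tau * g t.
    have -> : mu * g s = (tau * g t) * (p0 * g s) by rewrite /mu; ring.
    by rewrite ler_piMr// mulr_ge0// ltW.
  have b2 : (1 - mu) * g s' <= (1 - tau) * g t.
    have -> : (1 - mu) * g s' = ((1 - tau) * g t) * (q0 * g s') by rewrite mu1; ring.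
    by rewrite ler_piMr// mulr_ge0 ?(ltW (g0 t))//; lra.
  have ss' : s = s'.
    apply: (strict s s' mu) => //; first by apply/andP; split; lra.
    by apply/eqP; rewrite eq_le; apply/andP; split; [exact: conv|rewrite -/(g t) -/(g s) -/(g s'); lra].
  have st : s = t by rewrite ts -ss'; ring.
  rewrite -ss' st in b1 b2.
  have mt : mu = tau.
    apply/eqP; rewrite eq_le; apply/andP; split; first by rewrite -(ler_pM2r (g0 t)).
    by have : 1 - mu <= 1 - tau; [rewrite -(ler_pM2r (g0 t))|lra].
  have p0E : p0 = (g t)^-1.
    have : tau * (p0 * g t) = tau * 1 by rewrite mulr1 mulrA -/mu.
    move=> /(mulfI (lt0r_neq0 ta0)) h.
    by rewrite -[LHS]mulr1 -[X in _ * X](mulfV (lt0r_neq0 (g0 t))) mulrA h mul1r.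
  by rewrite sp st p0E uE mulrC.
split; first by rewrite uE; split; [exact: vxy|rewrite -uE Nu].
have half p q (tau : R) : [set z | lspan (range v) z /\ N z <= 1] p ->
    [set z | lspan (range v) z /\ N z <= 1] q -> 0 < tau < 1 -> u = tau *: p + (1 - tau) *: q -> p = u.
  move=> [/lspan_ordP[c]]; rewrite vE => pE Np [/lspan_ordP[d]]; rewrite vE => qE Nq taui upq.
  have gi0 : 0 < (g t)^-1 by rewrite invr_gt0.
  set p0 := c ord0 in pE; set p1 := c ord_max in pE; set q0 := d ord0 in qE; set q1 := d ord_max in qE.
  have [del [de0 de1 dp dq]] : exists del : R, [/\ 0 < del, del <= 1,
      0 < del * p0 + (1 - del) * (g t)^-1 & 0 < del * q0 + (1 - del) * (g t)^-1].
    pose S := (g t)^-1 + `|p0| + `|q0|.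
    have S0 : 0 < S by rewrite /S; have := normr_ge0 p0; have := normr_ge0 q0; lra.
    have [r rE] : exists r, r = (g t)^-1 / (2 * S) by exists ((g t)^-1 / (2 * S)).
    have rS : r * S = (g t)^-1 / 2 by rewrite rE; field; rewrite !gt_eqF.
    have r0 : 0 < r by rewrite rE divr_gt0// mulr_gt0.
    have r1 : r <= 1.
      rewrite rE ler_pdivrMr ?mulr_gt0// mul1r /S.
      by have := normr_ge0 p0; have := normr_ge0 q0; lra.
    have pp : - `|p0| <= p0 by rewrite lerNl -normrN ler_norm.
    have qq : - `|q0| <= q0 by rewrite lerNl -normrN ler_norm.
    have h1 := ler_wpM2l (ltW r0) pp; have h2 := ler_wpM2l (ltW r0) qq.
    have h3 : 0 <= r * `|p0| by rewrite mulr_ge0// ltW.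
    have h4 : 0 <= r * `|q0| by rewrite mulr_ge0// ltW.
    have h5 : r * (g t)^-1 + r * `|p0| + r * `|q0| = (g t)^-1 / 2 by rewrite -rS /S; ring.
    by exists r; split=> //; lra.
  have shr (a b : R) : del *: (a *: x + b *: y) + (1 - del) *: u =
      (del * a + (1 - del) * (g t)^-1) *: x + (del * b + (1 - del) * ((g t)^-1 * t)) *: y.
    by rewrite uE !scalerDr !scalerA addrACA -!scalerDl.
  have dei : 0 <= del <= 1 by rewrite ltW.
  have Nshr z : N z <= 1 -> N (del *: z + (1 - del) *: u) <= 1.
    move=> Nz; apply: le_trans (seminorm_convex _ _ dei) _; rewrite Nu.
    have : del * N z <= del * 1 by rewrite ler_wpM2l// ltW.
    by lra.
  have := core _ (del * p1 + (1 - del) * ((g t)^-1 * t)) _ (del * q1 + (1 - del) * ((g t)^-1 * t)) tau taui dp dq.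
  rewrite -!shr -pE -qE => /(_ (Nshr _ Np) (Nshr _ Nq)) h.
  have : del *: p + (1 - del) *: u = u.
    apply: h; rewrite !scalerDr !scalerA addrACA -scalerDl.
    rewrite [tau * del]mulrC [(1 - tau) * del]mulrC -!scalerA -scalerDr -upq -scalerDl.
    rewrite -[LHS]scale1r; congr (_ *: _); ring.
  move=> /eqP; rewrite scalerBl scale1r addrCA -subr_eq0 addrAC subrr add0r -scalerBr.
  by rewrite scaler_eq0 gt_eqF//= subr_eq0 => /eqP.
move=> p q tau Kp Kq taui upq; split; first exact: (half p q tau).
apply: (half q p (1 - tau)) => //; first by move: taui => /andP[? ?]; apply/andP; split; lra.
by rewrite upq addrC (_ : 1 - (1 - tau) = tau)//; ring.
Qed.

Hypothesis poly : forall n (v : 'I_n -> X),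
  finite_set (extreme_point [set y | lspan (range v) y /\ N y <= 1]).

(** If [N] were affine on no initial segment of the half-line, points of strict convexity would
    accumulate at 0 and give infinitely many extreme points in the ball of the plane of [x] and
    [y]. *)
Lemma polyhedral_affine (x y : X) : exists2 t0 : R, 0 < t0 & forall t, 0 <= t <= t0 ->
  N (x + t *: y) = N x + t * ((N (x + t0 *: y) - N x) / t0).
Proof.
pose v (i : 'I_2) := if i == ord0 then x else y.
have [ind|dep] := pselect (independent v); last first.
  have [->|x0] := eqVneq x 0.
    exists 1; first exact: ltr01.
    move=> t /andP[t0 _]; rewrite !add0r (seminorm0 sN) scale1r !(seminormZ sN) ger0_norm//.
    by rewrite subr0 divr1 add0r.
  have [c yE] : exists c : R, y = c *: x.
    apply: contrapT => H; apply: dep => c; rewrite big_ord_recl big_ord1 /v /= => h.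
    have c1 : c (lift ord0 ord0) = 0.
      apply: contrapT => /eqP c10; apply: H; exists (- (c (lift ord0 ord0))^-1 * c ord0).
      apply: (scalerI c10); rewrite scalerA mulrA mulrN mulfV// mulN1r scaleNr.
      by apply/eqP; rewrite -addr_eq0 addrC h.
    move: h; rewrite c1 scale0r addr0 => /eqP; rewrite scaler_eq0 (negbTE x0) orbF => /eqP c0 i.
    by case: (unliftP ord0 i) => [j ->|->//]; rewrite (ord1 j).
  have c10 : 0 < `|c| + 1 by have := normr_ge0 c; lra.
  have t00 : 0 < (`|c| + 1)^-1 by rewrite invr_gt0.
  have E t : 0 <= t <= (`|c| + 1)^-1 -> N (x + t *: y) = (1 + t * c) * N x.
    move=> /andP[t1 t2]; rewrite yE scalerA -{1}[x]scale1r -scalerDl (seminormZ sN) ger0_norm//.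
    have cc : - `|c| <= c by rewrite lerNl -normrN ler_norm.
    have : t * (`|c| + 1) <= 1 by rewrite -ler_pdivlMr// mul1r.
    by have := ler_wpM2l t1 cc; lra.
  exists (`|c| + 1)^-1 => // t ti.
  rewrite (E _ ti) E ?lexx ?ltW//; field; rewrite gt_eqF//.
apply: contrapT => H.
pose g s := N (x + s *: y).
pose St (t : R) := 0 < t /\ (forall s s' mu, 0 < mu < 1 -> t = mu * s + (1 - mu) * s' ->
    g t = mu * g s + (1 - mu) * g s' -> s = s').
have Stex (t0 : R) : 0 < t0 -> exists2 t, t < t0 & St t.
  move=> t00; have [|||t /andP[t1 t2] h] := @strict_convexity_point R g (N y) t0 _ _ t00.
  - move=> s t; have sub s1 t1 : g s1 - g t1 <= N y * `|s1 - t1|.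
      have := seminorm_le_sub sN (x + s1 *: y) (x + t1 *: y).
      by rewrite opprD addrACA subrr add0r -scalerBl (seminormZ sN) -/(g s1) -/(g t1); lra.
    rewrite ler_norml; apply/andP; split; last exact: sub.
    by have := sub t s; rewrite distrC; lra.
  - move=> s t mu mui; have := seminorm_convex (x + s *: y) (x + t *: y) mui.
    rewrite !scalerDr !scalerA addrACA -!scalerDl (_ : mu + _ = 1) ?scale1r//.
    by ring.
  - move=> h; apply: H; exists t0 => // t ti; have := h t ti.
    by rewrite /g scale0r addr0.
  by exists t.
pose u t := (g t)^-1 *: (x + t *: y).
have vE (c : 'I_2 -> R) : \sum_i c i *: v i = c ord0 *: x + c ord_max *: y.
  by rewrite big_ord_recl big_ord1 /v /=; congr (_ + c _ *: _); apply: val_inj.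
have inj (a b a' b' : R) : a *: x + b *: y = a' *: x + b' *: y -> a = a' /\ b = b'.
  move=> /eqP; rewrite -subr_eq0 opprD addrACA -!scalerBl => /eqP h.
  have := ind (fun i => if i == ord0 then a - a' else b - b'); rewrite vE /= h => /(_ erefl) hh.
  by split; apply/eqP; rewrite -subr_eq0; apply/eqP; [exact: (hh ord0)|exact: (hh ord_max)].
have g0 s : 0 < g s.
  apply: Ngt0; apply/eqP => h; have [] := inj 1 s 0 0.
    by rewrite scale1r h !scale0r addr0.
  by move=> /eqP; rewrite oner_eq0.
have uinj t t' : u t = u t' -> t = t'.
  rewrite /u !scalerDr !scalerA => /inj[-> ] /mulfI; apply.
  by rewrite invr_eq0 gt_eqF.
have finS : finite_set St.
  pose h p := xget 0 [set t | p = u t].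
  apply: (@sub_finite_set _ _ (h @` (extreme_point [set y | lspan (range v) y /\ N y <= 1]))); last first.
    by apply: finite_image; exact: poly.
  move=> t [t0 st]; exists (u t).
    by apply: extreme_point_of_strict => //; exact: st.
  by have := @xgetPex _ 0 [set t1 | u t = u t1] (ex_intro _ t erefl) => /uinj; exact: esym.
have [l lP] := (finite_seqP St).1 finS.
pose m := \big[Order.min/1]_(t <- l) t.
have m0 : 0 < m.
  have lpos t : t \in l -> 0 < t by move=> tl; have [] : St t by rewrite lP.
  rewrite /m; elim: (l) lpos => [|a l' IH] lpos; first by rewrite big_nil.
  rewrite big_cons lt_min lpos ?mem_head//=; apply: IH => t tl.
  by apply: lpos; rewrite inE tl orbT.
have [t tm tS] := Stex m m0.
have : m <= t.
  have : t \in l by move: tS; rewrite lP.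
  rewrite /m; elim: (l) => [//|a l' IH]; rewrite inE big_cons => /orP[/eqP ->|/IH h].
    by rewrite ge_min lexx.
  by rewrite ge_min h orbT.
by rewrite leNgt tm.
Qed.

End Polyhedral.

(** * Baire category arguments *)

Section Boundary.
Variables (R : realType) (X : completeNormedModType R) (N : X -> R) (b : R).
Hypotheses (sN : seminorm N) (b0 : 0 < b) (Nb : forall x, N x <= b * `|x|).
Hypothesis affine : forall x y : X, exists2 t0 : R, 0 < t0 & forall t, 0 <= t <= t0 ->
  N (x + t *: y) = N x + t * ((N (x + t0 *: y) - N x) / t0).

Let N_lip x y : N x - N y <= b * `|x - y|.
Proof. by have := seminorm_le_sub sN x y; have := Nb (x - y); lra. Qed.

Lemma closed_lipschitz (I : Type) (D : set I) (phi : I -> X -> R) :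
  (forall i, exists2 L, 0 <= L & forall x y, phi i x - phi i y <= L * `|x - y|) ->
  closed [set y | forall i, D i -> phi i y <= 0].
Proof.
move=> lip y yc i Di; have [L L0 LP] := lip i.
apply: (le_of_small L0) => e e0; rewrite add0r.
have [z [/= zP]] := yc _ (nbhsx_ballx y _ e0); rewrite -ball_normE /= => yz.
have := LP y z; have := zP i Di; have := ler_wpM2l L0 (ltW yz).
by lra.
Qed.

Lemma baire_ball (F : nat -> set X) : (forall n, closed (F n)) -> (forall x, exists n, F n x) ->
  exists n x, exists2 r : R, 0 < r & ball x r `<=` F n.
Proof.
move=> cF covF; apply: contrapT => H.
have dn n : open (~` F n) /\ dense (~` F n).
  split; first exact/closed_openC.
  move=> O [x Ox] oO; apply: contrapT => ne; apply: H.
  have /nbhs_ballP[r /= r0 rO] : nbhs x O by exact: open_nbhs_nbhs.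
  exists n, x, r => // y xy; apply: contrapT => nF; apply: ne; exists y.
  by split => //; exact: rO.
have [||x [_ xF]] := @Baire R X (fun n => ~` F n) dn setT; first by exists 0.
  exact: openT.
by have [n Fn] := covF x; exact: (xF n).
Qed.

Lemma affine_slope (x v : X) : exists c : R, exists2 t0, 0 < t0 & forall t, 0 <= t <= t0 ->
  N (x + t *: v) = N x + t * c.
Proof. by have [t0 t00 h] := affine x v; exists ((N (x + t0 *: v) - N x) / t0), t0. Qed.

(** Lying above the chord along [x + t *: y] up to [t = recip n] is a closed condition on [y], and
    polyhedrality makes these sets cover [X]. Baire gives a ball of directions with a common length,
    hence a ball of endpoints [u]. Only the inequality opposite to convexity is recorded. *)
Lemma ex_affine_segments (x : X) : exists u0, exists2 r : R, 0 < r & forall u, ball u0 r u ->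
  forall s : R, 0 <= s <= 1 -> (1 - s) * N x + s * N u <= N (x + s *: (u - x)).
Proof.
pose q n := recip R n.
have q0 n : 0 < q n by exact: recip_gt0.
pose F n := [set y | forall t : R, [set t | 0 <= t <= q n] t ->
  N x + t * (q n)^-1 * (N (x + q n *: y) - N x) - N (x + t *: y) <= 0].
have cF n : closed (F n).
  apply: (@closed_lipschitz R [set t | 0 <= t <= q n]
    (fun t y => N x + t * (q n)^-1 * (N (x + q n *: y) - N x) - N (x + t *: y))) => t.
  have qq : 0 <= (q n)^-1 by rewrite invr_ge0 ltW.
  have bb := ltW b0.
  exists (`|t| * (q n)^-1 * (b * q n) + b * `|t|).
    by rewrite addr_ge0// !mulr_ge0// ltW.
  move=> y z.
  have l1 w w' (c : R) : N (x + c *: w) - N (x + c *: w') <= b * `|c| * `|w - w'|.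
    apply: le_trans (N_lip _ _) _.
    by rewrite opprD addrACA subrr add0r -scalerBr normrZ mulrA.
  have l2 : `|N (x + q n *: y) - N (x + q n *: z)| <= b * q n * `|y - z|.
    rewrite ler_norml; apply/andP; split.
      by have := l1 z y (q n); rewrite distrC [`|q n|]gtr0_norm//; lra.
    by have := l1 y z (q n); rewrite [`|q n|]gtr0_norm.
  have := l1 z y t; rewrite distrC => h1.
  have := ler_norm (t * (q n)^-1 * (N (x + q n *: y) - N (x + q n *: z))).
  rewrite !normrM [`|(q n)^-1|]ger0_norm// => h2.
  have h3 : `|t| * (q n)^-1 * `|N (x + q n *: y) - N (x + q n *: z)| <=
      `|t| * (q n)^-1 * (b * q n * `|y - z|) by rewrite ler_wpM2l// mulr_ge0.
  by lra.
have [|n [y0 [r r0 rF]]] := baire_ball cF.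
  move=> y; have [c [t0 t00 tP]] := affine_slope x y.
  have [n /(_ n (leqnn n)) nt] := recip_small t00.
  exists n => t /= /andP[t1 t2].
  rewrite !tP; [|by rewrite t1 (le_trans t2)|by rewrite (ltW (q0 n))].
  have : (q n)^-1 * q n = 1 by rewrite mulVf// gt_eqF.
  set qi := (q n)^-1 => qiq.
  have -> : N x + t * qi * (N x + q n * c - N x) - (N x + t * c) = t * c * (qi * q n) - t * c by ring.
  by rewrite qiq mulr1 subrr.
exists (x + q n *: y0), (q n * r) => [|u]; first by rewrite mulr_gt0.
rewrite -ball_normE /= => ub s /andP[s0 s1].
pose y := (q n)^-1 *: (u - x).
have yE : q n *: y = u - x by rewrite /y scalerA mulfV ?gt_eqF// scale1r.
have Fy : F n y.
  apply: rF; rewrite -ball_normE /=.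
  have : q n * `|y0 - y| < q n * r.
    rewrite -[q n in X in X < _]gtr0_norm// -normrZ scalerBr yE.
    by rewrite opprB addrCA addrA.
  by rewrite ltr_pM2l.
have := Fy (s * q n); rewrite /= yE -scalerA yE [x + (u - x)]addrC subrK mulfK ?gt_eqF//.
rewrite mulr_ge0 ?(ltW (q0 n))//= ler_piMl ?(ltW (q0 n))// => /(_ isT).
by lra.
Qed.

(** A small second difference is an open condition on [u]. It is dense because a short step from any
    point along [d i] lands inside a segment on which [N] is affine, where the second difference
    vanishes. *)
Lemma ex_smooth (d : nat -> X) (u0 : X) (r : R) : 0 < r -> exists2 u, ball u0 r u &
  forall i k, exists2 t, 0 < t & N (u + t *: d i) + N (u - t *: d i) - 2 * N u < t * recip R k.
Proof.
move=> r0.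
pose O i k := [set u | exists2 t, 0 < t & N (u + t *: d i) + N (u - t *: d i) - 2 * N u < t * recip R k].
have oO i k : open (O i k).
  rewrite openE => u [t t0 ut].
  pose g := t * recip R k - (N (u + t *: d i) + N (u - t *: d i) - 2 * N u).
  have g0 : 0 < g by rewrite /g subr_gt0.
  have b4 : 0 < 4 * b by rewrite mulr_gt0.
  apply/nbhs_ballP; exists (g / (4 * b)); first by rewrite /= divr_gt0.
  move=> u' /=; rewrite -ball_normE /= ltr_pdivlMr// => uu'; exists t => //.
  have := N_lip (u' + t *: d i) (u + t *: d i); have := N_lip (u' - t *: d i) (u - t *: d i).
  have sh v : u' + v - (u + v) = u' - u by rewrite opprD addrACA subrr addr0.
  rewrite !sh distrC => h1 h2.
  move: h1 h2 (N_lip u u') uu'; rewrite /g.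
  move: (N (u' + _)) (N (u' - _)) (N (u + _)) (N (u - _)) (N u) (N u') (`|u - u'|) (t * _).
  by move=> *; lra.
have dO i k : dense (O i k).
  move=> W [u1 Wu1] oW.
  have /nbhs_ballP[e /= e0 eW] : nbhs u1 W by exact: open_nbhs_nbhs.
  have [c [t0 t00 tP]] := affine_slope u1 (d i).
  have d1 : 0 < `|d i| + 1 by have := normr_ge0 (d i); lra.
  pose s := Order.min (t0 / 2) (e / (2 * (`|d i| + 1))).
  have s0 : 0 < s by rewrite lt_min !divr_gt0// mulr_gt0.
  have s1 : s <= t0 / 2 by rewrite ge_min lexx.
  have s2 : s * (2 * (`|d i| + 1)) <= e.
    by rewrite -ler_pdivlMr ?mulr_gt0// ge_min lexx orbT.
  exists (u1 + s *: d i); split.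
    apply: eW; rewrite -ball_normE /= opprD addrA subrr add0r normrN normrZ gtr0_norm//.
    by have := mulr_ge0 (ltW s0) (normr_ge0 (d i)); lra.
  have ss : u1 + s *: d i + s *: d i = u1 + (s + s) *: d i by rewrite -addrA -scalerDl.
  exists s => //; rewrite addrK ss !tP; try by apply/andP; split; lra.
  have -> : N u1 + (s + s) * c + N u1 - 2 * (N u1 + s * c) = 0 by ring.
  by rewrite mulr_gt0// recip_gt0.
pose F n := O (odflt (0%N, 0%N) (unpickle n)).1 (odflt (0%N, 0%N) (unpickle n)).2.
have [||u [uB uF]] := @Baire R X F (fun n => conj (oO _ _) (dO _ _)) (ball u0 r).
- by exists u0; exact: ballxx.
- exact: ball_open.
exists u => // i k.
by have := uF (pickle (i, k)) I; rewrite /F pickleK.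
Qed.

(* At a point [u] where [N] is Gateaux differentiable, polyhedrality makes [N] agree with its
   derivative along each line near [u]; Baire's theorem makes this uniform in the direction. *)
Lemma ex_local_form (d : nat -> X) (u0 : X) (r : R) :
  (forall (x : X) (e : R), 0 < e -> exists n, `|x - d n| < e) -> 0 < r ->
  exists u h, [/\ ball u0 r u, linear_form h, forall v, `|h v| <= N v &
    exists2 e : R, 0 < e & forall v, ball u e v -> N v = h v].
Proof.
move=> dd r0; have [u uB uS] := ex_smooth d u0 r0.
(* [p v] is the one-sided derivative of [N] at [u] along [v], a sublinear function below [N].
   Smoothness in the dense directions [d i] makes it odd, hence linear. *)
have /choice[p pP] := affine_slope u.
have p_uniq v (c t0 : R) : 0 < t0 -> (forall t, 0 <= t <= t0 -> N (u + t *: v) = N u + t * c) -> p v = c.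
  move=> t00 h; have [t1 t10 h1] := pP v.
  pose t := Order.min t0 t1.
  have tt : 0 < t by rewrite lt_min t00.
  have := h t; rewrite (ltW tt) ge_min lexx => /(_ isT).
  rewrite h1; last by rewrite (ltW tt) ge_min lexx orbT.
  by move=> /addrI /(mulfI (lt0r_neq0 tt)).
have p_ge v (t : R) : 0 <= t -> N u + t * p v <= N (u + t *: v).
  move=> t0; have [t1 t10 h1] := pP v.
  have [tt1|t1t] := leP t t1; first by rewrite h1// t0.
  have tt : 0 < t by exact: lt_trans t1t.
  have mi : 0 <= t1 / t <= 1 by rewrite divr_ge0 ?(ltW t10) ?(ltW tt)//= ler_pdivrMr// mul1r ltW.
  have := seminorm_convex sN (u + t *: v) u mi.
  have -> : (t1 / t) *: (u + t *: v) + (1 - t1 / t) *: u = u + t1 *: v.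
    rewrite scalerDr scalerA divfK ?gt_eqF// addrAC -scalerDl.
    by rewrite (_ : _ + (1 - _) = 1) ?scale1r//; ring.
  rewrite h1; last by rewrite (ltW t10) lexx.
  have e1 : t1 / t * t = t1 by rewrite divfK// gt_eqF.
  set mu := t1 / t in mi e1 * => h.
  have mu0 : 0 < mu by rewrite /mu divr_gt0.
  by rewrite -(ler_pM2l mu0) mulrDr mulrA e1; lra.
have small v w z : exists2 t : R, 0 < t & [/\ N (u + t *: v) = N u + t * p v,
    N (u + (2 * t) *: w) = N u + 2 * t * p w & N (u + (2 * t) *: z) = N u + 2 * t * p z].
  have [t1 t10 h1] := pP v; have [t2 t20 h2] := pP w; have [t3 t30 h3] := pP z.
  pose t := Order.min t1 (Order.min (t2 / 2) (t3 / 2)).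
  have tt : 0 < t by rewrite !lt_min t10 !divr_gt0.
  have i1 : t <= t1 by rewrite ge_min lexx.
  have i2 : t <= t2 / 2 by rewrite !ge_min lexx orbT.
  have i3 : t <= t3 / 2 by rewrite !ge_min lexx !orbT.
  by exists t => //; split; [apply: h1|apply: h2|apply: h3]; apply/andP; split; lra.
have pN v : p v <= N v.
  have [t t0 [h _ _]] := small v v v.
  have := seminormD sN u (t *: v); rewrite h (seminormZ sN) gtr0_norm// lerD2l.
  by rewrite ler_pM2l.
have pD v w : p (v + w) <= p v + p w.
  have [t t0 [h h1 h2]] := small (v + w) v w.
  have mi : 0 <= (2^-1 : R) <= 1 by apply/andP; split; lra.
  have := seminorm_convex sN (u + (2 * t) *: v) (u + (2 * t) *: w) mi.
  have -> : 2^-1 *: (u + (2 * t) *: v) + (1 - 2^-1) *: (u + (2 * t) *: w) = u + t *: (v + w).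
    rewrite !scalerDr !scalerA addrACA -scalerDl.
    have -> : 2^-1 + (1 - 2^-1) = 1 :> R by ring.
    have -> : 2^-1 * (2 * t) = t by lra.
    have -> : (1 - 2^-1) * (2 * t) = t by lra.
    by rewrite scale1r.
  by rewrite h h1 h2 => hh; rewrite -(ler_pM2l t0); lra.
have pZ v (c : R) : 0 <= c -> p (c *: v) = c * p v.
  move=> c0; have [t1 t10 h1] := pP v.
  have c1 : 0 < c + 1 by lra.
  apply: (p_uniq _ _ (t1 / (c + 1))); first by rewrite divr_gt0.
  move=> t /andP[t0]; rewrite ler_pdivlMr// => tc.
  rewrite scalerA h1; first by ring.
  by apply/andP; split; [rewrite mulr_ge0|lra].
have p0 : p 0 = 0 by have := pZ 0 0 (lexx _); rewrite scale0r mul0r.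
have pdd i : p (d i) + p (- d i) <= 0.
  apply: (@le_of_small _ 1) => // e e0; have [k /(_ k (leqnn k)) ke] := recip_small e0.
  have [t t0 ht] := uS i k.
  have := p_ge (d i) t (ltW t0); have := p_ge (- d i) t (ltW t0); rewrite scalerN => h1 h2.
  have : t * recip R k <= t * e by rewrite ler_wpM2l// ltW.
  by move=> h3; rewrite -(ler_pM2l t0); lra.
have pN0 v : p (- v) = - p v.
  have lo : 0 <= p v + p (- v) by have := pD v (- v); rewrite subrr p0.
  have hi : p v + p (- v) <= 0.
    have b2 : 0 <= 2 * b by rewrite mulr_ge0// ltW.
    apply: (le_of_small b2) => e e0; have [n nv] := dd v _ e0.
    have := pD (d n) (v - d n); rewrite addrC subrK => h1.
    have := pD (- d n) (d n - v); rewrite addrA addNr add0r => h2.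
    have := pN (v - d n); have := pN (d n - v); rewrite (seminorm_dist sN (d n)).
    have := Nb (v - d n); have := ler_wpM2l (ltW b0) (ltW nv); have := pdd n.
    by lra.
  by lra.
have pl : linear_form p.
  have pD2 v w : p (v + w) = p v + p w.
    apply/eqP; rewrite eq_le pD /=; have := pD (- v) (- w).
    by rewrite -opprD !pN0; lra.
  move=> a v w; rewrite pD2; congr (_ + _).
  have [a0|a0] := leP 0 a; first exact: pZ.
  by have := pZ v (- a); rewrite scaleNr pN0 => h; apply: oppr_inj; rewrite h ?mulNr// oppr_ge0 ltW.
have pabs v : `|p v| <= N v.
  by rewrite ler_norml pN andbT lerNl -pN0 -(seminormN sN v) pN.
have pu : p u = N u.
  apply: (p_uniq _ _ 1) => // t /andP[t0 _].
  by rewrite -{1}[u]scale1r -scalerDl (seminormZ sN) ger0_norm; [ring|lra].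
pose F n := [set v | forall t : R, [set t | `|t| <= recip R n] t -> N (u + t *: v) - N u - t * p v <= 0].
have cF n : closed (F n).
  apply: (@closed_lipschitz R [set t | `|t| <= recip R n] (fun t v => N (u + t *: v) - N u - t * p v)) => t.
  exists (2 * b * `|t|); first by rewrite !mulr_ge0// ltW.
  move=> v w; have := N_lip (u + t *: v) (u + t *: w).
  rewrite opprD addrACA subrr add0r -scalerBr normrZ => h1.
  have := ler_norm (- (t * p (v - w))); rewrite normrN normrM (linear_formB _ _ pl) => h2.
  have : `|t| * `|p (v - w)| <= `|t| * (b * `|v - w|).
    by rewrite ler_wpM2l// (le_trans (pabs _) (Nb _)).
  by rewrite (linear_formB _ _ pl); lra.
have [|n [v0 [e e0 eF]]] := baire_ball cF.
  move=> v; have [t1 t10 h1] := pP v; have [t2 t20 h2] := pP (- v).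
  have tm0 : 0 < Order.min t1 t2 by rewrite lt_min t10.
  have [n /(_ n (leqnn n))] := recip_small tm0; rewrite le_min => /andP[n1 n2].
  exists n => t /= tn; have [t0|t0] := leP 0 t.
    rewrite h1; first by lra.
    by rewrite t0 (le_trans _ n1)// -[t]ger0_norm.
  have := h2 (- t); rewrite scaleNr scalerN opprK pN0 => ->; first by lra.
  by rewrite oppr_ge0 (ltW t0)/= (le_trans _ n2)// -ltr0_norm.
pose q := recip R n; have q0 : 0 < q by exact: recip_gt0.
exists u, p; split=> //; exists (q * e) => [|w]; first by rewrite mulr_gt0.
rewrite -ball_normE /= => uw.
pose v := q^-1 *: (w - u).
have qv : q *: v = w - u by rewrite /v scalerA mulfV ?gt_eqF// scale1r.
have ve : `|v| < e.
  by rewrite -(ltr_pM2l q0) -[q in X in X < _]gtr0_norm// -normrZ qv distrC.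
(* The point [u + q *: v] is the midpoint of [u + q *: (v0 + v)] and [u - q *: (v0 - v)]: this moves
   the estimate from directions near [v0] to directions near 0. *)
have f1 : F n (v0 + v) by apply: eF; rewrite -ball_normE /= opprD addrA subrr add0r normrN.
have f2 : F n (v0 - v) by apply: eF; rewrite -ball_normE /= opprB addrCA subrr addr0.
have qn : `|q| <= q by rewrite gtr0_norm.
have qn' : `|- q| <= q by rewrite normrN gtr0_norm.
have := f1 q qn; have := f2 (- q) qn'.
rewrite (linear_formB _ _ pl) (linear_formD _ _ pl) => g1 g2.
have mi : 0 <= (2^-1 : R) <= 1 by apply/andP; split; lra.
have := seminorm_convex sN (u + q *: (v0 + v)) (u + (- q) *: (v0 - v)) mi.
have wE : w = u + q *: v by rewrite qv addrC subrK.
have -> : 2^-1 *: (u + q *: (v0 + v)) + (1 - 2^-1) *: (u + - q *: (v0 - v)) = w.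
  have -> : 1 - 2^-1 = 2^-1 :> R by lra.
  rewrite -scalerDr scaleNr -scalerN opprB addrACA -scalerDr [v0 + v]addrC addrACA subrr addr0.
  have -> : u + u + q *: (v + v) = (2 : R) *: (u + q *: v).
    by rewrite scaler_nat mulr2n scalerDr addrACA.
  by rewrite scalerA mulVf// scale1r wE.
have g3 := p_ge v q (ltW q0); rewrite -wE in g3.
have pw : p w = N u + q * p v by rewrite wE (linear_formD _ _ pl) (linear_formZ _ _ pl) pu.
clear pP p_uniq p_ge small pN pD pZ pdd pN0 pabs cF dd uS.
by rewrite pw => g4; apply/eqP; rewrite eq_le; apply/andP; split; lra.
Qed.

End Boundary.

(** * Countability of the norming functionals *)

Section CountableBoundary.
Variables (R : realType) (X : completeNormedModType R) (N : X -> R) (b : R).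
Hypotheses (sN : seminorm N) (b0 : 0 < b) (Nb : forall x, N x <= b * `|x|).
Hypothesis N0 : forall x, N x = 0 -> x = 0.
Hypothesis affine : forall x y : X, exists2 t0 : R, 0 < t0 & forall t, 0 <= t <= t0 ->
  N (x + t *: y) = N x + t * ((N (x + t0 *: y) - N x) / t0).

Lemma linear_form_eq_near (h h' : X -> R) (u : X) (e : R) : 0 < e ->
  linear_form h -> linear_form h' -> (forall v, ball u e v -> h v = h' v) -> h = h'.
Proof.
move=> e0 hl hl' hh; apply/funext => v.
have v1 : 0 < `|v| + 1 by have := normr_ge0 v; lra.
have t0 : 0 < e / (`|v| + 1) / 2 by rewrite !divr_gt0.
set t := e / _ / 2 in t0.
have tv : t * (`|v| + 1) = e / 2 by rewrite /t mulrAC divfK// gt_eqF.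
have := hh u (ballxx _ e0); have := hh (u + t *: v).
rewrite -ball_normE /= opprD addrA subrr add0r normrN normrZ gtr0_norm// => h1 h2.
have : t * `|v| < e by lra.
move=> /h1; rewrite !(linear_formD _ _ hl) !(linear_formD _ _ hl') (linear_formZ _ _ hl) (linear_formZ _ _ hl') h2 => /addrI.
by move=> /(mulfI (lt0r_neq0 t0)).
Qed.

(** Linear forms that agree on a ball are equal, so at most one form coincides with [N] near [d n].
    Given [x], choose [u] such that [N] lies above its chord on the segment from [x] to [u] and
    equals a form [h] near [u]; the chord inequality carries the equality back to [x], and [h] is
    the form of any [d n] close enough to [u]. *)
Lemma ex_countable_boundary (d : nat -> X) :
  (forall (x : X) (e : R), 0 < e -> exists n, `|x - d n| < e) ->
  exists hs : nat -> X -> R, [/\ forall n, linear_form (hs n), forall n v, `|hs n v| <= N v &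
    forall x, exists n, hs n x = N x].
Proof.
move=> dd.
pose good n (h : X -> R) := linear_form h /\ exists2 e : R, 0 < e & forall v, ball (d n) e v -> N v = h v.
have /choice[hs hsP] : forall n, exists h, [/\ linear_form h, forall v, `|h v| <= N v &
    forall h', good n h' -> (forall v, `|h' v| <= N v) -> h = h'].
  move=> n; have [[h [hl [e e0 he]] hN]|none] := pselect (exists2 h, good n h & forall v, `|h v| <= N v).
    exists h; split=> // h' [hl' [e' e0' he']] _.
    have m0 : 0 < Order.min e e' by rewrite lt_min e0.
    apply: (linear_form_eq_near m0 hl hl' (u := d n)) => v; rewrite -ball_normE /= lt_min => /andP[v1 v2].
    by rewrite -he -?he'// -ball_normE.
  (* Default where no form bounded by [N] agrees with [N] near [d n]. *)
  exists (fun=> 0); split=> [a u v|v|h' gh' hN'].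
  - by rewrite mulr0 addr0.
  - by rewrite normr0; exact: seminorm_ge0.
  - by case: none; exists h'.
exists hs; split=> [n|n v|x]; [by case: (hsP n)|by case: (hsP n)|].
have [u0 [r r0 seg]] := ex_affine_segments sN b0 Nb affine x.
have [u [h [uB hl hN [e e0 he]]]] := ex_local_form sN b0 Nb affine u0 dd r0.
have hx : h x = N x.
  have xu1 : 0 < `|x - u| + 1 by have := normr_ge0 (x - u); lra.
  (* So small that [u + t *: (x - u)], a point of the segment from [x] to [u], is in the ball where
     [N] equals [h]. *)
  pose t := Order.min 1 (e / (`|x - u| + 1) / 2).
  have t0 : 0 < t by rewrite lt_min ltr01 !divr_gt0.
  have t1 : t <= 1 by rewrite ge_min lexx.
  have te : t * (`|x - u| + 1) <= e / 2.
    by rewrite -ler_pdivlMr// mulrAC ge_min lexx orbT.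
  have := seg u uB (1 - t) _; rewrite subKr.
  have -> : x + (1 - t) *: (u - x) = u + t *: (x - u).
    rewrite scalerBl scale1r addrA [x + (u - x)]addrC subrK -scalerN opprB.
    by [].
  rewrite (he u (ballxx _ e0)) (he (u + t *: (x - u))); last first.
    rewrite -ball_normE /= opprD addrA subrr add0r normrN normrZ gtr0_norm//.
    by lra.
  rewrite (linear_formD _ _ hl) (linear_formZ _ _ hl) (linear_formB _ _ hl).
  have -> : 0 <= 1 - t <= 1 by apply/andP; split; lra.
  move=> /(_ isT) h1; apply/eqP; rewrite eq_le; apply/andP; split.
    exact: le_trans (ler_norm _) (hN x).
  by rewrite -(ler_pM2l t0); lra.
have e2 : 0 < e / 2 by rewrite divr_gt0.
have [n nu] := dd u _ e2; exists n; rewrite -hx; congr (_ x).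
have [_ _ /(_ h)] := hsP n; apply=> //; split=> //; exists (e / 2) => // v.
rewrite -ball_normE /= => nv; apply: he; rewrite -ball_normE /=.
have := ler_normD (u - d n) (d n - v); rewrite addrA subrK.
by lra.
Qed.

Lemma ex_common_zero (hs : nat -> X -> R) n : (forall n, linear_form (hs n)) ->
  ~ finite_dim [set: X] -> exists2 k, N k = 1 & forall i, (i < n)%N -> hs i k = 0.
Proof.
move=> hl nfd; have [u _ ind] := ex_independent n.+1 nfd.
have [c [i ci] cA] := ex_kernel (fun i (j : 'I_n) => hs j (u i)).
pose v := \sum_i c i *: u i.
have v0 : 0 < N v.
  rewrite lt_neqAle (seminorm_ge0 sN) andbT eq_sym; apply/eqP => /N0 /ind /(_ i)/eqP.
  exact/negP.
exists ((N v)^-1 *: v).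
  by rewrite (seminormZ sN) ger0_norm ?invr_ge0 ?(ltW v0)// mulVf// gt_eqF.
move=> j jn; rewrite (linear_formZ _ _ (hl j)) (linear_form_lc _ _ (hl j)).
by rewrite (cA (Ordinal jn)) mulr0.
Qed.

End CountableBoundary.

(** * The two implications *)

Section Implications.
Variable R : realType.

Lemma nneseries_ltyP (f : nat -> R) : (forall n, 0 <= f n) ->
  (\sum_(n <oo) (f n)%:E < +oo)%E <-> exists V : R, forall n, \sum_(i < n) f i <= V.
Proof.
move=> f0; have f0' n : (0 <= (f n)%:E)%E by rewrite lee_fin.
split=> [fin|[V VP]].
  exists (fine (\sum_(n <oo) (f n)%:E)%E) => n.
  rewrite -lee_fin fineK; last first.
    rewrite ge0_fin_numE//; exact: nneseries_ge0.
  rewrite -sumEFin -(big_mkord xpredT (fun i => (f i)%:E)).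
  by apply: nneseries_lim_ge => i _ _.
apply: (@le_lt_trans _ _ V%:E); last exact: ltry.
apply: lime_le; first by apply: is_cvg_nneseries => n _ _.
by apply: nearW => n; rewrite big_mkord sumEFin lee_fin.
Qed.

(** Since the supremum over [E] is attained, each property of [N] is checked on a single
    functional. *)
Lemma iso_precisely_norming_norm (X : normedModType R) (E : set (X -> R)) :
  iso_precisely_norming E -> exists N : X -> R, exists2 C : R, 0 < C &
    [/\ seminorm N, forall x, `|x| <= C * N x, forall x, N x <= C * `|x|,
        forall e, E e -> linear_form e &
        (forall e, E e -> forall x, `|e x| <= N x) /\ forall x, exists2 e, E e & `|e x| = N x].
Proof.
move=> [Ed [C [C1 [EC [Ex Eatt]]]]]; have C0 : 0 < C by lra.
have El e : E e -> linear_form e by move=> /Ed[].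
pose N x := sup [set `|e x| | e in E].
have EN e : E e -> forall x, `|e x| <= N x.
  move=> Ee x; apply: ub_le_sup; last by exists e.
  by exists (C * `|x|) => _ [e' Ee' <-]; exact: EC.
have NP x (c : R) : (forall e, E e -> `|e x| <= c) -> N x <= c.
  by move=> h; have [e Ee ex] := Eatt x; have -> : N x = `|e x| by []; exact: h.
exists N, C => //; split => //.
- split=> [u v|a u].
    apply: NP => e Ee; rewrite (linear_formD _ _ (El _ Ee)).
    by apply: le_trans (ler_normD _ _) _; rewrite lerD// EN.
  have [e Ee eu] := Eatt u; have [e' Ee' eau] := Eatt (a *: u).
  have {}eu : N u = `|e u| by [].
  have {}eau : N (a *: u) = `|e' (a *: u)| by [].
  apply/eqP; rewrite eq_le; apply/andP; split.
    by rewrite eau (linear_formZ _ _ (El _ Ee')) normrM ler_wpM2l// EN.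
  by rewrite eu -normrM -(linear_formZ _ _ (El _ Ee)) EN.
- by move=> x; have := Ex x; rewrite ler_pdivrMr// mulrC.
- by move=> x; apply: NP => e Ee; exact: EC.
Qed.

Lemma linear_form_is_dual (X : normedModType R) (e : X -> R) (b : R) : 0 < b ->
  linear_form e -> (forall x, `|e x| <= b * `|x|) -> is_dual e.
Proof.
move=> b0 el eb; split=> // x; apply/cvgrPdist_le => eps e0; near=> y.
rewrite -(linear_formB _ _ el); apply: le_trans (eb _) _.
rewrite mulrC -ler_pdivlMr//; near: y.
by apply: (@cvgr_dist_le _ _ _ (nbhs x) _ id x) => //; rewrite divr_gt0.
Unshelve. all: end_near. Qed.

Lemma separable_dense_sequence (X : normedModType R) : separable_space X ->
  exists d : nat -> X, forall (x : X) (e : R), 0 < e -> exists n, `|x - d n| < e.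
Proof.
move=> [D [/countable_injP[f finj] cD]].
exists (fun n => xget 0 [set p | D p /\ f p = n]) => x e e0.
have : closure D x by rewrite cD.
move=> /(_ _ (nbhsx_ballx x _ e0))[p [Dp]]; rewrite -ball_normE /= => xp.
exists (f p); have [Dq fq] := @xgetPex _ 0 [set q | D q /\ f q = f p] (ex_intro _ p (conj Dp erefl)).
by rewrite (finj _ _ (mem_set Dq) (mem_set Dp) fq).
Qed.

Lemma forward (X : completeNormedModType R) (x : nat -> X) (E : set (X -> R)) :
  ~ cvgn x -> iso_precisely_norming E ->
  (forall e, E e -> (\sum_(n <oo) (`|e (x n.+1 - x n)|)%:E < +oo)%E) ->
  exists phi : nat -> nat, {homo phi : m n / (m < n)%N >-> (m < n)%N} /\
    iso_polyhedral (clspan (range (x \o phi))).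
Proof.
move=> ncv /iso_precisely_norming_norm[N [C C0 [sN CN NC El [EN Eatt]]]] xE.
have xV e : E e -> finite_variation (e \o x).
  move=> Ee; have [V VP] := (nneseries_ltyP (fun n => normr_ge0 (e (x n.+1 - x n)))).1 (xE e Ee).
  exists V => n; apply: le_trans (VP n); apply: ler_sum => i _ /=.
  by rewrite (linear_formB _ _ (El e Ee)).
have [[B xB]|unb] := pselect (exists B, forall n, N (x n) <= B).
  exact: (forward_bounded sN C0 CN NC El EN Eatt ncv xV xB).
exact: (forward_unbounded sN C0 CN NC El EN Eatt xV unb).
Qed.

Lemma converse (Y : completeNormedModType R) : separable_space Y -> iso_polyhedral [set: Y] ->
  exists (x : nat -> Y) (E : set (Y -> R)), ~ cvgn x /\ iso_precisely_norming E /\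
    clspan (range x) = setT /\
    (forall e, E e -> (\sum_(n <oo) (`|e (x n.+1 - x n)|)%:E < +oo)%E).
Proof.
move=> /separable_dense_sequence[d dd] [N [ND [NZ [[a [b [a0 [b0 ab]]]] [nfd poly]]]]].
have sN : seminorm N by split=> [u v|c u]; [exact: ND|exact: NZ].
have aN x : a * `|x| <= N x by have [] := ab x Logic.I.
have Nb x : N x <= b * `|x| by have [] := ab x Logic.I.
have N0 x : N x = 0 -> x = 0.
  move=> Nx; apply/eqP; rewrite -normr_le0 -(ler_pM2l a0) mulr0 -Nx; exact: aN.
have poly' n (v : 'I_n -> Y) := poly n v (fun=> Logic.I).
have affine := polyhedral_affine sN N0 poly'.
have [hs [hl hN hx]] := ex_countable_boundary sN b0 Nb affine dd.
have /choice[k kP] : forall n, exists k, N k = 1 /\ forall i, (i < n)%N -> hs i k = 0.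
  by move=> n; have [k] := ex_common_zero sN N0 n hl nfd; exists k.
pose c n : R := 2^-1 ^+ n / (1 + N (d n)).
have d1 n : 0 < 1 + N (d n) by have := seminorm_ge0 sN (d n); lra.
have c0 n : 0 < c n by rewrite divr_gt0// exprn_gt0.
(* The even terms tend to 0 and their span contains every [d n]; the odd ones have [N] equal to 1,
   so the sequence diverges. Every functional is summable over the even terms, and [hs i] vanishes
   at [k n] for [n > i]. *)
pose x m := if odd m then k m./2 else c m./2 *: d m./2.
have xe n : x n.*2 = c n *: d n by rewrite /x odd_double doubleK.
have xo n : x n.*2.+1 = k n by rewrite /x /= odd_double /= uphalf_double.
have cN n : N (c n *: d n) <= 2^-1 ^+ n.
  rewrite (seminormZ sN) gtr0_norm// /c mulrAC ler_pdivrMr// ler_wpM2l ?exprn_ge0//.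
  by lra.
exists x, (range hs); split; [|split; [|split]].
- move=> /cvg_ex[l /cvgrPdist_lt xl].
  have e0 : 0 < (8 * b)^-1 by rewrite invr_gt0 mulr_gt0.
  have [M _ MP] := xl _ e0.
  (* [n >= 1] gives [N (c n *: d n) <= 1 / 2]; the tolerance [1 / (8 * b)] adds at most [1 / 4],
     against [N (k n) = 1]. *)
  pose n := maxn M 1.
  have Mn : (M <= n.*2)%N by rewrite -addnn (leq_trans (leq_maxl M 1))// leq_addr.
  have h1 := MP _ Mn; have h2 := MP _ (leq_trans Mn (leqnSn _)).
  rewrite /= xe in h1; rewrite /= xo in h2.
  have : N (k n) <= N (c n *: d n) + b * ((8 * b)^-1 + (8 * b)^-1).
    apply: le_trans (seminorm_le_sub sN (k n) (c n *: d n)) _; rewrite lerD2l.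
    apply: le_trans (Nb _) _; rewrite ler_wpM2l ?(ltW b0)//.
    have := ler_normB (l - c n *: d n) (l - k n).
    by rewrite opprB [_ + (k n - l)]addrC addrA subrK; lra.
  have -> : b * ((8 * b)^-1 + (8 * b)^-1) = 4^-1 by field; rewrite gt_eqF.
  rewrite (kP n).1; have := cN n.
  have : (2^-1 : R) ^+ n <= 2^-1 ^+ 1 by rewrite ler_wiXn2l// ?leq_maxr//; lra.
  rewrite expr1; lra.
- have hC : forall e, range hs e -> linear_form e /\ forall v, `|e v| <= N v.
    by move=> _ [n _ <-].
  have supE y : sup [set `|e y| | e in range hs] = N y.
    apply/eqP; rewrite eq_le; apply/andP; split.
      apply: ge_sup; first by exists `|hs 0%N y|, (hs 0%N) => //; exists 0%N.
      by move=> _ [e [n _ <-] <-].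
    have [n hn] := hx y; apply: ub_le_sup.
      by exists (N y) => _ [e [m _ <-] <-].
    by exists (hs n); [exists n|rewrite hn ger0_norm// (seminorm_ge0 sN)].
  split=> [e /hC[el eN]|].
    by apply: (linear_form_is_dual b0 el) => y; exact: le_trans (eN y) (Nb y).
  have ai : 0 < a^-1 by rewrite invr_gt0.
  exists (1 + b + a^-1); split; first by lra.
  split; [|split].
  + move=> e /hC[_ eN] y; apply: le_trans (eN y) _; apply: le_trans (Nb y) _.
    by rewrite ler_wpM2r//; lra.
  + move=> y; rewrite supE ler_pdivrMr; last by lra.
    have : `|y| <= N y * a^-1 by rewrite ler_pdivlMr// mulrC.
    by move=> /le_trans; apply; rewrite ler_wpM2l ?(seminorm_ge0 sN)//; lra.
  + move=> y; have [n hn] := hx y; exists (hs n); first by exists n.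
    by rewrite supE hn ger0_norm// (seminorm_ge0 sN).
- apply/seteqP; split=> // y _; rewrite clspan_nclosure => e e0.
  have [n yn] := dd y _ e0; exists (d n) => //.
  have -> : d n = (c n)^-1 *: x n.*2 by rewrite xe scalerA mulVf ?scale1r// gt_eqF.
  by apply: (lsubspaceZ _ (lsubspace_lspan _)); apply: subset_lspan; exists n.*2.
- move=> _ [i _ <-]; apply/nneseries_ltyP; first by move=> n; exact: normr_ge0.
  (* The even terms contribute at most the geometric sum 2; of the odd terms only [k 0], ..., [k i]
     survive, each contributing at most 1. *)
  have sumx n : \sum_(m < n) `|hs i (x m)| <= 2 + i.+1%:R.
    apply: (@le_trans _ _ (\sum_(m < n.*2) `|hs i (x m)|)).
      have nn : (n <= n.*2)%N by rewrite -addnn leq_addr.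
      rewrite -!(big_mkord xpredT (fun m => `|hs i (x m)|)) [leRHS](@big_cat_nat _ _ _ n 0)//=.
      by rewrite lerDl sumr_ge0.
    have -> : \sum_(m < n.*2) `|hs i (x m)| = \sum_(m < n) `|hs i (c m *: d m)| + \sum_(m < n) `|hs i (k m)|.
      elim: n => [|n IH]; first by rewrite !big_ord0 addr0.
      by rewrite doubleS !big_ord_recr /= IH xe xo; ring.
    apply: lerD.
      apply: le_trans (sum_geom R n); apply: ler_sum => m _.
      exact: le_trans (hN _ _) (cN m).
    apply: (@le_trans _ _ (minn n i.+1)%:R); last by rewrite ler_nat geq_minr.
    elim: n => [|n IH]; first by rewrite big_ord0.
    rewrite big_ord_recr /=; have [ni|ni] := leqP n i; last first.
      rewrite (kP n).2// normr0 addr0; apply: le_trans IH _; rewrite ler_nat.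
      by rewrite leq_min geq_minr andbT; apply: leq_trans (geq_minl _ _) (leqnSn _).
    rewrite minnSS (minn_idPl ni) -natr1 lerD//.
      by apply: le_trans IH _; rewrite ler_nat geq_minl.
    by apply: le_trans (hN _ _) _; rewrite (kP n).1.
  exists (2 * (2 + i.+1%:R)) => n.
  apply: (@le_trans _ _ (\sum_(m < n) `|hs i (x m.+1)| + \sum_(m < n) `|hs i (x m)|)).
    rewrite -big_split; apply: ler_sum => m _ /=.
    by rewrite (linear_formB _ _ (hl i)); exact: ler_normB.
  have := sumx n; have := sumx n.+1; rewrite big_ord_recl /=.
  have := normr_ge0 (hs i (x 0%N)).
  by lra.
Qed.

End Implications.

Theorem theorem1p4 (R : realType) :
  (forall (X : completeNormedModType R) (x : nat -> X) (E : set (X -> R)),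
     ~ cvgn x ->
     iso_precisely_norming E ->
     (forall e, E e -> (\sum_(n <oo) (`|e (x n.+1 - x n)|)%:E < +oo)%E) ->
     exists phi : nat -> nat,
       {homo phi : m n / (m < n)%N >-> (m < n)%N} /\
       iso_polyhedral (clspan (range (x \o phi))))
  /\
  (forall Y : completeNormedModType R,
     separable_space Y -> iso_polyhedral (@setT Y) ->
     exists (x : nat -> Y) (E : set (Y -> R)),
       ~ cvgn x /\ iso_precisely_norming E /\
       clspan (range x) = setT /\
       (forall e, E e -> (\sum_(n <oo) (`|e (x n.+1 - x n)|)%:E < +oo)%E)).
Proof.
split; [exact: forward|exact: converse].
Qed.
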